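(* Let $\mathcal G_5$ be the class of graphs with at most $5$ vertices. The class $\mathrm{co}(\mathcal G_5)$ is tractable, superrigid, and $\mathrm{Qu}(\mathrm{co}(\mathcal G_5))=\mathrm{Jor}(\mathrm{Qu}(\mathcal G_5))$.
   Context: Graphs are finite, simple and undirected, with at least one vertex, considered up to isomorphism (so $G=H$ means isomorphic). For a class $\mathcal F$ of graphs, $\mathrm{co}(\mathcal F)$ is the smallest class of graphs containing $\mathcal F$ and stable under finite disjoint unions and complement. A magic unitary with coefficients in a nonzero unital $C^*$-algebra $X$ is a square matrix whose entries are self-adjoint projections of $X$ with every row and column summing to $1_X$. $G$ and $H$ (with equally many vertices) are quantum isomorphic if there is a magic unitary $U$, with coefficients in some nonzero unital $C^*$-algebra, rows indexed by $V(H)$ and columns by $V(G)$, with $U\,\mathrm{Adj}(G)=\mathrm{Adj}(H)\,U$ ($\mathrm{Adj}$ = adjacency matrix). A quantum permutation group of size $n$ is a pair $\Gamma=(\mathcal A,p)$ where $\mathcal A=\mathcal O(\Gamma)$ is a unital complex $*$-algebra generated by $p=(p_{ij})_{1\le i,j\le n}$ satisfying relations ($\mathcal P_s$): $p_{ij}^*=p_{ij}=p_{ij}^2$, $\sum_j p_{ij}=1=\sum_j p_{ji}$, $p_{ij}p_{ik}=0=p_{ji}p_{ki}$ for $j\neq k$, and such that there is a unital $*$-morphism $\Delta:\mathcal A\to\mathcal A\otimes\mathcal A$ (algebraic tensor product) with $\Delta(p_{ij})=\sum_k p_{ik}\otimes p_{kj}$. Quantum permutation groups are identified when isomorphic, i.e.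 when there is a $*$-isomorphism of the algebras intertwining the comultiplications $\Delta$. $S_n^+$ is the quantum permutation group whose algebra is universal for ($\mathcal P_s$). $\mathrm{Qu}(G)$ is the quantum permutation group whose algebra $\mathcal O(\mathrm{Qu}(G))$ is the universal unital $*$-algebra generated by $u=(u_{xy})_{x,y\in V(G)}$ with relations ($\mathcal P_s$) and $u\,\mathrm{Adj}(G)=\mathrm{Adj}(G)\,u$; $C(\mathrm{Qu}(G))$ is its universal enveloping $C^*$-algebra. $\mathrm{Qu}(G)$ is trivial if $\mathcal O(\mathrm{Qu}(G))=\mathbb C$; $G$ has quantum symmetry if $C(\mathrm{Qu}(G))$ is not commutative. $\mathrm{Qu}(\mathcal F)=\{\mathrm{Qu}(G)\mid G\in\mathcal F\}$. $G$ satisfies Schmidt's criterion if it has two nontrivial automorphisms with disjoint supports ($\mathrm{Supp}(f)=\{x\mid f(x)\ne x\}$). A class $\mathcal F$ is tractable if: (QA) for all $G\in\mathcal F$, $\mathrm{Qu}(G)$ is trivial iff $\mathrm{Aut}(G)$ is trivial; (QI) for all $G,H\in\mathcal F$, $G$ and $H$ are quantum isomorphic iff $G=H$; (SA) for all $G\in\mathcal F$, $G$ has quantum symmetry iff $G$ satisfies Schmidt's criterion. It is superrigid if, whenever $G\in\mathcal F$ and $H$ is any graph quantum isomorphic to $G$, one has $G=H$. The free product of $(\mathcal A,p)$ and $(\mathcal B,q)$ is $(\mathcal A*\mathcal B,\mathrm{Diag}(p,q))$ with $*$ the unital free product of $*$-algebras. The wreath product $(\mathcal A,u)\wr S_n^+$,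 for $(\mathcal A,u)$ of size $m$ and $S_n^+=(\mathcal S,p)$, has algebra $\mathcal A^{*n}*\mathcal S$ modulo the ideal generated by the commutators $[\nu_i(a),p_{ij}]$ ($a\in\mathcal A$, $1\le i,j\le n$), where $\nu_i:\mathcal A\to\mathcal A^{*n}$ is the $i$-th inclusion, and fundamental representation of size $mn$ with coefficients $w_{ij,kl}=\nu_i(u_{kl})p_{ij}$ (row $(i,k)$, column $(j,l)$). For a family $\mathcal Q$ of quantum permutation groups, $\mathrm{Jor}(\mathcal Q)$ is the smallest family of quantum permutation groups containing $\mathcal Q$ and stable under free product and under wreath product with $S_n^+$ for every $n\ge1$. *)

(* Defs.v *)
From HB Require Import structures.
From mathcomp Require Import all_boot all_order all_algebra perm generic_quotient.
From mathcomp Require Import boolp reals complex.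

Set Implicit Arguments.
Unset Strict Implicit.
Unset Printing Implicit Defensive.

Import Order.TTheory GRing.Theory Num.Theory.

Local Open Scope ring_scope.
Local Open Scope quotient_scope.

(* Everything is parameterized by a field [C : numClosedFieldType]; the       *)
(* theorem takes [C := R[i]] for [R : realType], i.e. the complex numbers.    *)

Record graph := Graph {
  vert : finType;
  edge : rel vert;
  edge_sym : symmetric edge;
  edge_irr : irreflexive edge;
  vert_gt0 : (0 < #|vert|)%N }.

Definition graph_iso (G H : graph) : Prop :=
  exists f : vert G -> vert H,
    bijective f /\ forall x y, edge (f x) (f y) = edge x y.

Definition is_aut (G : graph) (f : {perm vert G}) : Prop :=
  forall x y, edge (f x) (f y) = edge x y.

Definition aut_trivial (G : graph) : Prop :=
  forall f : {perm vert G}, is_aut f -> f = 1%g.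

Definition schmidt (G : graph) : Prop :=
  exists f g : {perm vert G},
    [/\ is_aut f, is_aut g, f <> 1%g, g <> 1%g &
        [disjoint [set x | f x != x] & [set x | g x != x]]].

Section GraphOperations.

Variables G H : graph.

Definition union_edge : rel (vert G + vert H)%type := fun x y =>
  match x, y with
  | inl x, inl y => edge x y
  | inr x, inr y => edge x y
  | _, _ => false
  end.

Fact union_edge_sym : symmetric union_edge.
Proof. by case=> x [] y //=; apply: edge_sym. Qed.

Fact union_edge_irr : irreflexive union_edge.
Proof. by case=> x /=; apply: edge_irr. Qed.

Fact union_vert_gt0 : (0 < #|{: vert G + vert H}|)%N.
Proof. by rewrite card_sum addn_gt0 vert_gt0. Qed.

Definition graph_union : graph :=
  Graph union_edge_sym union_edge_irr union_vert_gt0.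

Definition compl_edge : rel (vert G) := fun x y => (x != y) && ~~ edge x y.

Fact compl_edge_sym : symmetric compl_edge.
Proof. by move=> x y; rewrite /compl_edge eq_sym edge_sym. Qed.

Fact compl_edge_irr : irreflexive compl_edge.
Proof. by move=> x; rewrite /compl_edge eqxx. Qed.

Definition graph_compl : graph :=
  Graph compl_edge_sym compl_edge_irr (vert_gt0 G).

End GraphOperations.

(* Classes of graphs are predicates. Graphs are taken up to isomorphism,      *)
(* hence [co_iso]; graphs are nonempty, so stability under finite disjoint    *)
(* unions is stability under binary ones.                                     *)
Inductive co (F : graph -> Prop) : graph -> Prop :=
| co_base G : F G -> co F G
| co_union G H : co F G -> co F H -> co F (graph_union G H)
| co_compl G : co F G -> co F (graph_compl G)
| co_iso G H : graph_iso G H -> co F G -> co F H.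

Definition graphs_le5 (G : graph) : Prop := (#|vert G| <= 5)%N.

(* The action of the scalars is given by the structure morphism               *)
(* [inC : C -> Z(A)], so that [c] acts as [x |-> inC c * x]. MathComp's        *)
(* [algType] is not used because it excludes the zero algebra, and there is   *)
(* no room in the hierarchy for a structure joining [lmodType] and            *)
(* [pzRingType] below it.                                                     *)
HB.mixin Record PzRing_isStarAlgebra (C : numClosedFieldType) A
    & GRing.PzRing A := {
  inC : C -> A;
  inCD : {morph inC : c d / c + d};
  inCM : {morph inC : c d / c * d};
  inC1 : inC 1 = 1;
  inC_central : forall (c : C) (x : A), inC c * x = x * inC c;
  star : A -> A;
  starK : involutive star;
  starD : {morph star : x y / x + y};
  starM : forall x y, star (x * y) = star y * star x;
  star_inC : forall c : C, star (inC c) = inC c^* }.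

#[short(type="starAlgType")]
HB.structure Definition StarAlgebra (C : numClosedFieldType) :=
  {A of GRing.PzRing A & PzRing_isStarAlgebra C A}.

Arguments inC {C A} : rename.

HB.mixin Record isStarMorphism (C : numClosedFieldType) (A B : starAlgType C)
    (f : A -> B) := {
  starmorph_inC : forall c : C, f (inC c) = inC c;
  starmorph_star : {morph f : x / star x} }.

#[short(type="starMorphism")]
HB.structure Definition StarMorphism (C : numClosedFieldType)
    (A B : starAlgType C) :=
  {f of @GRing.RMorphism A B f & isStarMorphism C A B f}.

(* The norm takes its values in the nonnegative elements of [C], as in        *)
(* MathComp's [normedZmodType C].                                             *)
HB.mixin Record isCStarAlgebra (C : numClosedFieldType) A
    & StarAlgebra C A := {
  cnorm : A -> C;
  cnorm_ge0 : forall x, 0 <= cnorm x;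
  cnorm_eq0 : forall x, cnorm x = 0 -> x = 0;
  cnormD : forall x y, cnorm (x + y) <= cnorm x + cnorm y;
  cnormZ : forall (c : C) x, cnorm (inC c * x) = `|c| * cnorm x;
  cnormM : forall x y, cnorm (x * y) <= cnorm x * cnorm y;
  cnorm_star : forall x, cnorm (star x * x) = cnorm x ^+ 2;
  cnorm_complete : forall u : nat -> A,
    (forall e : C, 0 < e -> exists N, forall m n,
       (N <= m)%N -> (N <= n)%N -> cnorm (u m - u n) < e) ->
    exists l, forall e : C, 0 < e -> exists N, forall n,
       (N <= n)%N -> cnorm (u n - l) < e }.

#[short(type="cstarAlgType")]
HB.structure Definition CStarAlgebra (C : numClosedFieldType) :=
  {A of StarAlgebra C A & isCStarAlgebra C A}.

Section StarMorphisms.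

Variable C : numClosedFieldType.

Definition star_hom (A B : starAlgType C) (f : A -> B) : Prop :=
  [/\ {morph f : x y / x + y}, {morph f : x y / x * y},
      forall c : C, f (inC c) = inC c & {morph f : x / star x}].

Lemma starMorphismP (A B : starAlgType C) (f : starMorphism A B) : star_hom f.
Proof.
by split; [exact: raddfD | exact: rmorphM | exact: starmorph_inC |
           exact: starmorph_star].
Qed.

Lemma inC0 (A : starAlgType C) : inC 0 = 0 :> A.
Proof. by apply: (addrI (inC 0)); rewrite -inCD !addr0. Qed.

Lemma inCN1 (A : starAlgType C) : inC (- 1) = - 1 :> A.
Proof. by apply/eqP; rewrite -addr_eq0 -[X in _ + X]inC1 -inCD addNr inC0. Qed.

Section Build.
Variables (A B : starAlgType C) (f : A -> B) (hf : star_hom f).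

Definition hom_of of star_hom f := f.
Local Notation g := (hom_of hf).

Fact hom_of_nmod : nmod_morphism g.
Proof. by case: hf => fD fM fC fS; split; [rewrite /hom_of -inC0 fC inC0 |]. Qed.
Fact hom_of_monoid : monoid_morphism g.
Proof. by case: hf => fD fM fC fS; split; [rewrite /hom_of -inC1 fC inC1 |]. Qed.
Fact hom_of_inC (c : C) : g (inC c) = inC c.
Proof. by case: hf. Qed.
Fact hom_of_star : {morph g : x / star x}.
Proof. by case: hf. Qed.

HB.instance Definition _ := GRing.isNmodMorphism.Build A B g hom_of_nmod.
HB.instance Definition _ := GRing.isMonoidMorphism.Build A B g hom_of_monoid.
HB.instance Definition _ := isStarMorphism.Build C A B g hom_of_inC hom_of_star.

Definition star_morphism : starMorphism A B := g.

Lemma star_morphismE x : star_morphism x = f x.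
Proof. by []. Qed.
End Build.

Lemma star_hom_comp (A B D : starAlgType C) (f : B -> D) (g : A -> B) :
  star_hom f -> star_hom g -> star_hom (f \o g).
Proof.
move=> [fD fM fC fS] [gD gM gC gS].
by split=> [x y|x y|c|x] /=; rewrite (gD, gM, gC, gS) (fD, fM, fC, fS).
Qed.

Lemma star0 (A : starAlgType C) : star (0 : A) = 0.
Proof. by rewrite -inC0 star_inC rmorph0. Qed.

Lemma star1 (A : starAlgType C) : star (1 : A) = 1.
Proof. by rewrite -inC1 star_inC rmorph1. Qed.

Lemma star_sum (A : starAlgType C) (I : Type) (r : seq I) (P : pred I)
    (F : I -> A) :
  star (\sum_(i <- r | P i) F i) = \sum_(i <- r | P i) star (F i).
Proof. by elim/big_ind2: _ => [|x y u v <- <-|//]; [exact: star0 | exact: starD]. Qed.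

Definition star_subalg (A : starAlgType C) (P : A -> Prop) : Prop :=
  [/\ forall c : C, P (inC c), forall x y, P x -> P y -> P (x + y),
      forall x y, P x -> P y -> P (x * y) & forall x, P x -> P (star x)].

Definition star_generated_by (A : starAlgType C) (S : A -> Prop) : Prop :=
  forall P : A -> Prop, star_subalg P -> (forall x, S x -> P x) ->
  forall x, P x.

End StarMorphisms.

(* [pres rels] is the universal unital *-algebra generated by a family        *)
(* indexed by [X] with relations [rels]: the *-polynomials in [X], two of     *)
(* them being identified when they agree at every family satisfying [rels] in *)
(* any *-algebra. [pres_lift] is the universal property. That the generators  *)
(* satisfy [rels] holds because all the relations used below are equations    *)
(* between *-polynomials; it is proved in each case.                          *)
Inductive star_poly (C X : Type) : Type :=
| SGen of X
| SConst of C
| SAdd of star_poly C X & star_poly C X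
| SMul of star_poly C X & star_poly C X
| SStar of star_poly C X.
Arguments SGen {C X}.
Arguments SConst {C X}.

HB.instance Definition _ (C X : Type) := gen_eqMixin (star_poly C X).
HB.instance Definition _ (C X : Type) := gen_choiceMixin (star_poly C X).

Section Presentation.

Variables (C : numClosedFieldType) (X : Type).

Fixpoint star_eval (A : starAlgType C) (v : X -> A) (t : star_poly C X) : A :=
  match t with
  | SGen x => v x
  | SConst c => inC c
  | SAdd s t => star_eval v s + star_eval v t
  | SMul s t => star_eval v s * star_eval v t
  | SStar t => star (star_eval v t)
  end.

Variable rels : forall A : starAlgType C, (X -> A) -> Prop.

Definition pres_eqv (s t : star_poly C X) : bool :=
  `[< forall (A : starAlgType C) (v : X -> A), rels v ->
      star_eval v s = star_eval v t >].

Fact pres_eqv_equiv : equiv_class_of pres_eqv.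
Proof.
split=> [s|s t|t s u]; first by apply/asboolP.
  by apply/asboolP/asboolP=> h A v /h.
by move=> /asboolP h1 /asboolP h2; apply/asboolP=> A v r; rewrite h1 ?h2.
Qed.

Canonical pres_eqv_rel := EquivRelPack pres_eqv_equiv.

Definition pres : Type := {eq_quot pres_eqv_rel}.
HB.instance Definition _ := Choice.on pres.
HB.instance Definition _ := EqQuotient.on pres.

Implicit Types x y z : pres.

Definition pres_val (A : starAlgType C) (v : X -> A) x : A := star_eval v (repr x).

Lemma pres_valE (A : starAlgType C) (v : X -> A) t :
  rels v -> pres_val v (\pi_pres t) = star_eval v t.
Proof.
move=> rv; rewrite /pres_val; case: piP => s /eqP.
by rewrite eqmodE => /asboolP/(_ A v rv).
Qed.

Lemma pres_eq x y :
  (forall (A : starAlgType C) (v : X -> A), rels v -> pres_val v x = pres_val v y) ->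
  x = y.
Proof.
move=> h; rewrite -[x]reprK -[y]reprK; apply/eqP; rewrite eqmodE.
by apply/asboolP=> A v rv; apply: h.
Qed.

Definition pres_gen (i : X) : pres := \pi_pres (SGen i).
Definition pres_const (c : C) : pres := \pi_pres (SConst c).
Definition pres_add x y : pres := \pi_pres (SAdd (repr x) (repr y)).
Definition pres_mul x y : pres := \pi_pres (SMul (repr x) (repr y)).
Definition pres_star x : pres := \pi_pres (SStar (repr x)).
Definition pres_opp x : pres := pres_mul (pres_const (- 1)) x.

Section Val.
Variables (A : starAlgType C) (v : X -> A) (rv : rels v).
Lemma pres_val_gen i : pres_val v (pres_gen i) = v i.
Proof. exact: pres_valE. Qed.
Lemma pres_val_const c : pres_val v (pres_const c) = inC c.
Proof. exact: pres_valE. Qed.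
Lemma pres_val_add x y : pres_val v (pres_add x y) = pres_val v x + pres_val v y.
Proof. exact: pres_valE. Qed.
Lemma pres_val_mul x y : pres_val v (pres_mul x y) = pres_val v x * pres_val v y.
Proof. exact: pres_valE. Qed.
Lemma pres_val_star x : pres_val v (pres_star x) = star (pres_val v x).
Proof. exact: pres_valE. Qed.
Lemma pres_val_opp x : pres_val v (pres_opp x) = - pres_val v x.
Proof. by rewrite pres_val_mul pres_val_const inCN1 mulN1r. Qed.
End Val.

Definition pres_valW (A : starAlgType C) (v : X -> A) (rv : rels v) :=
  (pres_val_gen rv, pres_val_const rv, pres_val_opp rv, pres_val_add rv,
   pres_val_mul rv, pres_val_star rv).

Local Ltac pres_tac :=
  let A := fresh "A" in let v := fresh "v" in let rv := fresh "rv" in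
  apply: pres_eq; intros A v rv; rewrite !(pres_valW rv).

Fact pres_addA : associative pres_add.
Proof. by move=> x y z; pres_tac; rewrite addrA. Qed.
Fact pres_addC : commutative pres_add.
Proof. by move=> x y; pres_tac; rewrite addrC. Qed.
Fact pres_add0 : left_id (pres_const 0) pres_add.
Proof. by move=> x; pres_tac; rewrite inC0 add0r. Qed.
Fact pres_addN : left_inverse (pres_const 0) pres_opp pres_add.
Proof. by move=> x; pres_tac; rewrite inC0 addNr. Qed.

HB.instance Definition _ :=
  GRing.isZmodule.Build pres pres_addA pres_addC pres_add0 pres_addN.

Fact pres_mulA : associative pres_mul.
Proof. by move=> x y z; pres_tac; rewrite mulrA. Qed.
Fact pres_mul1 : left_id (pres_const 1) pres_mul.
Proof. by move=> x; pres_tac; rewrite inC1 mul1r. Qed.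
Fact pres_mulr1 : right_id (pres_const 1) pres_mul.
Proof. by move=> x; pres_tac; rewrite inC1 mulr1. Qed.
Fact pres_mulDl : left_distributive pres_mul pres_add.
Proof. by move=> x y z; pres_tac; rewrite mulrDl. Qed.
Fact pres_mulDr : right_distributive pres_mul pres_add.
Proof. by move=> x y z; pres_tac; rewrite mulrDr. Qed.

HB.instance Definition _ := GRing.Zmodule_isPzRing.Build pres
  pres_mulA pres_mul1 pres_mulr1 pres_mulDl pres_mulDr.

Fact pres_constD : {morph pres_const : c d / c + d}.
Proof. by move=> c d; pres_tac; rewrite inCD. Qed.
Fact pres_constM : {morph pres_const : c d / c * d}.
Proof. by move=> c d; pres_tac; rewrite inCM. Qed.
Fact pres_const_central c x : pres_const c * x = x * pres_const c.
Proof. by pres_tac; rewrite inC_central. Qed.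
Fact pres_starK : involutive pres_star.
Proof. by move=> x; pres_tac; rewrite starK. Qed.
Fact pres_starD : {morph pres_star : x y / x + y}.
Proof. by move=> x y; pres_tac; rewrite starD. Qed.
Fact pres_starM x y : pres_star (x * y) = pres_star y * pres_star x.
Proof. by pres_tac; rewrite starM. Qed.
Fact pres_star_const c : pres_star (pres_const c) = pres_const c^*.
Proof. by pres_tac; rewrite star_inC. Qed.

HB.instance Definition _ := PzRing_isStarAlgebra.Build C pres
  pres_constD pres_constM erefl pres_const_central
  pres_starK pres_starD pres_starM pres_star_const.

Definition pres_alg : starAlgType C := pres.

Lemma pres_alg_eq (x y : pres_alg) :
  (forall (A : starAlgType C) (v : X -> A), rels v -> pres_val v x = pres_val v y) ->
  x = y.
Proof. exact: pres_eq. Qed.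

Lemma pres_val_hom (A : starAlgType C) (v : X -> A) :
  rels v -> star_hom (pres_val v : pres_alg -> A).
Proof.
by move=> rv; split=> [x y|x y|c|x]; rewrite (pres_valW rv).
Qed.

Definition pres_lift (A : starAlgType C) (v : X -> A) (rv : rels v) :
  starMorphism pres_alg A := star_morphism (pres_val_hom rv).

Lemma pres_liftE (A : starAlgType C) (v : X -> A) (rv : rels v) i :
  pres_lift rv (pres_gen i) = v i.
Proof. exact: pres_val_gen. Qed.

Lemma pres_generated :
  star_generated_by (fun x : pres_alg => exists i, x = pres_gen i).
Proof.
move=> P [PC PD PM PS] Pg x; rewrite -[x]reprK; elim: (repr x) => {x}.
- by move=> i; apply: Pg; exists i.
- exact: PC.
- move=> s Ps t Pt.
  rewrite (_ : \pi_pres _ = (\pi_pres s : pres_alg) + \pi_pres t); first exact: PD.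
  by pres_tac; rewrite !pres_valE.
- move=> s Ps t Pt.
  rewrite (_ : \pi_pres _ = (\pi_pres s : pres_alg) * \pi_pres t); first exact: PM.
  by pres_tac; rewrite !pres_valE.
- move=> s Ps; rewrite (_ : \pi_pres _ = star (\pi_pres s : pres_alg)); first exact: PS.
  by pres_tac; rewrite !pres_valE.
Qed.

End Presentation.

Lemma pres_gen_hom (C : numClosedFieldType) (X : Type)
    (rels : forall A : starAlgType C, (X -> A) -> Prop) (A : starAlgType C)
    (f : A -> X) :
  (forall (B : starAlgType C) (v : X -> B), rels B v -> star_hom (v \o f)) ->
  star_hom (fun a => pres_gen rels (f a) : pres_alg rels).
Proof.
move=> h; split=> [x y|x y|c|x]; apply: pres_alg_eq => B v rv;
rewrite !(pres_valW rv); have [fD fM fC fS] := h B v rv;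
by [exact: fD | exact: fM | exact: fC | exact: fS].
Qed.

Section StarHomTheory.

Variable C : numClosedFieldType.

Lemma star_subalg_sum (A : starAlgType C) (P : A -> Prop) (I : finType)
    (F : I -> A) :
  star_subalg P -> (forall i, P (F i)) -> P (\sum_i F i).
Proof.
move=> [PC PD _ _] PF; by apply: big_ind => //; rewrite -(inC0 A); apply: PC.
Qed.

Lemma star_subalg_preim (A B : starAlgType C) (f : A -> B) (P : B -> Prop) :
  star_hom f -> star_subalg P -> star_subalg (P \o f).
Proof.
move=> [fD fM fC fS] [PC PD PM PS].
by split=> /= [c|x y Px Py|x y Px Py|x Px]; rewrite (fC, fD, fM, fS); auto.
Qed.

Lemma star_subalg_commute (A B : starAlgType C) (f : A -> B) (e : B) :
  star_hom f -> star e = e -> star_subalg (fun x => f x * e = e * f x).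
Proof.
move=> [fD fM fC fS] eS; split=> [c|x y hx hy|x y hx hy|x hx].
- by rewrite fC inC_central.
- by rewrite fD mulrDl mulrDr hx hy.
- by rewrite fM -mulrA hy mulrA hx mulrA.
- by rewrite fS -{1}eS -starM -hx starM eS.
Qed.

Lemma star_hom1 (A B : starAlgType C) (f : A -> B) : star_hom f -> f 1 = 1.
Proof. by move=> hf; rewrite -[f]/(hom_of hf : A -> B) rmorph1. Qed.

Lemma star_hom_sumE (A B : starAlgType C) (f : A -> B) (I : finType)
    (F : I -> A) : star_hom f -> f (\sum_i F i) = \sum_i f (F i).
Proof. by move=> hf; rewrite -[f]/(hom_of hf : A -> B) rmorph_sum. Qed.

Lemma star_hom_glue (A B : starAlgType C) (I : finType) (f : I -> A -> B)
    (e : I -> B) :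
  (forall i, star_hom (f i)) -> (forall i, star (e i) = e i) ->
  (forall i j, e i * e j = if i == j then e i else 0) -> \sum_i e i = 1 ->
  (forall i a, f i a * e i = e i * f i a) ->
  star_hom (fun a => \sum_i f i a * e i).
Proof.
move=> fh eS eM e1 fe; split=> [x y|x y|c|x].
- by rewrite -big_split; apply: eq_bigr => i _; case: (fh i) => -> *; rewrite mulrDl.
- rewrite mulr_suml; apply: eq_bigr => i _.
  rewrite mulr_sumr (bigD1 i) //= big1 ?addr0.
    rewrite -mulrA [e i * _]mulrA -fe -[f i y * _ * _]mulrA eM eqxx mulrA.
    by case: (fh i) => _ ->.
  move=> j ne_ji; rewrite (fe j) mulrA -[f i x * _ * _]mulrA eM.
  by rewrite eq_sym (negbTE ne_ji) mulr0 mul0r.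
- rewrite -[RHS]mulr1 -e1 mulr_sumr; apply: eq_bigr => i _.
  by case: (fh i) => _ _ ->.
- rewrite star_sum; apply: eq_bigr => i _.
  by rewrite fe starM eS; case: (fh i) => _ _ _ ->.
Qed.

End StarHomTheory.

Section Constructions.

Variable C : numClosedFieldType.

(* Bilinearity makes the symbols [a (x) b] span, so that this *-algebra is    *)
(* the vector space tensor product of [A] and [B] with its usual structure.   *)
Record tens_rels (A B T : starAlgType C) (t : A * B -> T) : Prop := TensRels {
  tens_relDl : forall a a' b, t (a + a', b) = t (a, b) + t (a', b);
  tens_relDr : forall a b b', t (a, b + b') = t (a, b) + t (a, b');
  tens_relZl : forall (c : C) a b, t (inC c * a, b) = inC c * t (a, b);
  tens_relZr : forall (c : C) a b, t (a, inC c * b) = inC c * t (a, b);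
  tens_rel1 : t (1, 1) = 1;
  tens_relM : forall a a' b b', t (a * a', b * b') = t (a, b) * t (a', b');
  tens_relS : forall a b, t (star a, star b) = star (t (a, b)) }.

Definition tens (A B : starAlgType C) : starAlgType C :=
  pres_alg (@tens_rels A B).

Definition tensor (A B : starAlgType C) (a : A) (b : B) : tens A B :=
  pres_gen (@tens_rels A B) (a, b).

Section Tensor.
Variables A B : starAlgType C.
Implicit Types (a : A) (b : B).

Local Ltac tens_tac h :=
  let T := fresh "T" in let v := fresh "v" in let rv := fresh "rv" in
  apply: pres_alg_eq; intros T v rv; rewrite !(pres_valW rv); apply: (h _ _ _ _ rv).

Lemma tensDl a a' b : tensor (a + a') b = tensor a b + tensor a' b.
Proof. tens_tac tens_relDl. Qed.
Lemma tensDr a b b' : tensor a (b + b') = tensor a b + tensor a b'.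
Proof. tens_tac tens_relDr. Qed.
Lemma tensZl (c : C) a b : tensor (inC c * a) b = inC c * tensor a b.
Proof. tens_tac tens_relZl. Qed.
Lemma tensZr (c : C) a b : tensor a (inC c * b) = inC c * tensor a b.
Proof. tens_tac tens_relZr. Qed.
Lemma tens1 : tensor 1 1 = 1 :> tens A B.
Proof.
by apply: pres_alg_eq => T v rv; rewrite !(pres_valW rv) inC1 (tens_rel1 rv).
Qed.
Lemma tensM a a' b b' : tensor (a * a') (b * b') = tensor a b * tensor a' b'.
Proof. tens_tac tens_relM. Qed.
Lemma tensS a b : tensor (star a) (star b) = star (tensor a b).
Proof. tens_tac tens_relS. Qed.

Lemma tens0l b : tensor 0 b = 0 :> tens A B.
Proof. by apply: (addrI (tensor 0 b)); rewrite -tensDl !addr0. Qed.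
Lemma tens0r a : tensor a 0 = 0 :> tens A B.
Proof. by apply: (addrI (tensor a 0)); rewrite -tensDr !addr0. Qed.
Lemma tens_suml (I : finType) (F : I -> A) b :
  tensor (\sum_i F i) b = \sum_i tensor (F i) b.
Proof.
apply: (big_morph (fun a => tensor a b)); last exact: tens0l.
by move=> x y; exact: tensDl.
Qed.
Lemma tens_sumr (I : finType) a (F : I -> B) :
  tensor a (\sum_i F i) = \sum_i tensor a (F i).
Proof.
apply: (big_morph (fun b => tensor a b)); last exact: tens0r.
by move=> x y; exact: tensDr.
Qed.
End Tensor.

Section TensorMap.
Variables (A A' B B' : starAlgType C) (f : A -> A') (g : B -> B').
Hypotheses (hf : star_hom f) (hg : star_hom g).

Fact tens_map_rels :
  tens_rels (fun x : A * B => tensor (f x.1) (g x.2) : tens A' B').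
Proof.
case: (hf) (hg) => [fD fM fC fS] [gD gM gC gS].
split=> /= [a a' b|a b b'|c a b|c a b||a a' b b'|a b].
- by rewrite fD tensDl.
- by rewrite gD tensDr.
- by rewrite fM fC tensZl.
- by rewrite gM gC tensZr.
- by rewrite (star_hom1 hf) (star_hom1 hg) tens1.
- by rewrite fM gM tensM.
- by rewrite fS gS tensS.
Qed.

Definition tens_map : starMorphism (tens A B) (tens A' B') :=
  pres_lift tens_map_rels.

Lemma tens_mapE a b : tens_map (tensor a b) = tensor (f a) (g b).
Proof. exact: (pres_liftE tens_map_rels). Qed.

Lemma tens_map_commute (c : A') (d : B') x :
  star c = c -> star d = d ->
  (forall a, f a * c = c * f a) -> (forall b, g b * d = d * g b) ->
  tens_map x * tensor c d = tensor c d * tens_map x.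
Proof.
move=> cS dS fc gd; move: x; apply: pres_generated.
  by apply: star_subalg_commute; [exact: starMorphismP | rewrite -tensS cS dS].
move=> _ [[a b] ->].
by rewrite -[pres_gen _ _]/(tensor a b) tens_mapE -!tensM fc gd.
Qed.
End TensorMap.

Definition freeprod2_rels (A B T : starAlgType C) (v : (A + B)%type -> T) :=
  star_hom (fun a => v (inl a)) /\ star_hom (fun b => v (inr b)).

Definition freeprod2 (A B : starAlgType C) : starAlgType C :=
  pres_alg (@freeprod2_rels A B).

Definition fp_inl (A B : starAlgType C) (a : A) : freeprod2 A B :=
  pres_gen (@freeprod2_rels A B) (inl a).
Definition fp_inr (A B : starAlgType C) (b : B) : freeprod2 A B :=
  pres_gen (@freeprod2_rels A B) (inr b).

Lemma fp_inl_hom (A B : starAlgType C) : star_hom (@fp_inl A B).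
Proof. by apply: pres_gen_hom => T v []. Qed.
Lemma fp_inr_hom (A B : starAlgType C) : star_hom (@fp_inr A B).
Proof. by apply: pres_gen_hom => T v []. Qed.

Lemma freeprod2_generated (A B : starAlgType C) :
  star_generated_by (fun x : freeprod2 A B =>
    (exists a, x = fp_inl B a) \/ (exists b, x = fp_inr A b)).
Proof.
move=> P hP h; apply: pres_generated => // _ [[a|b] ->]; apply: h.
  by left; exists a.
by right; exists b.
Qed.

Definition freeprod_rels (I : Type) (A : I -> starAlgType C)
    (T : starAlgType C) (v : {i : I & A i} -> T) :=
  forall i, star_hom (fun a => v (existT (fun i => A i : Type) i a)).

Definition freeprod (I : Type) (A : I -> starAlgType C) : starAlgType C :=
  pres_alg (@freeprod_rels I A).

Definition fp_in (I : Type) (A : I -> starAlgType C) (i : I) (a : A i) :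
  freeprod A := pres_gen (@freeprod_rels I A) (existT (fun i => A i : Type) i a).

Lemma fp_in_hom (I : Type) (A : I -> starAlgType C) i : star_hom (@fp_in I A i).
Proof. by apply: pres_gen_hom => T v; apply. Qed.

(* The quotient of [A] by the *-ideal generated by [N]. *)
Definition star_quot_rels (A : starAlgType C) (N : A -> Prop)
    (T : starAlgType C) (v : A -> T) :=
  star_hom v /\ forall x, N x -> v x = 0.

Definition star_quot (A : starAlgType C) (N : A -> Prop) : starAlgType C :=
  pres_alg (@star_quot_rels A N).

Definition quot_proj (A : starAlgType C) (N : A -> Prop) (a : A) :
  star_quot N := pres_gen (@star_quot_rels A N) a.

Lemma quot_proj_hom (A : starAlgType C) (N : A -> Prop) :
  star_hom (@quot_proj A N).
Proof. by apply: (pres_gen_hom (f := id)) => T v []. Qed.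

Lemma quot_proj0 (A : starAlgType C) (N : A -> Prop) a :
  N a -> quot_proj N a = 0.
Proof.
move=> Na; apply: pres_alg_eq => T v rv; rewrite !(pres_valW rv) inC0.
by case: rv => _; apply.
Qed.

End Constructions.

Arguments fp_in {C I} A i a.
Arguments fp_in_hom {C I} A i.

Section Magic.

Variable C : numClosedFieldType.

Definition magic_unitary (A : starAlgType C) (I J : finType) (u : I -> J -> A) :
    Prop :=
  [/\ forall i j, star (u i j) = u i j, forall i j, u i j * u i j = u i j,
      forall i, \sum_j u i j = 1 & forall j, \sum_i u i j = 1].

Definition Ps (A : starAlgType C) (I : finType) (p : I -> I -> A) : Prop :=
  [/\ magic_unitary p,
      forall i j k, j != k -> p i j * p i k = 0 &
      forall i j k, j != k -> p j i * p k i = 0].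

Definition adj (A : starAlgType C) (G : graph) (x y : vert G) : A :=
  (edge x y)%:R.

(* [u Adj(G) = Adj(H) u] *)
Definition adj_intertwines (A : starAlgType C) (G H : graph)
    (u : vert H -> vert G -> A) : Prop :=
  forall y x, \sum_z u y z * adj A z x = \sum_z adj A y z * u z x.

Definition quantum_iso (G H : graph) : Prop :=
  #|vert G| = #|vert H| /\
  exists (X : cstarAlgType C) (U : vert H -> vert G -> X),
    [/\ (1 : X) <> 0, magic_unitary U & adj_intertwines U].

Section PsTheory.
Variables (A : starAlgType C) (I : finType) (p : I -> I -> A).
Hypothesis hp : Ps p.

Lemma Ps_star i j : star (p i j) = p i j.
Proof. by case: hp => [[]]. Qed.
Lemma Ps_row i : \sum_j p i j = 1.
Proof. by case: hp => [[]]. Qed.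
Lemma Ps_col j : \sum_i p i j = 1.
Proof. by case: hp => [[]]. Qed.
Lemma Ps_mulr i j k : p i j * p i k = if j == k then p i j else 0.
Proof.
case: hp => [[_ pp _ _] pr _].
by case: eqP => [<-|/eqP]; [exact: pp | exact: pr].
Qed.
Lemma Ps_mulc i j k : p j i * p k i = if j == k then p j i else 0.
Proof.
case: hp => [[_ pp _ _] _ pc].
by case: eqP => [<-|/eqP]; [exact: pp | exact: pc].
Qed.

Lemma Ps_hom (B : starAlgType C) (f : A -> B) :
  star_hom f -> Ps (fun i j => f (p i j)).
Proof.
move=> hf; case: (hf) => fD fM fC fS.
have f0 : f 0 = 0 by rewrite -(inC0 A) fC inC0.
split; first split=> [i j|i j|i|j].
- by rewrite -fS Ps_star.
- by rewrite -fM Ps_mulr eqxx.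
- by rewrite -(star_hom_sumE _ hf) Ps_row star_hom1.
- by rewrite -(star_hom_sumE _ hf) Ps_col star_hom1.
- by move=> i j k /negbTE jk; rewrite -fM Ps_mulr jk.
- by move=> i j k /negbTE jk; rewrite -fM Ps_mulc jk.
Qed.
End PsTheory.

Lemma Ps_tens (A B : starAlgType C) (I : finType) (p : I -> I -> A)
    (q : I -> I -> B) : Ps p -> Ps q ->
  Ps (fun i j => \sum_k tensor (p i k) (q k j)).
Proof.
move=> hp hq.
have row i j k : (\sum_l tensor (p i l) (q l j)) * (\sum_l tensor (p i l) (q l k)) =
    \sum_l tensor (p i l) (q l j * q l k).
  rewrite mulr_suml; apply: eq_bigr => l _; rewrite mulr_sumr (bigD1 l) //=.
  rewrite -tensM (Ps_mulr hp) eqxx big1 ?addr0 // => m ml.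
  by rewrite -tensM (Ps_mulr hp) eq_sym (negbTE ml) tens0l.
split; first split=> [i j|i j|i|j].
- by rewrite star_sum; apply: eq_bigr => k _; rewrite -tensS (Ps_star hp) (Ps_star hq).
- by rewrite row; apply: eq_bigr => k _; rewrite (Ps_mulr hq) eqxx.
- rewrite exchange_big /= -(tens1 A B) -(Ps_row hp i) tens_suml.
  by apply: eq_bigr => k _; rewrite -tens_sumr (Ps_row hq).
- rewrite exchange_big /= -(tens1 A B) -(Ps_col hq j) tens_sumr.
  by apply: eq_bigr => k _; rewrite -tens_suml (Ps_col hp).
- move=> i j k /negbTE jk; rewrite row big1 // => l _.
  by rewrite (Ps_mulr hq) jk tens0r.
- move=> i j k /negbTE jk; rewrite mulr_suml big1 // => l _.
  rewrite mulr_sumr big1 // => m _; rewrite -tensM (Ps_mulc hq).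
  by case: eqP => [->|_]; rewrite ?tens0r // (Ps_mulc hp) jk tens0l.
Qed.

Lemma tens_adjl (A B : starAlgType C) (G : graph) (x y : vert G) (a : A) (b : B) :
  tensor (a * adj A x y) b = tensor a b * adj _ x y.
Proof. by rewrite /adj; case: edge; rewrite ?mulr1 ?mulr0 ?tens0l. Qed.

Lemma tens_adjm (A B : starAlgType C) (G : graph) (x y : vert G) (a : A) (b : B) :
  tensor a (adj B x y * b) = tensor (a * adj A x y) b.
Proof.
by rewrite /adj; case: edge; rewrite ?mulr1 ?mul1r ?mulr0 ?mul0r ?tens0l ?tens0r.
Qed.

Lemma adj_intertwines_tens (A B : starAlgType C) (G : graph)
    (u : vert G -> vert G -> A) (v : vert G -> vert G -> B) :
  adj_intertwines u -> adj_intertwines v ->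
  adj_intertwines (fun x y => \sum_z tensor (u x z) (v z y)).
Proof.
move=> hu hv y x.
have adjr k z : tensor (u y k) (v k z) * adj _ z x =
    tensor (u y k) (v k z * adj B z x).
  by rewrite /adj; case: edge; rewrite ?mulr1 ?mulr0 ?tens0r.
have adjl k z : adj _ y z * tensor (u z k) (v k x) =
    tensor (adj A y z * u z k) (v k x).
  by rewrite /adj; case: edge; rewrite ?mul1r ?mul0r ?tens0l.
under eq_bigr => z _ do rewrite mulr_suml.
under [RHS]eq_bigr => z _ do rewrite mulr_sumr.
rewrite exchange_big [RHS]exchange_big /=.
transitivity (\sum_k \sum_z tensor (u y k) (adj B k z * v z x)).
  apply: eq_bigr => k _; rewrite -tens_sumr -hv tens_sumr.
  by apply: eq_bigr => z _; rewrite adjr.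
rewrite exchange_big /=; apply: eq_bigr => z _.
under eq_bigr => k _ do rewrite tens_adjm.
rewrite -tens_suml hu tens_suml.
by apply: eq_bigr => k _; rewrite adjl.
Qed.

Section PresentedPs.
Variables (X : Type) (rels : forall A : starAlgType C, (X -> A) -> Prop).

Lemma pres_Ps (I : finType) (p : I -> I -> pres_alg rels) :
  (forall (A : starAlgType C) (v : X -> A), rels v ->
     Ps (fun i j => pres_val v (p i j))) -> Ps p.
Proof.
move=> h.
have hom (A : starAlgType C) (v : X -> A) (rv : rels v) := pres_val_hom rv.
split; first split=> [i j|i j|i|j].
- apply: pres_alg_eq => A v rv; case: (hom A v rv) => _ _ _ ->.
  exact: (Ps_star (h A v rv)).
- apply: pres_alg_eq => A v rv; case: (hom A v rv) => _ -> _ _.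
  by rewrite (Ps_mulr (h A v rv)) eqxx.
- apply: pres_alg_eq => A v rv; rewrite (star_hom_sumE _ (hom A v rv)).
  by rewrite (star_hom1 (hom A v rv)) (Ps_row (h A v rv)).
- apply: pres_alg_eq => A v rv; rewrite (star_hom_sumE _ (hom A v rv)).
  by rewrite (star_hom1 (hom A v rv)) (Ps_col (h A v rv)).
- move=> i j k /negbTE jk; apply: pres_alg_eq => A v rv.
  case: (hom A v rv) => _ -> vC _; rewrite (Ps_mulr (h A v rv)) jk.
  by rewrite -(inC0 (pres_alg rels)) vC inC0.
- move=> i j k /negbTE jk; apply: pres_alg_eq => A v rv.
  case: (hom A v rv) => _ -> vC _; rewrite (Ps_mulc (h A v rv)) jk.
  by rewrite -(inC0 (pres_alg rels)) vC inC0.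
Qed.

Lemma pres_adj_intertwines (G : graph) (u : vert G -> vert G -> pres_alg rels) :
  (forall (A : starAlgType C) (v : X -> A), rels v ->
     adj_intertwines (fun x y => pres_val v (u x y))) -> adj_intertwines u.
Proof.
move=> h y x; apply: pres_alg_eq => A v rv.
have hv := pres_val_hom rv; rewrite !(star_hom_sumE _ hv).
have adjE z t : pres_val v (adj (pres_alg rels) z t) = adj A z t :> A.
  rewrite /adj; case: edge; first by rewrite !mulr1n (star_hom1 hv).
  by rewrite !mulr0n -(inC0 (pres_alg rels)); case: hv => _ _ -> _; rewrite inC0.
case: (hv) => _ vM _ _.
under eq_bigr => z _ do rewrite vM adjE.
under [RHS]eq_bigr => z _ do rewrite vM adjE.
exact: h.
Qed.
End PresentedPs.

End Magic.

(* The matrices may be indexed by any nonempty finite set rather than         *)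
(* {1,...,n}, as for graphs. The comultiplication, determined by its values   *)
(* on the generators, is recorded as data.                                    *)
Record qperm (C : numClosedFieldType) := QPerm {
  qalg : starAlgType C;
  qidx : finType;
  qmat : qidx -> qidx -> qalg;
  qcomult : starMorphism qalg (tens qalg qalg);
  qidx_gt0 : (0 < #|qidx|)%N;
  qmat_Ps : Ps qmat;
  qmat_generates : star_generated_by (fun x => exists i j, x = qmat i j);
  qcomultE : forall i j,
    qcomult (qmat i j) = \sum_k tensor (qmat i k) (qmat k j) }.

Section QuantumPermutationGroups.

Variable C : numClosedFieldType.
Implicit Types (G : graph) (Q : qperm C).

Definition qperm_iso Q Q' : Prop :=
  exists f : starMorphism (qalg Q) (qalg Q'),
    bijective f /\
    forall x, qcomult Q' (f x) =
              tens_map (starMorphismP f) (starMorphismP f) (qcomult Q x).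

Definition Splus_rels (n : nat) (A : starAlgType C) (p : 'I_n * 'I_n -> A) :=
  Ps (fun i j => p (i, j)).

Section Splus.
Variables (n : nat) (n_gt0 : (0 < n)%N).

Definition Splus_alg : starAlgType C := pres_alg (@Splus_rels n).
Definition Splus_mat (i j : 'I_n) : Splus_alg := pres_gen (@Splus_rels n) (i, j).

Fact Splus_Ps : Ps Splus_mat.
Proof.
apply: pres_Ps => A v rv; have := rv; congr Ps.
by apply/funext=> i; apply/funext=> j; rewrite (pres_val_gen rv).
Qed.

Fact Splus_generates :
  star_generated_by (fun x => exists i j, x = Splus_mat i j).
Proof.
move=> P hP h; apply: pres_generated => // _ [[i j] ->].
by apply: h; exists i, j.
Qed.

Fact Splus_comult_rels :
  Splus_rels (fun x => \sum_k tensor (Splus_mat x.1 k) (Splus_mat k x.2)).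
Proof. by apply: Ps_tens; apply: Splus_Ps. Qed.

Definition Splus_comult : starMorphism Splus_alg (tens Splus_alg Splus_alg) :=
  pres_lift Splus_comult_rels.

Fact Splus_comultE i j :
  Splus_comult (Splus_mat i j) = \sum_k tensor (Splus_mat i k) (Splus_mat k j).
Proof. exact: (pres_liftE Splus_comult_rels). Qed.

Fact Splus_idx_gt0 : (0 < #|'I_n|)%N.
Proof. by rewrite card_ord. Qed.

Definition Splus : qperm C :=
  QPerm Splus_idx_gt0 Splus_Ps Splus_generates Splus_comultE.

End Splus.

Definition Qu_rels G (A : starAlgType C) (u : vert G * vert G -> A) :=
  Ps (fun x y => u (x, y)) /\ adj_intertwines (fun x y => u (x, y)).

Section Qu.
Variable G : graph.

Definition Qu_alg : starAlgType C := pres_alg (@Qu_rels G).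
Definition Qu_mat (x y : vert G) : Qu_alg := pres_gen (@Qu_rels G) (x, y).

Fact Qu_matE (A : starAlgType C) (v : vert G * vert G -> A) : Qu_rels v ->
  (fun x y => pres_val v (Qu_mat x y)) = (fun x y => v (x, y)).
Proof.
by move=> rv; apply/funext=> i; apply/funext=> j; rewrite (pres_val_gen rv).
Qed.

Fact Qu_Ps : Ps Qu_mat.
Proof. by apply: pres_Ps => A v rv; rewrite Qu_matE //; case: rv. Qed.

Fact Qu_intertwines : adj_intertwines Qu_mat.
Proof.
by apply: pres_adj_intertwines => A v rv; rewrite Qu_matE //; case: rv.
Qed.

Fact Qu_generates : star_generated_by (fun x => exists i j, x = Qu_mat i j).
Proof.
move=> P hP h; apply: pres_generated => // _ [[i j] ->].
by apply: h; exists i, j.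
Qed.

Fact Qu_comult_rels :
  Qu_rels (fun x => \sum_k tensor (Qu_mat x.1 k) (Qu_mat k x.2)).
Proof.
split; first by apply: Ps_tens; apply: Qu_Ps.
by apply: adj_intertwines_tens; apply: Qu_intertwines.
Qed.

Definition Qu_comult : starMorphism Qu_alg (tens Qu_alg Qu_alg) :=
  pres_lift Qu_comult_rels.

Fact Qu_comultE i j :
  Qu_comult (Qu_mat i j) = \sum_k tensor (Qu_mat i k) (Qu_mat k j).
Proof. exact: (pres_liftE Qu_comult_rels). Qed.

Definition Qu : qperm C :=
  QPerm (vert_gt0 G) Qu_Ps Qu_generates Qu_comultE.

End Qu.

Section FreeProduct.
Variables Q1 Q2 : qperm C.

Local Notation A := (freeprod2 (qalg Q1) (qalg Q2)).
Local Notation inl1 := (@fp_inl C (qalg Q1) (qalg Q2)).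
Local Notation inr1 := (@fp_inr C (qalg Q1) (qalg Q2)).
Local Notation hl := (@fp_inl_hom C (qalg Q1) (qalg Q2)).
Local Notation hr := (@fp_inr_hom C (qalg Q1) (qalg Q2)).

Definition qfree_mat (x y : (qidx Q1 + qidx Q2)%type) : A :=
  match x, y with
  | inl i, inl j => fp_inl _ (qmat i j)
  | inr i, inr j => fp_inr _ (qmat i j)
  | _, _ => 0
  end.

Fact qfree_idx_gt0 : (0 < #|{: qidx Q1 + qidx Q2}|)%N.
Proof. by rewrite card_sum addn_gt0 qidx_gt0. Qed.

Fact qfree_Ps : Ps qfree_mat.
Proof.
have hp := Ps_hom (qmat_Ps Q1) hl; have hq := Ps_hom (qmat_Ps Q2) hr.
split; first split=> [i j|i j|i|j].
- by case: i j => i [] j /=; rewrite ?star0 ?(Ps_star hp) ?(Ps_star hq).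
- by case: i j => i [] j /=; rewrite ?mul0r // ?(Ps_mulr hp) ?(Ps_mulr hq) eqxx.
- case: i => i; rewrite big_sumType /= ?(Ps_row hp) ?(Ps_row hq) big1_eq;
  by rewrite ?addr0 ?add0r.
- case: j => j; rewrite big_sumType /= ?(Ps_col hp) ?(Ps_col hq) big1_eq;
  by rewrite ?addr0 ?add0r.
- case=> i [] j [] k /negbTE jk /=; rewrite ?mul0r ?mulr0 //.
    by rewrite (Ps_mulr hp) (_ : (j == k) = false).
  by rewrite (Ps_mulr hq) (_ : (j == k) = false).
- case=> i [] j [] k /negbTE jk /=; rewrite ?mul0r ?mulr0 //.
    by rewrite (Ps_mulc hp) (_ : (j == k) = false).
  by rewrite (Ps_mulc hq) (_ : (j == k) = false).
Qed.

Fact qfree_generates : star_generated_by (fun x => exists i j, x = qfree_mat i j).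
Proof.
move=> P hP h; apply: freeprod2_generated => // x [] [y ->].
  move: y; apply: (qmat_generates (star_subalg_preim hl hP)) => _ [i [j ->]].
  by apply: h; exists (inl i), (inl j).
move: y; apply: (qmat_generates (star_subalg_preim hr hP)) => _ [i [j ->]].
by apply: h; exists (inr i), (inr j).
Qed.

Definition qfree_comult_gen (x : (qalg Q1 + qalg Q2)%type) : tens A A :=
  match x with
  | inl a => tens_map hl hl (qcomult Q1 a)
  | inr b => tens_map hr hr (qcomult Q2 b)
  end.

Fact qfree_comult_rels : freeprod2_rels qfree_comult_gen.
Proof.
by split; apply: star_hom_comp; apply: starMorphismP.
Qed.

Definition qfree_comult : starMorphism A (tens A A) :=
  pres_lift qfree_comult_rels.

Fact qfree_comultE i j :
  qfree_comult (qfree_mat i j) = \sum_k tensor (qfree_mat i k) (qfree_mat k j).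
Proof.
case: i j => i [] j /=; rewrite big_sumType /=.
- rewrite [X in _ + X]big1 ?addr0 => [|k _]; last by rewrite tens0l.
  rewrite [LHS](pres_liftE qfree_comult_rels) /= qcomultE rmorph_sum.
  by apply: eq_bigr => k _; apply: tens_mapE.
- rewrite !big1 ?addr0 ?rmorph0 // => k _; by rewrite ?tens0l ?tens0r.
- rewrite !big1 ?addr0 ?rmorph0 // => k _; by rewrite ?tens0l ?tens0r.
- rewrite [X in X + _]big1 ?add0r => [|k _]; last by rewrite tens0l.
  rewrite [LHS](pres_liftE qfree_comult_rels) /= qcomultE rmorph_sum.
  by apply: eq_bigr => k _; apply: tens_mapE.
Qed.

Definition qfree : qperm C :=
  QPerm qfree_idx_gt0 qfree_Ps qfree_generates qfree_comultE.

End FreeProduct.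

Section Wreath.
Variables (Q : qperm C) (n : nat) (n_gt0 : (0 < n)%N).

Local Notation A := (qalg Q).
Local Notation u := (@qmat C Q).
Local Notation S := (Splus n_gt0).
Local Notation p := (@qmat C S).

Definition wreath_base : starAlgType C :=
  freeprod2 (freeprod (fun _ : 'I_n => A)) (qalg S).

Definition base_nu (i : 'I_n) (a : A) : wreath_base :=
  fp_inl (qalg S) (fp_in (fun _ : 'I_n => A) i a).
Definition base_S (s : qalg S) : wreath_base :=
  fp_inr (freeprod (fun _ : 'I_n => A)) s.

(* As [nu_i(a), p_ij]^* = - [nu_i(a^* ), p_ij], the ideal and the *-ideal     *)
(* generated by these commutators coincide.                                   *)
Definition wreath_commutator (x : wreath_base) : Prop :=
  exists (i j : 'I_n) (a : A),
    x = base_nu i a * base_S (p i j) - base_S (p i j) * base_nu i a.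

Definition wreath_alg : starAlgType C := star_quot wreath_commutator.

Definition wreath_nu (i : 'I_n) (a : A) : wreath_alg :=
  quot_proj wreath_commutator (base_nu i a).
Definition wreath_S (s : qalg S) : wreath_alg :=
  quot_proj wreath_commutator (base_S s).

(* [w_{ij,kl}], in row [x = (i, k)] and column [y = (j, l)] *)
Definition wreath_mat (x y : 'I_n * qidx Q) : wreath_alg :=
  wreath_nu x.1 (u x.2 y.2) * wreath_S (p x.1 y.1).

Fact wreath_nu_hom i : star_hom (wreath_nu i).
Proof.
apply: (star_hom_comp (quot_proj_hom wreath_commutator)).
apply: (star_hom_comp (fp_inl_hom _ _)).
exact: (fp_in_hom (fun _ : 'I_n => A) i).
Qed.

Fact wreath_S_hom : star_hom wreath_S.
Proof.
apply: (star_hom_comp (quot_proj_hom wreath_commutator)).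
exact: fp_inr_hom.
Qed.

Fact wreath_comm i j a :
  wreath_nu i a * wreath_S (p i j) = wreath_S (p i j) * wreath_nu i a.
Proof.
apply/eqP; rewrite -subr_eq0; apply/eqP.
have /quot_proj0 : wreath_commutator
  (base_nu i a * base_S (p i j) - base_S (p i j) * base_nu i a) by exists i, j, a.
rewrite -[quot_proj _]/(hom_of (quot_proj_hom wreath_commutator)).
by rewrite rmorphB !rmorphM.
Qed.

Let hP : Ps (fun i j => wreath_S (p i j)) := Ps_hom (qmat_Ps S) wreath_S_hom.
Let hU i : Ps (fun k l => wreath_nu i (u k l)) :=
  Ps_hom (qmat_Ps Q) (wreath_nu_hom i).

Let hPr i j k : wreath_S (p i j) * wreath_S (p i k) =
  if j == k then wreath_S (p i j) else 0 := Ps_mulr hP i j k.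
Let hPc i j k : wreath_S (p j i) * wreath_S (p k i) =
  if j == k then wreath_S (p j i) else 0 := Ps_mulc hP i j k.
Let hUr i k l m : wreath_nu i (u k l) * wreath_nu i (u k m) =
  if l == m then wreath_nu i (u k l) else 0 := Ps_mulr (hU i) k l m.
Let hUc i k l m : wreath_nu i (u l k) * wreath_nu i (u m k) =
  if l == m then wreath_nu i (u l k) else 0 := Ps_mulc (hU i) k l m.

Fact wreath_idx_gt0 : (0 < #|{: 'I_n * qidx Q}|)%N.
Proof. by rewrite card_prod muln_gt0 card_ord n_gt0 qidx_gt0. Qed.

Fact wreath_Ps : Ps wreath_mat.
Proof.
rewrite /wreath_mat; split; first split=> [[i k] [j l]|[i k] [j l]|[i k]|[j l]] /=.
- by rewrite starM (Ps_star hP) (Ps_star (hU i)) wreath_comm.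
- rewrite {2}wreath_comm mulrA -[_ * wreath_S _ * wreath_S _]mulrA hPr eqxx.
  by rewrite -mulrA -wreath_comm mulrA hUr eqxx.
- rewrite -(pair_bigA _ (fun j l => wreath_nu i (u k l) * wreath_S (p i j))) /=.
  under eq_bigr => j _ do rewrite -mulr_suml (Ps_row (hU i)) mul1r.
  exact: (Ps_row hP).
- rewrite -(pair_bigA _ (fun i k => wreath_nu i (u k l) * wreath_S (p i j))) /=.
  under eq_bigr => i _ do rewrite -mulr_suml (Ps_col (hU i)) mul1r.
  exact: (Ps_col hP).
- move=> [i k] [j l] [j' l'] /= ne.
  rewrite wreath_comm mulrA -[_ * _ * wreath_nu _ _]mulrA hUr.
  case: eqP => [ll|_]; last by rewrite mulr0 mul0r.
  rewrite -wreath_comm -mulrA hPr; case: eqP => [jj|_]; last by rewrite mulr0.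
  by rewrite ll jj eqxx in ne.
- move=> [j l] [i k] [i' k'] /= ne.
  rewrite [X in _ * X]wreath_comm mulrA -[_ * _ * wreath_S _]mulrA hPc.
  case: eqP => [ii|_]; last by rewrite mulr0 mul0r.
  rewrite -ii -mulrA -wreath_comm mulrA hUc.
  case: eqP => [kk|_]; last by rewrite mul0r.
  by rewrite ii kk eqxx in ne.
Qed.

Fact wreath_generates :
  star_generated_by (fun x => exists i j, x = wreath_mat i j).
Proof.
move=> P hPP h.
have hw x y : P (wreath_mat x y) by apply: h; exists x, y.
have hq := star_subalg_preim (quot_proj_hom wreath_commutator) hPP.
apply: pres_generated => // _ [x ->]; rewrite -[pres_gen _ _]/(quot_proj _ x).
move: x; apply: (freeprod2_generated hq) => x [] [y ->].
  have hl := star_subalg_preim (fp_inl_hom _ _) hq.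
  move: y; apply: (pres_generated hl) => _ [[i a] ->].
  have hnu := star_subalg_preim (wreath_nu_hom i) hPP.
  move: a; apply: (qmat_generates hnu) => _ [k [l ->]] /=.
  rewrite -[wreath_nu _ _]mulr1 -(Ps_row hP i) mulr_sumr.
  by apply: star_subalg_sum => // j; apply: (hw (i, k) (j, l)).
move: y; have hS := star_subalg_preim wreath_S_hom hPP.
apply: (qmat_generates hS) => _ [i [j ->]] /=.
have /card_gt0P[k _] := qidx_gt0 Q.
rewrite -[wreath_S _]mul1r -(Ps_row (hU i) k) mulr_suml.
by apply: star_subalg_sum => // l; apply: (hw (i, k) (j, l)).
Qed.

Section Lift.
Variables (T : starAlgType C) (f : 'I_n -> A -> T) (g : qalg S -> T).
Hypotheses (hf : forall i, star_hom (f i)) (hg : star_hom g).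
Hypothesis fg : forall i j a, f i a * g (p i j) = g (p i j) * f i a.

Fact wreath_lift_rels1 :
  @freeprod_rels C _ (fun _ : 'I_n => A) T (fun x => f (projT1 x) (projT2 x)).
Proof. by move=> i; apply: hf. Qed.

Let f1 := pres_lift wreath_lift_rels1.

Definition wreath_lift_fun2 (x : (freeprod (fun _ : 'I_n => A) + qalg S)%type) : T :=
  match x with inl a => f1 a | inr s => g s end.

Fact wreath_lift_rels2 : freeprod2_rels wreath_lift_fun2.
Proof. by split; [apply: starMorphismP | apply: hg]. Qed.

Let f2 : starMorphism wreath_base T := pres_lift wreath_lift_rels2.

Let f2_nu i a : f2 (base_nu i a) = f i a.
Proof.
rewrite [LHS](pres_liftE wreath_lift_rels2) /=.
exact: (pres_liftE wreath_lift_rels1).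
Qed.

Let f2_S s : f2 (base_S s) = g s.
Proof. exact: (pres_liftE wreath_lift_rels2). Qed.

Fact wreath_lift_rels : star_quot_rels wreath_commutator f2.
Proof.
split; first exact: starMorphismP.
move=> _ [i [j [a ->]]].
by rewrite rmorphB !rmorphM /= f2_nu f2_S fg subrr.
Qed.

Definition wreath_lift : starMorphism wreath_alg T := pres_lift wreath_lift_rels.

Lemma wreath_lift_nu i a : wreath_lift (wreath_nu i a) = f i a.
Proof. exact: (etrans (pres_liftE wreath_lift_rels _) (f2_nu i a)). Qed.

Lemma wreath_lift_S s : wreath_lift (wreath_S s) = g s.
Proof. exact: (etrans (pres_liftE wreath_lift_rels _) (f2_S s)). Qed.
End Lift.

Let W2 := tens wreath_alg wreath_alg.
Let D i r : starMorphism (tens A A) W2 :=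
  tens_map (wreath_nu_hom i) (wreath_nu_hom r).
Let e i r : W2 := tensor (wreath_S (p i r)) 1.

Definition wreath_comult_nu i (a : A) : W2 := \sum_r D i r (qcomult Q a) * e i r.

Definition wreath_comult_S (s : qalg S) : W2 :=
  tens_map wreath_S_hom wreath_S_hom (qcomult S s).

Let De i r x : D i r x * e i r = e i r * D i r x.
Proof.
apply: tens_map_commute => [||a|b]; rewrite ?star1 ?mulr1 ?mul1r //.
  exact: (Ps_star hP).
exact: wreath_comm.
Qed.

Let eM i r s : e i r * e i s = if r == s then e i r else 0.
Proof.
by rewrite /e -tensM mulr1 hPr; case: eqP => //; rewrite tens0l.
Qed.

Fact wreath_comult_nu_hom i : star_hom (wreath_comult_nu i).
Proof.
apply: (star_hom_glue (f := fun r a => D i r (qcomult Q a))).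
- by move=> r; apply: star_hom_comp; apply: starMorphismP.
- by move=> r; rewrite /e -tensS (Ps_star hP) star1.
- exact: eM.
- by rewrite /e -tens_suml (Ps_row hP) tens1.
- by move=> r a; apply: De.
Qed.

Let wreath_comult_SE i j : wreath_comult_S (p i j) =
  \sum_k tensor (wreath_S (p i k)) (wreath_S (p k j)).
Proof.
rewrite /wreath_comult_S qcomultE rmorph_sum.
by apply: eq_bigr => k _; apply: tens_mapE.
Qed.

Let q i r j : W2 := tensor (wreath_S (p i r)) (wreath_S (p r j)).

Let eq_ i r s j : e i r * q i s j = if r == s then q i r j else 0.
Proof.
rewrite /e /q -tensM mul1r hPr; case: eqP => [->//|_].
by rewrite tens0l.
Qed.

Let qe_ i r s j : q i s j * e i r = if s == r then q i s j else 0.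
Proof.
rewrite /e /q -tensM mulr1 hPr; case: eqP => [//|_].
by rewrite tens0l.
Qed.

Let Dq i r j x : D i r x * q i r j = q i r j * D i r x.
Proof.
apply: tens_map_commute => [||a|b]; first exact: (Ps_star hP).
- exact: (Ps_star hP).
- exact: wreath_comm.
- exact: wreath_comm.
Qed.

Let wreath_comult_mul i j a : wreath_comult_nu i a * wreath_comult_S (p i j) =
  \sum_r D i r (qcomult Q a) * q i r j.
Proof.
rewrite wreath_comult_SE mulr_suml; apply: eq_bigr => r _.
rewrite mulr_sumr (bigD1 r) //= big1 ?addr0 => [|s sr].
  by rewrite -mulrA -/(q i r j) eq_ eqxx.
by rewrite -mulrA -/(q i s j) eq_ eq_sym (negbTE sr) mulr0.
Qed.

Fact wreath_comult_comm i j a :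
  wreath_comult_nu i a * wreath_comult_S (p i j) =
  wreath_comult_S (p i j) * wreath_comult_nu i a.
Proof.
rewrite wreath_comult_mul wreath_comult_SE mulr_sumr; apply: eq_bigr => r _.
rewrite mulr_suml (bigD1 r) //= big1 ?addr0 => [|s sr].
  by rewrite -/(q i r j) De mulrA qe_ eqxx Dq.
by rewrite -/(q i s j) De mulrA qe_ (negbTE sr) mul0r.
Qed.

Definition wreath_comult : starMorphism wreath_alg W2 :=
  wreath_lift wreath_comult_nu_hom (star_hom_comp
    (starMorphismP (tens_map wreath_S_hom wreath_S_hom))
    (starMorphismP (qcomult S))) wreath_comult_comm.

Fact wreath_comultE x y : wreath_comult (wreath_mat x y) =
  \sum_z tensor (wreath_mat x z) (wreath_mat z y).
Proof.
case: x y => [i k] [j l]; rewrite /wreath_mat /=.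
rewrite rmorphM /= [wreath_comult (wreath_nu _ _)]wreath_lift_nu.
rewrite [wreath_comult (wreath_S _)]wreath_lift_S.
rewrite -[X in _ * X]/(wreath_comult_S (p i j)) wreath_comult_mul.
rewrite -(pair_bigA _ (fun r m => tensor (wreath_nu i (u k m) * wreath_S (p i r))
  (wreath_nu r (u m l) * wreath_S (p r j)))) /=.
apply: eq_bigr => r _; rewrite qcomultE rmorph_sum mulr_suml.
by apply: eq_bigr => m _; rewrite tensM; congr (_ * _); apply: tens_mapE.
Qed.

Definition qwreath : qperm C :=
  QPerm wreath_idx_gt0 wreath_Ps wreath_generates wreath_comultE.

End Wreath.

Definition qperm_trivial Q : Prop := bijective (inC : C -> qalg Q).

(* [B] with [iota] is the universal enveloping C*-algebra of [A]: *-morphisms *)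
(* from [A] to unital C*-algebras factor uniquely through [iota].             *)
Definition cstar_envelope (A : starAlgType C) (B : cstarAlgType C)
    (iota : starMorphism A B) : Prop :=
  forall (X : cstarAlgType C) (f : starMorphism A X),
    (exists g : starMorphism B X, forall a, g (iota a) = f a) /\
    (forall g h : starMorphism B X,
       (forall a, g (iota a) = f a) -> (forall a, h (iota a) = f a) -> g =1 h).

Definition quantum_symmetry G : Prop :=
  exists (B : cstarAlgType C) (iota : starMorphism (qalg (Qu G)) B),
    cstar_envelope iota /\ ~ (forall x y : B, x * y = y * x).

Definition tractable (F : graph -> Prop) : Prop :=
  [/\ forall G, F G -> (qperm_trivial (Qu G) <-> aut_trivial G),
      forall G H, F G -> F H -> (quantum_iso C G H <-> graph_iso G H) &
      forall G, F G -> (quantum_symmetry G <-> schmidt G)].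

Definition superrigid (F : graph -> Prop) : Prop :=
  forall G H, F G -> quantum_iso C G H -> graph_iso G H.

(* Families of quantum permutation groups are taken up to isomorphism. *)
Definition Qu_family (F : graph -> Prop) Q : Prop :=
  exists2 G, F G & qperm_iso (Qu G) Q.

Inductive Jor (F : qperm C -> Prop) : qperm C -> Prop :=
| Jor_base Q : F Q -> Jor F Q
| Jor_free Q Q' : Jor F Q -> Jor F Q' -> Jor F (qfree Q Q')
| Jor_wreath Q n (n_gt0 : (0 < n)%N) : Jor F Q -> Jor F (qwreath Q n_gt0)
| Jor_iso Q Q' : qperm_iso Q Q' -> Jor F Q -> Jor F Q'.

End QuantumPermutationGroups.

Arguments tractable C F : clear implicits.
Arguments superrigid C F : clear implicits.

(* Main.v *)
(* Every graph on at most 5 vertices, unless it or its complement is          *)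
(* disconnected, forces the entries of a magic unitary intertwining its       *)
(* adjacency matrix to commute: either the vertex colours (degrees, and       *)
(* degrees of the neighbours) leave at most two candidates per row, with a    *)
(* common projection, or the graph and its complement have no 4-cycle. When   *)
(* the entries commute, a nonzero product of entries with one factor in each  *)
(* row is a graph isomorphism.                                                *)
(*   A magic unitary between disconnected graphs is cut into blocks, indexed  *)
(* by pairs of components; a block is a magic unitary for the two components, *)
(* so by induction on the number of vertices it vanishes unless these are     *)
(* isomorphic, and counting gives as many components of each type on both     *)
(* sides. Complements being harmless, this yields quantum rigidity over any   *)
(* torsion-free ring, hence (QI) and superrigidity; the same induction shows  *)
(* that the entries commute when Schmidt's criterion fails. Conversely, two   *)
(* automorphisms with disjoint supports and two noncommuting projections of   *)
(* M_2(C) give a noncommutative representation of O(Qu(G)), which factors     *)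
(* through the enveloping C*-algebra.                                         *)
(*   By the vanishing of blocks, Qu turns a disjoint union of graphs without  *)
(* common component into a free product, and n copies of a connected graph    *)
(* into a wreath product by S_n^+. This gives one inclusion by induction on   *)
(* the number of vertices; for the other one replaces graphs by connected     *)
(* ones, and one of two isomorphic connected graphs G by the complement of    *)
(* G + K_1, which has the same quantum automorphism group.                    *)

Require Import Defs.
From HB Require Import structures.
From mathcomp Require Import all_boot all_order all_algebra perm generic_quotient.
From mathcomp Require Import sesquilinear spectral.
From mathcomp Require classical_sets.
From mathcomp Require Import boolp reals complex ring lra.

(* [spectral] also defines a [schmidt]. *)
Import Defs.

Set Implicit Arguments.
Unset Strict Implicit.
Unset Printing Implicit Defensive.

Import Order.TTheory GRing.Theory Num.Theory.

Local Open Scope ring_scope.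
Local Open Scope complex_scope.

(** * Magic unitaries over a ring *)

(** Most of the argument takes place over a plain ring. [qmagic e u] keeps of a magic unitary only
    the orthogonality in rows and columns, the sums [e], and the rule that [u x a * u y b = 0] when
    the adjacency of [x], [y] differs from that of [a], [b]. Torsion-freeness, [natregular], turns
    [e *+ m = e *+ n] with [e != 0] into [m = n]; every complex algebra has it.

    Two facts are proved with the scheme [co_le5_ind], which reduces a graph of the class, up to
    complement, to a small graph with a commutation criterion or to a disconnected graph with
    smaller components. Rigidity, [co_le5_quantum_rigid]: a [qmagic] with [e != 0] forces an
    isomorphism. For small graphs the entries commute and [qmagic_commutative_iso] extracts one; for
    disconnected graphs nonzero blocks join isomorphic components, and [qmagic_card] with
    [iso_of_component_counts] matches them. Commutation, [co_le5_commute]: if Schmidt's criterion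
    fails, the entries commute, the main case being [split_commute].

    The passage to C*-algebras rests on [projections_orthogonal]: projections with sum 1 are
    orthogonal, so a quantum isomorphism is a [qmagic], and rigidity gives superrigidity and (QI).
    For (QA), automorphisms are representations of [Qu], and conversely commutation makes the
    fundamental matrix the identity. For (SA), [envelope_commutative] carries commutation to the
    enveloping C*-algebra; in the other direction this algebra is constructed ([envelope_universal])
    and shown noncommutative by the representation [hesitant_qmagic] in 2 by 2 matrices.

    The equality with [Jor] comes from [Qu_compl], [Qu_union] and [Qu_copies], combined in [Jor_Qu]
    for one inclusion and in [Qu_free] and [Qu_family_Jor] for the other. *)

Definition natregular (A : pzRingType) : Prop :=
  forall (x : A) n, x *+ n.+1 = 0 -> x = 0.

(* A magic unitary with unit [e] (so that blocks need no corner algebra); the  *)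
(* last condition is the intertwining of the adjacency matrices.               *)
Record qmagic (A : pzRingType) (H G : graph) (e : A) (u : vert H -> vert G -> A)
    : Prop := QMagic {
  qmagic_mulr : forall x a b, u x a * u x b = if a == b then u x a else 0;
  qmagic_mulc : forall x y a, u x a * u y a = if x == y then u x a else 0;
  qmagic_row : forall x, \sum_a u x a = e;
  qmagic_col : forall a, \sum_x u x a = e;
  qmagic_edge : forall x y a b, edge x y != edge a b -> u x a * u y b = 0 }.

Section QMagicTheory.
Variables (A : pzRingType) (H G : graph) (e : A) (u : vert H -> vert G -> A).
Hypothesis hu : qmagic e u.

Lemma qmagic_idem x a : u x a * u x a = u x a.
Proof. by rewrite (qmagic_mulr hu) eqxx. Qed.

Lemma qmagic_unitl x a : e * u x a = u x a.
Proof.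
rewrite -(qmagic_row hu x) mulr_suml (bigD1 a) //= big1 ?addr0 ?qmagic_idem // => b.
by rewrite (qmagic_mulr hu) => /negbTE ->.
Qed.

Lemma qmagic_unitr x a : u x a * e = u x a.
Proof.
rewrite -(qmagic_row hu x) mulr_sumr (bigD1 a) //= big1 ?addr0 ?qmagic_idem // => b.
by rewrite (qmagic_mulr hu) eq_sym => /negbTE ->.
Qed.

Lemma qmagic_insert x y z a b : u x a * u y b = \sum_c u x a * u z c * u y b.
Proof. by rewrite -mulr_suml -mulr_sumr (qmagic_row hu) qmagic_unitr. Qed.

Lemma qmagic_insertr x z a : u x a = \sum_c u x a * u z c.
Proof. by rewrite -mulr_sumr (qmagic_row hu) qmagic_unitr. Qed.

Lemma qmagic_insertl x z a : u x a = \sum_c u z c * u x a.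
Proof. by rewrite -mulr_suml (qmagic_row hu) qmagic_unitl. Qed.

Lemma qmagic_tr : qmagic (H := G) (G := H) e (fun a x => u x a).
Proof.
case: hu => h1 h2 h3 h4 h5; split=> //.
by move=> x y a b; rewrite eq_sym; apply: h5.
Qed.

(** Complementation alters the comparison of adjacencies only at pairs with [x = y] or [a = b],
    where orthogonality in rows and columns gives the vanishing. *)
Lemma qmagic_compl : qmagic (H := graph_compl H) (G := graph_compl G) e u.
Proof.
split=> [x a b|x y a|x|a|x y a b].
- exact: (qmagic_mulr hu).
- exact: (qmagic_mulc hu).
- exact: (qmagic_row hu).
- exact: (qmagic_col hu).
rewrite /= /compl_edge; have [->|xy] := eqVneq x y; have [->|ab] := eqVneq a b => //=.
- by rewrite (qmagic_mulr hu) (negbTE ab).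
- by rewrite (qmagic_mulc hu) (negbTE xy).
by move=> h; apply: (qmagic_edge hu); apply: contraNneq h => ->.
Qed.

Lemma qmagic_relabelr (G' : graph) (f : vert G' -> vert G) :
  bijective f -> (forall x y, edge (f x) (f y) = edge x y) ->
  qmagic (H := H) (G := G') e (fun x a => u x (f a)).
Proof.
move=> bf hf; split=> [x a b|x y a|x|a|x y a b].
- by rewrite (qmagic_mulr hu) (bij_eq bf).
- exact: (qmagic_mulc hu).
- by rewrite -(qmagic_row hu x) (reindex f) //=; apply: onW_bij.
- exact: (qmagic_col hu).
- by rewrite -hf; apply: (qmagic_edge hu).
Qed.

(* Connectivity is preserved because a walk in [H] can be followed in [G].     *)
Lemma qmagic_connect_imp x y a b :
  connect (@edge H) x y -> ~~ connect (@edge G) a b -> u x a * u y b = 0.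
Proof.
move=> /connectP[p]; elim: p x a => [|z p IHp] x a /=.
  move=> _ -> ab; rewrite (qmagic_mulr hu); case: eqP => // eab.
  by rewrite eab connect0 in ab.
move=> /andP[xz pz] yE ab; rewrite (qmagic_insert _ _ z) big1 // => c _.
have [ac|nac] := boolP (edge a c); last first.
  by rewrite (qmagic_edge hu) ?mul0r // xz (negbTE nac).
rewrite -mulrA (IHp z c) ?mulr0 //.
by apply: contraNN ab => /(connect_trans (connect1 ac)).
Qed.

(** Colour refinement for magic unitaries. Sum [u x a * u y b] over [y] in [P] and [b] in [Q]: rows
    give [u x a *+ #|P|] and columns [u x a *+ #|Q|], because an entry pairing [P] with the
    complement of [Q], or conversely, is killed by [u x a]. *)
Lemma qmagic_edge_color (T : eqType) (cH : vert H -> T) (cG : vert G -> T) :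
  (forall x a, cH x != cG a -> u x a = 0) -> natregular A ->
  forall k x a, u x a != 0 ->
    #|[pred y | edge x y && (cH y == k)]| = #|[pred b | edge a b && (cG b == k)]|.
Proof.
move=> hc tA k x a; set P := [pred y | _]; set Q := [pred b | _].
have PQ y b : P y != Q b -> u x a * u y b = 0.
  move=> h; have [exy|] := eqVneq (edge x y) (edge a b); last exact: (qmagic_edge hu).
  rewrite (hc y b) ?mulr0 //; apply: contraNneq h => /=.
  by rewrite exy => ->.
have E : u x a *+ #|P| = u x a *+ #|Q|.
  transitivity (\sum_(y | P y) \sum_(b | Q b) u x a * u y b).
    rewrite -[X in X = _](sumr_const P); apply: eq_bigr => y Py.
    rewrite [LHS](qmagic_insertr x y a) (bigID Q) /= [X in _ + X]big1 ?addr0 //.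
    by move=> b nQb; apply: PQ; move: Py nQb; rewrite ?inE /P /Q /= => -> /negbTE ->.
  rewrite exchange_big /= -[X in _ = X](sumr_const Q); apply: eq_bigr => b Qb.
  rewrite -[RHS](qmagic_unitr x a) -(qmagic_col hu b) mulr_sumr [RHS](bigID P) /=.
  rewrite [X in _ = _ + X]big1 ?addr0 // => y nPy.
  by apply: PQ; move: Qb nPy; rewrite ?inE /P /Q /= => -> /negbTE ->.
apply: contraNeq => ne; apply/eqP.
have [lt|gt|eq] := ltngtP #|P| #|Q|; last by rewrite eq eqxx in ne.
  apply: (tA _ (#|Q| - #|P|).-1); rewrite prednK ?subn_gt0 // mulrnBr ?(ltnW lt) //.
  by rewrite E subrr.
apply: (tA _ (#|P| - #|Q|).-1); rewrite prednK ?subn_gt0 // mulrnBr ?(ltnW gt) //.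
by rewrite E subrr.
Qed.

(** Inserting [e], the sum of row [x], after [u y b] in one product and before it in the other shows
    that both equal [u x a * u y b * u x a]. *)
Lemma qmagic_commW x a y b :
  (forall c, c != a -> u x a * u y b * u x c = 0) ->
  (forall c, c != a -> u x c * u y b * u x a = 0) ->
  u x a * u y b = u y b * u x a.
Proof.
move=> h1 h2; transitivity (u x a * u y b * u x a).
  rewrite -{1}[u y b]qmagic_unitr -(qmagic_row hu x) mulr_sumr mulr_sumr.
  rewrite (bigD1 a) //= big1 ?addr0 ?mulrA // => c ca.
  by rewrite mulrA h1.
rewrite -[in RHS](qmagic_unitl y b) -(qmagic_row hu x) !mulr_suml.
by rewrite (bigD1 a) //= big1 ?addr0 // => c ca; rewrite h2.
Qed.

End QMagicTheory.

Lemma qmagic_connect (A : pzRingType) (H G : graph) (e : A)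
    (u : vert H -> vert G -> A) x y a b : qmagic e u ->
  connect (@edge H) x y != connect (@edge G) a b -> u x a * u y b = 0.
Proof.
move=> hu; case: (boolP (connect _ x y)) => cxy; case: (boolP (connect _ a b)) => cab //= _.
  exact: (qmagic_connect_imp hu cxy cab).
exact: (qmagic_connect_imp (qmagic_tr hu) cab cxy).
Qed.

(* In a commutative situation the product of the entries chosen along a        *)
(* nonvanishing choice of columns is an isomorphism.                           *)
Lemma qmagic_commutative_iso (A : pzRingType) (H G : graph) (e : A)
    (u : vert H -> vert G -> A) x0 a0 : qmagic e u ->
  (forall x a y b, u x a * u y b = u y b * u x a) -> u x0 a0 != 0 ->
  exists f : vert H -> vert G,
    [/\ bijective f, forall x y, edge (f x) (f y) = edge x y & f x0 = a0].
Proof.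
move=> hu uC ne0.
(* A nonzero product extends by one row at a time: the row sums to [e], so some column keeps it
   nonzero. A row that occurs again later in the list must receive the same column, whence the
   distinction on [x \in s]. *)
have prodne (s : seq (vert H)) (w : A) : w * e = w -> w != 0 ->
    exists f : vert H -> vert G, w * \prod_(x <- s) u x (f x) != 0.
  elim: s w => [|x s IHs] w we w0; first by exists (fun=> a0); rewrite big_nil mulr1.
  have [a wa] : exists a, w * u x a != 0.
    apply/existsP; apply: contraNT w0; rewrite negb_exists => /forallP h.
    rewrite -we -(qmagic_row hu x) mulr_sumr big1 // => a _.
    by apply/eqP; move: (h a); rewrite negbK.
  have [] := IHs (w * u x a) _ wa; first by rewrite -mulrA (qmagic_unitr hu).
  move=> f hf; exists (fun y => if y == x then a else f y).
  rewrite big_cons eqxx mulrA; move: hf; set P := \prod_(_ <- _) _ => hf.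
  have : w * u x a * u x (f x) * P = w * u x a * P \/ x \notin s.
    have [xs|] := boolP (x \in s); last by right.
    left; rewrite -mulrA; congr (_ * _); rewrite /P.
    elim: s xs {IHs P hf} => // y s IHs.
    rewrite inE big_cons mulrA; have [<- _|xy /= xs] := eqVneq x y.
      by rewrite (qmagic_idem hu).
    by rewrite uC -mulrA IHs.
  case=> [E|xs]; last first.
    rewrite (_ : \prod_(_ <- _) _ = P) // /P.
    apply: eq_big_seq => y ys.
    by case: eqP => // yx; rewrite -yx ys in xs.
  have fx : f x = a.
    apply/eqP; apply: contraNT hf => fxa.
    by rewrite -E -(mulrA w) (qmagic_mulr hu) (eq_sym a) (negbTE fxa) mulr0 mul0r.
  rewrite (_ : \prod_(_ <- _) _ = P) // /P.
  by apply: eq_bigr => y _; case: eqP => // ->; rewrite fx.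
have [f hf] := prodne (enum (vert H)) (u x0 a0) (qmagic_unitr hu x0 a0) ne0.
have split2 x (s : seq (vert H)) : x \in s ->
    exists r, \prod_(z <- s) u z (f z) = u x (f x) * r.
  elim: s => // z s IHs; rewrite inE big_cons; have [<- _|zx /= /IHs[r ->]] := eqVneq x z.
    by exists (\prod_(z <- s) u z (f z)).
  by exists (u z (f z) * r); rewrite mulrA uC -mulrA.
have pair0 x y : u x (f x) * u y (f y) != 0.
  apply: contraNneq hf => xy0; have [r Er] := split2 x _ (mem_enum _ x).
  have [E|/eqP yx] := eqVneq y x.
    by move: xy0; rewrite E (qmagic_idem hu) Er => ->; rewrite mul0r mulr0.
  have [s Es] : exists s, \prod_(z <- enum (vert H)) u z (f z) =
      u x (f x) * u y (f y) * s.
    have : y \in enum (vert H) by rewrite mem_enum.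
    have : x \in enum (vert H) by rewrite mem_enum.
    elim: (enum _) => // z t IHt; rewrite !inE big_cons.
    have [xz|nxz] := eqVneq x z; have [yz|nyz] := eqVneq y z => //=.
    - by case: yx; rewrite yz.
    - by move=> _ /split2[q ->]; exists q; rewrite -xz mulrA.
    - by move=> /split2[q ->] _; exists q; rewrite -yz mulrA uC.
    move=> xt yt; have [q ->] := IHt xt yt; exists (u z (f z) * q).
    by rewrite !mulrA (uC z) -(mulrA (u x _)) (uC z) !mulrA.
  by rewrite Es xy0 mul0r mulr0.
have fe x y : edge (f x) (f y) = edge x y.
  apply/eqP; rewrite eq_sym; apply: contraTT (pair0 x y) => h.
  by rewrite (qmagic_edge hu) ?eqxx.
have fi : injective f.
  move=> x y fxy; apply/eqP; apply: contraTT (pair0 x y) => xy.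
  by rewrite fxy (qmagic_mulc hu) (negbTE xy) eqxx.
have fx0 : f x0 = a0.
  apply/eqP; apply: contraNT hf => h; have [r ->] := split2 x0 _ (mem_enum _ x0).
  by rewrite mulrA (qmagic_mulr hu) (eq_sym a0) (negbTE h) mul0r.
exists f; split=> //.
suff sf : codom f =i predT.
  by apply: inj_card_bij => //; rewrite -(card_codom fi) (eq_card sf).
(* The sum [e] of column [b] can be inserted in the product; if [b] is not a value of [f], every
   resulting term vanishes. *)
move=> b; rewrite inE; apply: contraNT hf => bf.
rewrite -[u x0 a0](qmagic_unitr hu) -mulrA -(qmagic_col hu b) mulr_suml mulr_sumr big1 // => x _.
have [r ->] := split2 x _ (mem_enum _ x); rewrite (mulrA (u x b)) (qmagic_mulr hu).
by case: eqP => [E|_]; [case/codomP: bf; exists x | rewrite mul0r mulr0].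
Qed.

(** * Commutation criteria for graphs with at most five vertices *)

Definition degree (G : graph) (x : vert G) := #|[pred y | edge x y]|.

(** One round of colour refinement. The degrees 0 to 4 are all those of a graph with at most 5
    vertices. *)
Definition color (G : graph) (x : vert G) : nat * seq nat :=
  (degree x, [seq #|[pred y | edge x y && (degree y == k)]| | k <- iota 0 5]).

(* In this case the nonzero entries of a row are [e] alone or [p] and [e - p]; *)
(* the second condition excludes two independent projections [p].             *)
Definition linked_colors (G : graph) : Prop :=
  (forall a b c : vert G, color a = color b -> color b = color c ->
     [\/ a = b, b = c | a = c]) /\
  (forall a a' b b' : vert G, a <> a' -> b <> b' -> color a = color a' ->
     color b = color b' -> color a <> color b -> edge a b <> edge a b').

(** The 4-cycle [a], [b], [g], [d] need not be induced; irreflexivity makes its vertices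
    distinct. *)
Definition C4_free (G : graph) : Prop :=
  forall a g b d : vert G, a <> g -> b <> d ->
    ~~ [&& edge a b, edge a d, edge g b & edge g d].

Section SmallCriteria.
Variables (A : pzRingType) (H G : graph) (e : A) (u : vert H -> vert G -> A).
Hypothesis hu : qmagic e u.

(** Two uses of [qmagic_edge_color]: a constant colour gives the degrees, then the degree as colour
    gives the second component. *)
Lemma qmagic_color x a : natregular A -> u x a != 0 -> color x = color a.
Proof.
move=> tA; have hdeg y b : u y b != 0 -> degree y = degree b.
  have degE (K : graph) (z : vert K) : degree z = #|[pred w | edge z w && (tt == tt)]|.
    by apply: eq_card => w; rewrite !inE andbT.
  by move=> ne; rewrite !degE; apply: (qmagic_edge_color hu (cH := fun=> tt) (cG := fun=> tt)).
move=> ne; congr pair; first exact: hdeg.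
apply: eq_map => k; apply: (qmagic_edge_color hu _ tA) => // y b.
by apply: contraNeq => /hdeg ->.
Qed.

(** If [a] is alone in its colour class, [u x a = e]. Within a class of two, [u y b = e - u y a] and
    orthogonality in column [a] applies. Between two classes of two, exactly one of [edge a b] and
    [edge a b'] agrees with [edge x y]: either both products vanish, or [u x a] kills
    [u y b' = e - u y b] on both sides. *)
Lemma linked_colors_commute : natregular A -> linked_colors G ->
  forall x a y b, u x a * u y b = u y b * u x a.
Proof.
move=> tA [cl lk] x a y b.
have zcol z c : color z <> color c -> u z c = 0.
  by move=> ne; apply/eqP; apply/negP => /negP/(qmagic_color tA).
have [/eqP ->|/(qmagic_color tA) cxa] := boolP (u x a == 0); first by rewrite mul0r mulr0.
have [/eqP ->|/(qmagic_color tA) cyb] := boolP (u y b == 0); first by rewrite mul0r mulr0.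
have single z c : color z = color c -> (forall c', c' <> c -> color c' <> color c) ->
    u z c = e.
  move=> czc h; rewrite -(qmagic_row hu z) (bigD1 c) //= big1 ?addr0 // => d /eqP dc.
  by apply: zcol; rewrite czc => /esym/(h d dc).
have pairE z c c' : color z = color c -> c' <> c -> color c' = color c ->
    u z c = e - u z c'.
  move=> czc c'c ccc; rewrite -(qmagic_row hu z) (bigD1 c) //= (bigD1 c') /=; last exact/eqP.
  rewrite big1 ?addr0 ?addrK // => d /andP[/eqP dc /eqP dc'].
  apply: zcol => czd; have := cl d c c'; rewrite -czd czc -ccc => /(_ erefl erefl).
  by case=> // cc; case: c'c.
have sgl z c : color z = color c -> u z c = e \/ (exists2 c', c' <> c & color c' = color c).
  move=> czc; have [[c' h]|h] := pselect (exists c', c' <> c /\ color c' = color c).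
    by right; exists c'; case: h.
  by left; apply: single => // c' c'c cc; apply: h; exists c'.
have [->|[a' aa' ca]] := sgl x a cxa.
  by rewrite (qmagic_unitl hu) (qmagic_unitr hu).
have [cab|cab] := pselect (color b = color a).
  have [->|xy] := eqVneq x y.
    by rewrite !(qmagic_mulr hu) [b == a]eq_sym; case: eqP => // ->.
  have [->|ab] := pselect (b = a).
    by rewrite !(qmagic_mulc hu) [y == x]eq_sym (negbTE xy).
  have -> : u y b = e - u y a.
    by apply: pairE => //; apply: nesym.
  rewrite mulrBr mulrBl (qmagic_unitl hu) (qmagic_unitr hu) !(qmagic_mulc hu).
  by rewrite [y == x]eq_sym (negbTE xy).
have [->|[b' bb' cb]] := sgl y b cyb.
  by rewrite (qmagic_unitl hu) (qmagic_unitr hu).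
have eab : edge a b <> edge a b' by apply: (lk a a') => //; apply: nesym.
have [exy|/eqP exy] := eqVneq (edge x y) (edge a b); last first.
  rewrite (qmagic_edge hu); last exact/eqP.
  by rewrite (qmagic_edge hu) // edge_sym [X in _ != X]edge_sym; apply/eqP.
have z1 : u x a * u y b' = 0 by apply: (qmagic_edge hu); rewrite exy; apply/eqP.
have z2 : u y b' * u x a = 0.
  by apply: (qmagic_edge hu); rewrite edge_sym [X in _ != X]edge_sym exy; apply/eqP.
rewrite (pairE y b b') // mulrBr mulrBl z1 z2.
by rewrite (qmagic_unitl hu) (qmagic_unitr hu).
Qed.

(** Both sides equal the sum of [u z c * u w d] over the neighbours [w] of [z] and [c] of [d]. This
    recovers the relation with the adjacency matrices from the edge condition. *)
Lemma qmagic_intertwine z d :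
  \sum_(w | edge z w) u w d = \sum_(c | edge d c) u z c.
Proof.
transitivity (\sum_(w | edge z w) \sum_(c | edge d c) u z c * u w d).
  apply: eq_bigr => w zw; rewrite {1}(qmagic_insertl hu w z d) (bigID (edge d)) /=.
  rewrite [X in _ + X]big1 ?addr0 // => c dc; apply: (qmagic_edge hu).
  by rewrite zw edge_sym (negbTE dc).
rewrite exchange_big /=; apply: eq_bigr => c dc.
rewrite -[RHS](qmagic_unitr hu) -(qmagic_col hu d) mulr_sumr [RHS](bigID (edge z)) /=.
rewrite [X in _ = _ + X]big1 ?addr0 // => w zw; apply: (qmagic_edge hu).
by rewrite edge_sym [edge c d]edge_sym dc edge_sym (negbTE zw).
Qed.

(* Multiply the intertwining relation at [(z, d)] by [u y b] and [u y d]: the  *)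
(* left-hand side vanishes, and only one term remains on the right.            *)
Lemma C4_free_triple y z a b d : C4_free G -> edge y z -> d != b ->
  u y b * u z a * u y d = 0.
Proof.
move=> c4 yz db.
have [ab|nab] := boolP (edge a b); last first.
  by rewrite (qmagic_edge hu) ?mul0r // yz edge_sym (negbTE nab).
have [ad|nad] := boolP (edge a d); last first.
  by rewrite -mulrA (qmagic_edge hu (x := z)) ?mulr0 // edge_sym yz (negbTE nad).
have : u y b * (\sum_(w | edge z w) u w d) * u y d = 0.
  rewrite mulr_sumr mulr_suml big1 // => w _.
  rewrite -mulrA (qmagic_mulc hu); case: eqP => [->|_]; last by rewrite mulr0.
  by rewrite (qmagic_mulr hu) eq_sym (negbTE db).
rewrite qmagic_intertwine mulr_sumr mulr_suml (bigD1 a) /=; last by rewrite edge_sym.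
rewrite big1 ?addr0 // => g /andP[dg ga].
rewrite (qmagic_edge hu) ?mul0r // yz eq_sym; apply/negP => /eqP bg.
have /negP[] := c4 a g b d (nesym (elimN eqP ga)) (nesym (elimN eqP db)).
by rewrite ab ad edge_sym bg edge_sym dg.
Qed.

Lemma C4_free_commute y z a b : C4_free G -> edge y z ->
  u y b * u z a = u z a * u y b.
Proof.
move=> c4 yz; apply: (qmagic_commW hu) => c cb; apply: C4_free_triple => //.
by rewrite eq_sym.
Qed.

End SmallCriteria.

Lemma C4_free_both_commute (A : pzRingType) (H G : graph) (e : A)
    (u : vert H -> vert G -> A) : qmagic e u ->
  C4_free G -> C4_free (graph_compl G) ->
  forall x a y b, u x a * u y b = u y b * u x a.
Proof.
move=> hu c4 c4' x a y b; have [->|xy] := eqVneq x y.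
  by rewrite !(qmagic_mulr hu) [b == a]eq_sym; case: eqP => // ->.
have [exy|nxy] := boolP (edge x y); first exact: (C4_free_commute hu).
by apply: (C4_free_commute (qmagic_compl hu) _ _ c4'); rewrite /= /compl_edge xy.
Qed.

(** Disconnectedness witnessed by a cut, a form that can be tested by enumerating subsets. *)
Definition split_graph (G : graph) : Prop :=
  exists S : pred (vert G), (exists x, S x) /\ (exists y, ~~ S y) /\
    forall x y, S x -> ~~ S y -> ~~ edge x y.

(* Graphs on at most 5 vertices are encoded by the list of the adjacencies     *)
(* 01, 02, 12, 03, 13, 23, 04, 14, 24, 34 and checked exhaustively.            *)
Section Encoding.

(** The list holds the triangular numbers. Ordering pairs by their larger element makes the first
    [(n * n.-1)./2] of them the pairs below [n]. *)
Definition pair_code i j := (nth 0 [:: 0; 0; 1; 3; 6] j + i)%N.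

Definition decode (l : seq bool) (i j : nat) : bool :=
  if (i < j)%N then nth false l (pair_code i j)
  else if (j < i)%N then nth false l (pair_code j i) else false.

Definition pairs : seq (nat * nat) :=
  [:: (0, 1); (0, 2); (1, 2); (0, 3); (1, 3); (2, 3); (0, 4); (1, 4); (2, 4); (3, 4)]%N.

Fixpoint masks n : seq (seq bool) :=
  if n is n'.+1 then [seq true :: m | m <- masks n'] ++ [seq false :: m | m <- masks n']
  else [:: [::]].

Definition nat_split n (e : rel nat) : bool :=
  has (fun m => if has (nth false m) (iota 0 n) && has (fun i => ~~ nth false m i) (iota 0 n)
       then all (fun i => if nth false m i then
         all (fun j => nth false m j || ~~ e i j) (iota 0 n) else true) (iota 0 n)
       else false)
    (masks n).

Definition nat_degree n (e : rel nat) i := count (e i) (iota 0 n).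

Definition nat_color n (e : rel nat) i : nat * seq nat :=
  (nat_degree n e i,
   [seq count (fun j => e i j && (nat_degree n e j == k)) (iota 0 n) | k <- iota 0 5]).

Definition nat_linked n (e : rel nat) : bool :=
  let c := [seq nat_color n e i | i <- iota 0 n] in
  let eqc i j := nth (0, [::])%N c i == nth (0, [::])%N c j in
  all (fun a => all (fun b => if eqc a b then
    all (fun d => eqc b d ==> [|| a == b, b == d | a == d]) (iota 0 n) else true)
    (iota 0 n)) (iota 0 n) &&
  all (fun a => all (fun a' => if (a != a') && eqc a a' then
    all (fun b => all (fun b' =>
      if (b != b') && eqc b b' then eqc a b || (e a b != e a b') else true)
    (iota 0 n)) (iota 0 n) else true) (iota 0 n)) (iota 0 n).

Definition nat_C4_free n (e : rel nat) : bool :=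
  all (fun a => all (fun b => if e a b then all (fun d => if e a d && (b != d) then
    all (fun g => (a != g) ==> ~~ (e g b && e g d)) (iota 0 n) else true)
    (iota 0 n) else true) (iota 0 n)) (iota 0 n).

Definition nat_compl (e : rel nat) : rel nat := fun i j => (i != j) && ~~ e i j.

(** Nested conditionals, so that [vm_compute] runs a test only when the previous ones fail. *)
Definition nat_small n (e : rel nat) : bool :=
  if nat_split n e then true else
  if nat_split n (nat_compl e) then true else
  if nat_linked n e then true else
  nat_C4_free n e && nat_C4_free n (nat_compl e).

Lemma masksP m : m \in masks (size m).
Proof.
elim: m => // b m IHm; rewrite /= mem_cat.
by case: b; apply/orP; [left | right]; apply/mapP; exists m.
Qed.

Lemma nat_small_all :
  all (fun n => all (fun l => nat_small n (decode l)) (masks (n * n.-1)./2))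
    [:: 1; 2; 3; 4; 5]%N.
Proof. by vm_compute. Qed.

End Encoding.

Lemma pair_codeP m i j : (m <= 5)%N -> (i < j)%N -> (j < m)%N ->
  (pair_code i j < size (take (m * m.-1)./2 pairs))%N /\
  nth (0, 0)%N (take (m * m.-1)./2 pairs) (pair_code i j) = (i, j).
Proof.
case: m => [|[|[|[|[|[|m]]]]]] // _; case: j => [|[|[|[|[|j]]]]] //;
by case: i => [|[|[|[|i]]]].
Qed.

Section Decoding.
Variables (G : graph) (x0 : vert G).

Local Notation n := #|vert G|.
Local Notation f := (nth x0 (enum (vert G))).
Local Notation idx := (fun x => index x (enum (vert G))).

Lemma idxK x : f (idx x) = x.
Proof. by rewrite nth_index // mem_enum. Qed.

Lemma idx_lt x : (idx x < n)%N.
Proof. by rewrite cardE index_mem mem_enum. Qed.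

Lemma idxP x : idx x \in iota 0 n.
Proof. by rewrite mem_iota add0n idx_lt. Qed.

Lemma nth_enum_eq i j : i \in iota 0 n -> j \in iota 0 n -> (f i == f j) = (i == j).
Proof.
rewrite !mem_iota !add0n /= => ? ?.
by rewrite nth_uniq -?cardE // enum_uniq.
Qed.

Lemma card_count (P : pred (vert G)) (Q : pred nat) :
  (forall i, i \in iota 0 n -> P (f i) = Q i) -> #|P| = count Q (iota 0 n).
Proof.
move=> h; have -> : #|P| = count P (enum (vert G)).
  by rewrite cardE -size_filter enumT.
rewrite -{1}(mkseq_nth x0 (enum (vert G))) count_map -cardE.
by apply: eq_in_count.
Qed.

Variable e : rel nat.
Hypothesis eE : forall i j, i \in iota 0 n -> j \in iota 0 n -> e i j = edge (f i) (f j).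

Lemma nat_degreeE i : i \in iota 0 n -> nat_degree n e i = degree (f i).
Proof. by move=> hi; apply/esym/card_count => j hj; rewrite /= eE. Qed.

Lemma nat_colorE i : i \in iota 0 n -> nat_color n e i = color (f i).
Proof.
move=> hi; congr pair; first exact: nat_degreeE.
apply: eq_map => k; apply/esym/card_count => j hj.
by rewrite /= eE // nat_degreeE.
Qed.

Lemma nat_splitP : nat_split n e -> split_graph G.
Proof.
case/hasP => m _; case: ifP => // /andP[/hasP[i hi mi] /hasP[j hj mj]] /allP h.
have idxf k : k \in iota 0 n -> idx (f k) = k.
  by rewrite mem_iota add0n /= => kn; rewrite index_uniq ?enum_uniq -?cardE.
exists (fun x => nth false m (idx x)); split; [|split].
- by exists (f i); rewrite idxf.
- by exists (f j); rewrite idxf.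
move=> x y mx my; have := h _ (idxP x); rewrite mx => /allP/(_ _ (idxP y)).
by rewrite (negbTE my) /= eE ?idxP // !idxK.
Qed.

Lemma nat_linkedP : nat_linked n e -> linked_colors G.
Proof.
have nc i : i \in iota 0 n ->
    nth (0, [::])%N [seq nat_color n e i | i <- iota 0 n] i = color (f i).
  move=> hi; rewrite -nat_colorE //; move: hi; rewrite mem_iota add0n /= => hi.
  by rewrite (nth_map 0%N) ?size_iota // nth_iota ?add0n.
case/andP => /allP h1 /allP h2; split=> [a b c cab cbc|a a' b b' aa bb ca cb cab].
  have /allP/(_ _ (idxP b)) := h1 _ (idxP a); rewrite !nc ?idxP // !idxK cab eqxx.
  move=> /allP/(_ _ (idxP c)); rewrite !nc ?idxP // !idxK cbc eqxx.
  rewrite -!nth_enum_eq ?idxP // !idxK.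
  by case/or3P => /eqP; [constructor 1 | constructor 2 | constructor 3].
have /allP/(_ _ (idxP a')) := h2 _ (idxP a).
rewrite !nc ?idxP // !idxK ca eqxx andbT -nth_enum_eq ?idxP // !idxK.
case: eqP => // _ /allP/(_ _ (idxP b)) /allP/(_ _ (idxP b')).
rewrite !nc ?idxP // !idxK cb eqxx andbT -nth_enum_eq ?idxP // !idxK.
case: eqP => // _; rewrite -ca -cb; have /eqP/negbTE -> := cab.
by rewrite !eE ?idxP // !idxK => /eqP.
Qed.

Lemma nat_C4_freeP : nat_C4_free n e -> C4_free G.
Proof.
move=> /allP h a g b d ag bd; apply/negP => /and4P[ab ad gb gd].
have /allP/(_ _ (idxP b)) := h _ (idxP a); rewrite eE ?idxP // !idxK ab.
move=> /allP/(_ _ (idxP d)); rewrite eE ?idxP // -nth_enum_eq ?idxP // !idxK ad.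
case: eqP => // _ /allP/(_ _ (idxP g)).
rewrite -nth_enum_eq ?idxP // !eE ?idxP // !idxK gb gd.
by case: eqP.
Qed.

End Decoding.

Lemma small_graph (G : graph) : graphs_le5 G ->
  [\/ split_graph G, split_graph (graph_compl G), linked_colors G |
      C4_free G /\ C4_free (graph_compl G)].
Proof.
move=> G5; have [x0 _] := elimT card_gt0P (vert_gt0 G).
set n := #|vert G|; pose f := nth x0 (enum (vert G)).
pose l := [seq edge (f p.1) (f p.2) | p <- take (n * n.-1)./2 pairs].
have n0 : (0 < n)%N := vert_gt0 G.
have nth_l i j : (i < j)%N -> (j < n)%N -> nth false l (pair_code i j) = edge (f i) (f j).
  move=> ij jn; have [lt E] := pair_codeP G5 ij jn.
  by rewrite (nth_map (0, 0)%N) // E.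
have dE i j : i \in iota 0 n -> j \in iota 0 n -> decode l i j = edge (f i) (f j).
  rewrite !mem_iota !add0n /= /decode => hi hj; have [ij|ji|->] := ltngtP i j.
  - exact: nth_l.
  - by rewrite nth_l // edge_sym.
  - by rewrite edge_irr.
have dcE i j : i \in iota 0 n -> j \in iota 0 n ->
    nat_compl (decode l) i j = @edge (graph_compl G) (f i) (f j).
  by move=> hi hj; rewrite /nat_compl dE //= /compl_edge nth_enum_eq.
have sl : size l = (n * n.-1)./2.
  rewrite size_map size_take; move: (G5) n0; rewrite /graphs_le5 -/n.
  by case: (n) => [|[|[|[|[|[|m]]]]]].
have : nat_small n (decode l).
  have /allP/(_ n) := nat_small_all; rewrite !inE.
  have -> : [|| n == 1, n == 2, n == 3, n == 4 | n == 5]%N.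
    by move: (G5) n0; rewrite /graphs_le5 -/n; case: (n) => [|[|[|[|[|[|m]]]]]].
  by move=> /(_ isT) /allP; apply; rewrite -sl masksP.
rewrite /nat_small; case: ifP => [/(nat_splitP dE)|_]; first by constructor 1.
case: ifP => [/(nat_splitP (G := graph_compl G) dcE)|_]; first by constructor 2.
case: ifP => [/(nat_linkedP dE)|_]; first by constructor 3.
case/andP => /(nat_C4_freeP dE) h /(nat_C4_freeP (G := graph_compl G) dcE) h'.
by constructor 4.
Qed.

(** * Components and the class [co graphs_le5] *)

Section GraphIso.

Lemma graph_iso_refl (G : graph) : graph_iso G G.
Proof. by exists id; split=> //; exists id. Qed.

Lemma graph_iso_sym (G H : graph) : graph_iso G H -> graph_iso H G.
Proof.
move=> [f [[g fK gK] hf]]; exists g; split=> [|x y]; first by exists f.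
by rewrite -hf !gK.
Qed.

Lemma graph_iso_trans (G H K : graph) : graph_iso G H -> graph_iso H K -> graph_iso G K.
Proof.
move=> [f [bf hf]] [g [bg hg]]; exists (g \o f); split=> [|x y]; first exact: bij_comp.
by rewrite /= hg hf.
Qed.

Lemma graph_iso_card (G H : graph) : graph_iso G H -> #|vert G| = #|vert H|.
Proof. by move=> [f [bf _]]; apply: bij_eq_card bf. Qed.

Lemma graph_iso_compl (G H : graph) :
  graph_iso G H -> graph_iso (graph_compl G) (graph_compl H).
Proof.
move=> [f [bf hf]]; exists f; split=> // x y.
by rewrite /= /compl_edge hf (bij_eq bf).
Qed.

Lemma graph_compl_compl (G : graph) : graph_iso (graph_compl (graph_compl G)) G.
Proof.
exists id; split=> [|x y]; first by exists id.
rewrite /= /compl_edge /= /compl_edge.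
by case: eqP => [->|_] /=; rewrite ?edge_irr ?negbK.
Qed.

Lemma split_graph_iso (G H : graph) : graph_iso G H -> split_graph G -> split_graph H.
Proof.
move=> [f [[g fK gK] hf]] [S [[x Sx] [[y Sy] h]]].
exists (fun z => S (g z)); split; first by exists (f x); rewrite fK.
split; first by exists (f y); rewrite fK.
by move=> z t hz ht; rewrite -(gK z) -(gK t) hf h.
Qed.

Lemma split_graph_union (G H : graph) : split_graph (graph_union G H).
Proof.
have [x _] := elimT card_gt0P (vert_gt0 G); have [y _] := elimT card_gt0P (vert_gt0 H).
exists (fun z => if z is inl _ then true else false); split; first by exists (inl x).
by split; [exists (inr y) | case=> ? [] ?].
Qed.

Lemma aut_trivial_iso (G H : graph) : graph_iso G H -> aut_trivial G -> aut_trivial H.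
Proof.
move=> [f [bf hf]] aG p hp; have [g fK gK] := bf.
have inj : injective (g \o p \o f).
  by apply: inj_comp (bij_inj bf); apply: inj_comp (can_inj gK) perm_inj.
have /permP h : perm inj = 1%g.
  by apply: aG => x y; rewrite !permE /= -hf !gK hp hf.
apply/permP => x; rewrite perm1; have := h (g x).
by rewrite permE perm1 /= gK => /(can_inj gK).
Qed.

End GraphIso.

Section Induced.
Variables (G : graph) (S : pred (vert G)).
Hypothesis S0 : exists x, S x.

Definition induced_edge : rel {x | S x} := fun x y => edge (val x) (val y).
Fact induced_edge_sym : symmetric induced_edge.
Proof. by move=> x y; apply: edge_sym. Qed.
Fact induced_edge_irr : irreflexive induced_edge.
Proof. by move=> x; apply: edge_irr. Qed.
Fact induced_vert_gt0 : (0 < #|{: {x | S x}}|)%N.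
Proof. by have [x Sx] := S0; apply/card_gt0P; exists (exist _ x Sx). Qed.

Definition induced : graph := Graph induced_edge_sym induced_edge_irr induced_vert_gt0.

Lemma card_induced : #|vert induced| = #|S|.
Proof. by rewrite card_sig. Qed.
End Induced.

Lemma split_union_iso (G : graph) (S : pred (vert G))
    (S0 : exists x, S x) (S1 : exists x, [predC S] x) :
  (forall x y, S x -> ~~ S y -> ~~ edge x y) ->
  graph_iso (graph_union (induced S0) (induced S1)) G.
Proof.
move=> h; exists (fun z => match z with inl x => val x | inr x => val x end).
split=> [|[x|x] [y|y]] //=.
- apply: inj_card_bij => [[x|x] [y|y] /= xy|].
  + by move/val_inj: xy => ->.
  + by case/negP: (svalP y); rewrite /= -xy; exact: (svalP x).
  + by case/negP: (svalP x); rewrite /= xy; exact: (svalP y).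
  + by move/val_inj: xy => ->.
  by rewrite /= card_sum !card_sig cardC.
- by apply/negbTE/h; [exact: (svalP x) | exact: (svalP y)].
- by rewrite edge_sym; apply/negbTE/h; [exact: (svalP y) | exact: (svalP x)].
Qed.

Definition component (G : graph) (a : vert G) : graph :=
  induced (ex_intro (fun x => connect (@edge G) a x) a (connect0 _ a)).

Section Components.
Variable G : graph.
Implicit Types x y a b : vert G.
Local Notation cn := (connect (@edge G)).

Lemma cn_sym x y : cn x y = cn y x.
Proof. by apply: sym_connect_sym; apply: edge_sym. Qed.

Lemma cn_eql x y z : cn x y -> cn x z = cn y z.
Proof. by move=> h; apply: (same_connect (sym_connect_sym (@edge_sym G)) h). Qed.

Lemma cn_eqr x y z : cn x y -> cn z x = cn z y.
Proof. by move=> h; rewrite ![cn z _]cn_sym (cn_eql _ h). Qed.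

Lemma edge_cn x y z : ~~ cn z x -> cn z y -> edge x y = false.
Proof. by move=> h zy; apply/negP => /connect1 /cn_eqr xy; rewrite xy zy in h. Qed.

Lemma card_component a : #|vert (component a)| = #|[pred x | cn a x]|.
Proof. exact: card_induced. Qed.

Lemma component_lt a : split_graph G -> (#|vert (component a)| < #|vert G|)%N.
Proof.
move=> [S [[x Sx] [[y Sy] h]]]; rewrite card_component.
have nxy : ~~ cn x y.
  apply/negP => /connectP[p]; elim: p x Sx => [|z p IHp] x Sx /=.
    by move=> _ yx; rewrite yx Sx in Sy.
  move=> /andP[xz pz] yE; apply: (IHp z) => //.
  by apply: contraLR xz; apply: h.
apply: proper_card; apply/properP; split; first by apply/fintype.subsetP.
have [ax|] := boolP (cn a x); last by exists x.
by exists y => //; rewrite inE (cn_eql _ ax).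
Qed.

Lemma nsplit_connect : ~ split_graph G -> forall x y, cn x y.
Proof.
move=> ns x y; apply/negP => /negP nxy; apply: ns.
exists (fun z => cn x z); split; first by exists x.
split; first by exists y.
by move=> z t xz xt; apply/negP => /connect1/cn_eqr zt; rewrite zt (negbTE xt) in xz.
Qed.

Lemma component_eq a b : cn a b -> graph_iso (component a) (component b).
Proof.
move=> ab; have h x : cn a x -> cn b x by rewrite (cn_eql _ ab).
have h' x : cn b x -> cn a x by rewrite (cn_eql _ ab).
exists (fun x : vert (component a) =>
  exist _ (val x) (h _ (svalP x)) : vert (component b)).
split=> //; exists (fun x : vert (component b) =>
  exist _ (val x) (h' _ (svalP x)) : vert (component a)); by move=> x; apply: val_inj.
Qed.

Lemma component_connected : (forall x y, cn x y) -> forall a, graph_iso (component a) G.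
Proof.
move=> h a; exists (fun x : vert (component a) => val x); split=> //.
by exists (fun x : vert G => exist _ x (h a x) : vert (component a)) => x //; apply: val_inj.
Qed.

End Components.

(** A total function instead of a map between subtypes, so that such maps can be glued by a case
    distinction. *)
Lemma component_iso_fun (G H : graph) (a : vert G) (b : vert H) :
  graph_iso (component a) (component b) ->
  exists g : vert G -> vert H,
    [/\ forall x, connect (@edge G) a x -> connect (@edge H) b (g x),
        forall x y, connect (@edge G) a x -> connect (@edge G) a y ->
          g x = g y -> x = y &
        forall x y, connect (@edge G) a x -> connect (@edge G) a y ->
          edge (g x) (g y) = edge x y].
Proof.
move=> [f [bf hf]]; pose g x := if insub x is Some x' then val (f x') else b.
have gE x (hx : connect (@edge G) a x) : g x = val (f (exist _ x hx)).
  by rewrite /g insubT.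
exists g; split=> [x hx|x y hx hy|x y hx hy]; rewrite !gE.
- exact: (svalP (f _)).
- by move=> /val_inj/(bij_inj bf) [].
- exact: hf.
Qed.

(** * Induction on the class [co graphs_le5] *)

Lemma co_iso_class F (G H : graph) : graph_iso G H -> co F G -> co F H.
Proof. exact: co_iso. Qed.

(** Stability under induced subgraphs, phrased with embeddings so that it passes through the
    isomorphisms of [co_iso]. A subgraph of a union lies on one side or is the union of its two
    traces. *)
Lemma co_le5_hereditary (G : graph) : co graphs_le5 G ->
  forall (K : graph) (f : vert K -> vert G), injective f ->
    (forall x y, edge (f x) (f y) = edge x y) -> co graphs_le5 K.
Proof.
elim=> {G} [G G5|G H _ IHG _ IHH|G _ IHG|G H [g [bg hg]] _ IHG] K f fi hf.
- by apply: co_base; apply: leq_trans (leq_card _ fi) G5.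
- have [x0 _] := elimT card_gt0P (vert_gt0 G); have [y0 _] := elimT card_gt0P (vert_gt0 H).
  pose S x := if f x is inl _ then true else false.
  pose fl x := if f x is inl z then z else x0.
  pose fr x := if f x is inr z then z else y0.
  have flE x : S x -> f x = inl (fl x) by rewrite /S /fl; case: (f x).
  have frE x : ~~ S x -> f x = inr (fr x) by rewrite /S /fr; case: (f x).
  have [S0|nS0] := pselect (exists x, S x); last first.
    have nS x : ~~ S x by apply/negP => Sx; apply: nS0; exists x.
    apply: (IHH K fr) => [x y fxy|x y]; first by apply: fi; rewrite !frE // fxy.
    by rewrite -hf !frE.
  have [S1|nS1] := pselect (exists x, [predC S] x); last first.
    have nS x : S x by apply/negP => /negP Sx; apply: nS1; exists x.
    apply: (IHG K fl) => [x y fxy|x y]; first by apply: fi; rewrite !flE // fxy.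
    by rewrite -hf !flE.
  have := split_union_iso S0 S1; move/(_ _)/co_iso_class; apply.
    by move=> x y Sx Sy; rewrite -hf flE // frE.
  apply: co_union.
    apply: (IHG _ (fun x : vert (induced S0) => fl (val x))) => [x y fxy|x y].
      apply/val_inj/fi; rewrite !flE ?fxy //; first [exact: (svalP x) | exact: (svalP y)].
    by rewrite /= /induced_edge -hf !flE //; first [exact: (svalP x) | exact: (svalP y)].
  apply: (IHH _ (fun x : vert (induced S1) => fr (val x))) => [x y fxy|x y].
    apply/val_inj/fi; rewrite !frE ?fxy //; first [exact: (svalP x) | exact: (svalP y)].
  by rewrite /= /induced_edge -hf !frE //; first [exact: (svalP x) | exact: (svalP y)].
- apply: (co_iso_class (graph_compl_compl K)); apply: co_compl.
  apply: (IHG _ (f : vert (graph_compl K) -> vert G)) => // x y.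
  have := hf x y; rewrite /= /compl_edge (inj_eq fi); case: eqP => [->|_] /=.
    by rewrite !edge_irr.
  by move=> <-; rewrite negbK.
have [g' gK g'K] := bg.
apply: (IHG K (g' \o f)) => [x y /= /(can_inj g'K)/fi //|x y /=].
by rewrite -hg !g'K.
Qed.

Lemma co_le5_induced (G : graph) (S : pred (vert G)) (S0 : exists x, S x) :
  co graphs_le5 G -> co graphs_le5 (induced S0).
Proof.
move=> FG; apply: (co_le5_hereditary FG (K := induced S0) (f := fun x => val x)) => //.
by move=> x y /val_inj.
Qed.

Lemma co_le5_split (G : graph) : co graphs_le5 G ->
  [\/ graphs_le5 G, split_graph G | split_graph (graph_compl G)].
Proof.
elim=> {G} [G G5|G H _ _ _ _|G _ []|G H GH _ []].
- by constructor 1.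
- by constructor 2; apply: split_graph_union.
- by move=> G5; constructor 1.
- by move=> h; constructor 3; apply: split_graph_iso (graph_iso_sym (graph_compl_compl G)) h.
- by move=> h; constructor 2.
- by move=> G5; constructor 1; rewrite /graphs_le5 -(graph_iso_card GH).
- by move=> h; constructor 2; apply: split_graph_iso h.
- by move=> h; constructor 3; apply: split_graph_iso (graph_iso_compl GH) h.
Qed.

(** Induction on the number of vertices. The complement step asks for [P (graph_compl G)], which is
    no smaller; it is applied only when that complement is disconnected, so that the second case
    settles it. *)
Lemma co_le5_ind (P : graph -> Prop) :
  (forall G, graphs_le5 G -> linked_colors G \/ C4_free G /\ C4_free (graph_compl G) -> P G) ->
  (forall G, co graphs_le5 G -> split_graph G ->
     (forall K, co graphs_le5 K -> (#|vert K| < #|vert G|)%N -> P K) -> P G) ->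
  (forall G, P (graph_compl G) -> P G) ->
  forall G, co graphs_le5 G -> P G.
Proof.
move=> Psmall Psplit Pcompl G; have [n] := ubnP #|vert G|; elim: n G => // n IHn G Gn FG.
have split_case K : #|vert K| = #|vert G| -> co graphs_le5 K -> split_graph K -> P K.
  move=> KG FK sK; apply: Psplit => // L FL LK; apply: IHn => //.
  by apply: leq_trans LK _; rewrite KG.
have cosplit : split_graph (graph_compl G) -> P G.
  by move=> s; apply: Pcompl; apply: split_case => //; apply: co_compl.
have [G5|s|s] := co_le5_split FG; last 2 first.
- exact: split_case.
- exact: cosplit.
have [s|s|l|c] := small_graph G5.
- exact: split_case.
- exact: cosplit.
- by apply: Psmall => //; left.
- by apply: Psmall => //; right.
Qed.

Lemma split_compl_connected (G : graph) : split_graph G ->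
  forall x y, connect (@edge (graph_compl G)) x y.
Proof.
move=> [S [[x0 Sx0] [[y0 Sy0] h]]].
have cross x y : S x -> ~~ S y -> @edge (graph_compl G) x y.
  move=> Sx Sy; rewrite /= /compl_edge h // andbT.
  by apply: contraNneq Sy => <-.
have cross' x y : S x -> ~~ S y -> @edge (graph_compl G) y x.
  by move=> Sx Sy; rewrite edge_sym cross.
move=> x y; have [Sx|Sx] := boolP (S x); have [Sy|Sy] := boolP (S y).
- exact: connect_trans (connect1 (cross _ _ Sx Sy0)) (connect1 (cross' _ _ Sy Sy0)).
- exact: connect1 (cross _ _ Sx Sy).
- exact: connect1 (cross' _ _ Sy Sx).
- exact: connect_trans (connect1 (cross' _ _ Sx0 Sx)) (connect1 (cross _ _ Sx0 Sy)).
Qed.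

Lemma connected_or_compl (G : graph) :
  (forall x y : vert G, connect (@edge G) x y) \/
  (forall x y, connect (@edge (graph_compl G)) x y).
Proof.
have [s|ns] := pselect (split_graph G).
  by right; apply: split_compl_connected.
by left; apply: nsplit_connect.
Qed.

(** The image of [f] is closed under adjacency, so walks starting in it stay in it and lift back to
    [G]. *)
Lemma component_embed (G H : graph) (f : vert G -> vert H) :
  injective f -> (forall x y, edge (f x) (f y) = edge x y) ->
  (forall x z, edge (f x) z -> exists y, z = f y) ->
  forall x, graph_iso (component x) (component (f x)).
Proof.
move=> fi hf cl x.
have cf y : connect (@edge G) x y -> connect (@edge H) (f x) (f y).
  move=> /connectP[p]; elim: p x => [|z p IHp] x' /=; first by move=> _ ->.
  move=> /andP[xz pz] yE; apply: connect_trans (connect1 _) (IHp z pz yE).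
  by rewrite hf.
have fc z : connect (@edge H) (f x) z -> exists2 y, z = f y & connect (@edge G) x y.
  move=> /connectP[p]; elim: p x {cf} => [|t p IHp] x' /=; first by move=> _ ->; exists x'.
  move=> /andP[xt pt] zE; have [y ty] := cl _ _ xt; rewrite ty in xt pt zE.
  have [w -> yw] := IHp y pt zE; exists w => //.
  by apply: connect_trans yw; apply: connect1; rewrite -hf.
exists (fun y : vert (component x) =>
  exist _ (f (val y)) (cf _ (svalP y)) : vert (component (f x))).
split=> [|y z]; last exact: hf.
apply: inj_card_bij => [y z [] /fi/val_inj //|].
rewrite !card_component.
have -> : #|[pred y | connect (@edge G) x y]| = #|f @: [set y | connect (@edge G) x y]|.
  by rewrite card_imset // cardsE.
apply: subset_leq_card; apply/fintype.subsetP => z /fc[y -> xy].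
by apply: imset_f; rewrite inE.
Qed.

Local Notation cn := (connect (@edge _)).

(** * Quantum rigidity *)

Definition same_type (G H : graph) (a : vert G) (b : vert H) : bool :=
  `[< graph_iso (component a) (component b) >].

Lemma same_type_refl (G : graph) (a : vert G) : same_type a a.
Proof. exact/asboolP/graph_iso_refl. Qed.

Lemma same_type_sym (G H : graph) (a : vert G) (b : vert H) :
  same_type a b = same_type b a.
Proof. by apply/asboolP/asboolP; apply: graph_iso_sym. Qed.

Lemma same_type_trans (G H K : graph) (b : vert H) (a : vert G) (c : vert K) :
  same_type a b -> same_type b c -> same_type a c.
Proof. by move=> /asboolP h /asboolP k; apply/asboolP; apply: graph_iso_trans h k. Qed.

Lemma same_type_cn (G : graph) (a b : vert G) : cn a b -> same_type a b.
Proof. by move=> h; apply/asboolP/component_eq. Qed.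

Lemma same_type_eql (G H K : graph) (a : vert G) (b : vert H) (c : vert K) :
  same_type a b -> same_type a c = same_type b c.
Proof.
move=> ab; apply/idP/idP; last exact: same_type_trans.
by apply: same_type_trans; rewrite same_type_sym.
Qed.

(* Remove a component of [H] and one of [G] of the same type, and glue.        *)
Lemma iso_of_component_counts (H G : graph) :
  #|vert H| = #|vert G| ->
  (forall x : vert H, #|[pred y : vert H | same_type x y]| =
                      #|[pred a : vert G | same_type x a]|) ->
  graph_iso H G.
Proof.
move=> cHG cnt.
have [a0 _] := elimT card_gt0P (vert_gt0 G).
(* The induction removes components, hence a statement about unions of components [S] and [T].
   Counting vertices of each type amounts to counting components, since components of one type have
   the same size. *)
suff glue n (S : {set vert H}) (T : {set vert G}) : (#|S| <= n)%N -> #|S| = #|T| ->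
    (forall x y, cn x y -> (x \in S) = (y \in S)) ->
    (forall a b, cn a b -> (a \in T) = (b \in T)) ->
    (forall x, x \in S -> #|[pred y in S | same_type x y]| =
                          #|[pred a in T | same_type x a]|) ->
    exists g : vert H -> vert G,
      [/\ {in S, forall x, g x \in T}, {in S &, injective g} &
          {in S &, forall x y, edge (g x) (g y) = edge x y}].
  have [||x y _|a b _|x _|g [_ gi ge]] := glue #|[set: vert H]| [set: vert H] [set: vert G].
  - by [].
  - by rewrite !cardsT.
  - by rewrite !inE.
  - by rewrite !inE.
  - have := cnt x; rewrite (eq_card (B := [pred y in [set: vert H] | same_type x y])).
      by move=> ->; apply: eq_card => a; rewrite !inE.
    by move=> y; rewrite !inE.
  exists g; split=> [|x y]; last by rewrite ge ?inE.
  apply: inj_card_bij; last by rewrite cHG.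
  by move=> x y; apply: gi; rewrite inE.
elim: n S T => [|n IHn] S T Sn ST clS clT hST.
  have S0 : S = set0 by apply/eqP; rewrite -cards_eq0 -leqn0.
  by exists (fun=> a0); split=> x; rewrite S0 inE.
have [->|/set0Pn[x xS]] := eqVneq S set0.
  by exists (fun=> a0); split=> x; rewrite inE.
have [a /andP[aT xa]] : exists a, a \in [pred a in T | same_type x a].
  by apply/card_gt0P; rewrite -hST //; apply/card_gt0P; exists x; rewrite inE xS same_type_refl.
pose X := [set y | cn x y]; pose Y := [set b | cn a b].
have XS : X \subset S.
  by apply/fintype.subsetP => y; rewrite inE => xy; rewrite -(clS x).
have YT : Y \subset T.
  by apply/fintype.subsetP => b; rewrite inE => ab; rewrite -(clT a).
have XY : #|X| = #|Y|.
  rewrite !cardsE -!card_component; apply: graph_iso_card.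
  exact/asboolP.
have x0 : (0 < #|X|)%N by apply/card_gt0P; exists x; rewrite inE connect0.
have cardX (y : vert H) : #|[pred z in X | same_type y z]| =
    if same_type y x then #|X| else 0%N.
  case: ifP => yx; last first.
    apply/eqP; rewrite -leqn0 leqNgt; apply/negP => /card_gt0P[z /andP[]].
    rewrite inE => /same_type_cn xz yz.
    by rewrite (same_type_trans yz) // same_type_sym in yx.
  apply: eq_card => z; rewrite !inE; case: (boolP (cn x z)) => //= xz.
  by apply: same_type_trans yx (same_type_cn xz).
have cardY (y : vert H) : #|[pred z in Y | same_type y z]| =
    if same_type y x then #|X| else 0%N.
  case: ifP => yx; last first.
    apply/eqP; rewrite -leqn0 leqNgt; apply/negP => /card_gt0P[z /andP[]].
    rewrite inE => /same_type_cn az yz; move: yx.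
    by rewrite (same_type_trans yz) // same_type_sym (same_type_trans xa).
  rewrite XY; apply: eq_card => z; rewrite !inE; case: (boolP (cn a z)) => //= az.
  by apply: same_type_trans yx (same_type_trans xa (same_type_cn az)).
have split_card (V : graph) (U W : {set vert V}) (y : vert H) : W \subset U ->
    #|[pred z in U | same_type y z]| =
    (#|[pred z in W | same_type y z]| + #|[pred z in U :\: W | same_type y z]|)%N.
  move=> WU; rewrite -(cardID W [pred z in U | same_type y z]).
  congr (_ + _)%N; apply: eq_card => z; rewrite !inE.
    case: (boolP (z \in W)) => zW; rewrite ?andbF ?andbT //=.
    by rewrite (fintype.subsetP WU).
  by rewrite andbA.
have [||y z yz|b c bc|y|g [gT gi ge]] := IHn (S :\: X) (T :\: Y).
- rewrite cardsDS // -ltnS; apply: leq_trans Sn; rewrite -subSn ?subset_leq_card //.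
  by rewrite leq_subLR -addn1 addnC leq_add2r.
- by rewrite !cardsDS // XY ST.
- by rewrite !inE (clS _ _ yz) (cn_eqr _ yz).
- by rewrite !inE (clT _ _ bc) (cn_eqr _ bc).
- rewrite inE => /andP[_ yS]; apply/eqP; rewrite -(eqn_add2l (if same_type y x then #|X| else 0%N)).
  by rewrite -{1}cardX -cardY -!split_card // hST.
have [h [hX hi he]] := component_iso_fun (elimT (asboolP _) xa).
have SD y : y \in S -> ~~ cn x y -> y \in S :\: X by rewrite !inE => -> ->.
exists (fun y => if cn x y then h y else g y); split=> [y yS|y z yS zS|y z yS zS] /=.
- case: ifP => xy; first by rewrite -(clT a) ?hX.
  by have := gT y (SD _ yS (negbT xy)); rewrite inE => /andP[].
- case: ifP => xy; case: ifP => xz.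
  + exact: hi.
  + move=> E; have := gT z (SD _ zS (negbT xz)).
    by rewrite -E !inE hX.
  + move=> E; have := gT y (SD _ yS (negbT xy)).
    by rewrite E !inE hX.
  + by apply: gi; apply: SD => //; apply/negbT.
- case: ifP => xy; case: ifP => xz.
  + exact: he.
  + have := gT z (SD _ zS (negbT xz)); rewrite !inE => /andP[agz _].
    by rewrite edge_sym (edge_cn agz (hX _ xy)) edge_sym (edge_cn (negbT xz) xy).
  + have := gT y (SD _ yS (negbT xy)); rewrite !inE => /andP[agy _].
    by rewrite (edge_cn agy (hX _ xz)) (edge_cn (negbT xy) xz).
  + by apply: ge; apply: SD => //; apply/negbT.
Qed.

Section Blocks.
Variables (A : pzRingType) (H G : graph) (e : A) (u : vert H -> vert G -> A).
Hypothesis hu : qmagic e u.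

Definition block x a : A := \sum_(b | cn a b) u x b.

(** By [qmagic_connect] both sums equal that of [u x b * u y a] over [b] connected to [a] and [y]
    connected to [x]. Hence a block sum depends only on the two components and can serve as the unit
    of the block. *)
Lemma block_col x a : block x a = \sum_(y | cn x y) u y a.
Proof.
transitivity (\sum_(b | cn a b) \sum_(y | cn x y) u x b * u y a).
  apply: eq_bigr => b ab; rewrite -[LHS](qmagic_unitr hu) -(qmagic_col hu a) mulr_sumr.
  rewrite (bigID (cn x)) /= [X in _ + X]big1 ?addr0 // => y xy.
  by apply: (qmagic_connect hu); rewrite (negbTE xy) cn_sym ab.
rewrite exchange_big /=; apply: eq_bigr => y xy.
rewrite [RHS](qmagic_insertl hu y x a) [RHS](bigID (cn a)) /= [X in _ = _ + X]big1 ?addr0 // => b ab.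
by apply: (qmagic_connect hu); rewrite xy cn_sym (negbTE ab).
Qed.

Lemma block_cnr x a b : cn a b -> block x a = block x b.
Proof. by move=> ab; apply: eq_bigl => c; rewrite (cn_eql _ ab). Qed.

Lemma block_cnl x y a : cn x y -> block x a = block y a.
Proof. by move=> xy; rewrite !block_col; apply: eq_bigl => c; rewrite (cn_eql _ xy). Qed.

Lemma block_unitl x a : block x a * u x a = u x a.
Proof.
rewrite mulr_suml (bigD1 a) ?connect0 //= big1 ?addr0 ?(qmagic_idem hu) // => b /andP[_ ba].
by rewrite (qmagic_mulr hu) (negbTE ba).
Qed.

Lemma block_qmagic x a : qmagic (H := component x) (G := component a) (block x a)
  (fun y b => u (val y) (val b)).
Proof.
have val_sum (K : graph) (c : vert K) (F : vert K -> A) :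
    \sum_(b : vert (component c)) F (val b) = \sum_(b | cn c b) F b.
  rewrite [RHS](reindex_omap (fun b : vert (component c) => val b) insub) => [|b cb].
    by apply: eq_bigl => b; rewrite valK eqxx andbT; apply/esym/(svalP b).
  by rewrite /= insubT.
split=> [y b c|y z b|y|b|y z b c].
- by rewrite (qmagic_mulr hu) val_eqE.
- by rewrite (qmagic_mulc hu) val_eqE.
- by rewrite val_sum -/(block (val y) a); apply/esym/block_cnl; exact: (svalP y).
- rewrite (val_sum _ _ (fun z => u z (val b))) -block_col.
  by apply/esym/block_cnr; exact: (svalP b).
- exact: (qmagic_edge hu).
Qed.

End Blocks.

(** Double counting as in [qmagic_edge_color], with [e] in place of an entry. *)
Lemma qmagic_card (A : pzRingType) (H G : graph) (e : A) (u : vert H -> vert G -> A)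
    (P : pred (vert H)) (Q : pred (vert G)) :
  qmagic e u -> natregular A -> e != 0 ->
  (forall x a, u x a != 0 -> P x = Q a) -> #|P| = #|Q|.
Proof.
move=> hu tA e0 PQ.
have E : e *+ #|P| = e *+ #|Q|.
  transitivity (\sum_(x | P x) \sum_(a | Q a) u x a).
    rewrite -[X in X = _](sumr_const P); apply: eq_bigr => x Px.
    rewrite -(qmagic_row hu x) (bigID Q) /= [X in _ + X]big1 ?addr0 // => a Qa.
    apply/eqP; apply: contraNT Qa => /PQ <-; exact: Px.
  rewrite exchange_big -[X in _ = X](sumr_const Q) /=; apply: eq_bigr => a Qa.
  rewrite -(qmagic_col hu a) [RHS](bigID P) /= [X in _ = _ + X]big1 ?addr0 // => x Px.
  by apply/eqP; apply: contraNT Px => /PQ ->; exact: Qa.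
apply/eqP; apply: contraNT e0 => ne; apply/eqP.
have [lt|gt|eq] := ltngtP #|P| #|Q|; last by rewrite eq eqxx in ne.
  apply: (tA _ (#|Q| - #|P|).-1); rewrite prednK ?subn_gt0 // mulrnBr ?(ltnW lt) //.
  by rewrite E subrr.
apply: (tA _ (#|P| - #|Q|).-1); rewrite prednK ?subn_gt0 // mulrnBr ?(ltnW gt) //.
by rewrite E subrr.
Qed.

(** Quantified over all units [e], so that the induction hypothesis applies to blocks. *)
Definition quantum_rigid (G : graph) : Prop :=
  forall (A : pzRingType) (H : graph) (e : A) (u : vert H -> vert G -> A),
    natregular A -> qmagic e u -> e != 0 -> graph_iso H G.

Lemma quantum_rigid_same_type (A : pzRingType) (H G : graph) (e : A)
    (u : vert H -> vert G -> A) : natregular A -> qmagic e u ->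
  (forall a : vert G, quantum_rigid (component a)) ->
  forall x a, u x a != 0 -> same_type x a.
Proof.
move=> tA hu rG x a ua; apply/asboolP; apply: rG tA (block_qmagic hu x a) _.
by apply: contraNneq ua => p0; rewrite -(block_unitl hu) p0 mul0r.
Qed.

Theorem co_le5_quantum_rigid (G : graph) : co graphs_le5 G -> quantum_rigid G.
Proof.
move: G; apply: co_le5_ind => [G _ crit|G FG sG IH|G IH] A H e u tA hu e0.
- have [x _] := elimT card_gt0P (vert_gt0 H).
  have [a ua] : exists a, u x a != 0.
    apply/existsP; apply: contraNT e0; rewrite negb_exists => /forallP h.
    by rewrite -(qmagic_row hu x) big1 // => a _; apply/eqP; rewrite -[_ == _]negbK.
  have uC : forall x a y b, u x a * u y b = u y b * u x a.
    by case: crit => [l|[c4 c4']]; [apply: (linked_colors_commute hu) |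
      apply: (C4_free_both_commute hu)].
  by have [f [bf hf _]] := qmagic_commutative_iso hu uC ua; exists f.
- have IHc (a : vert G) : quantum_rigid (component a).
    by apply: IH; [exact: co_le5_induced | exact: component_lt].
  have st := quantum_rigid_same_type tA hu IHc.
  apply: iso_of_component_counts => [|z].
    exact: (qmagic_card (P := predT) (Q := predT) hu tA e0).
  (* Nonzero entries preserve types, hence match the vertices of the type of [z] on both sides. *)
  apply: (qmagic_card hu tA e0) => x a /st xa /=.
  by rewrite ![same_type z _]same_type_sym (same_type_eql _ xa).
- have h := IH A _ e _ tA (qmagic_compl hu) e0.
  apply: graph_iso_trans (graph_compl_compl G).
  by apply: graph_iso_trans (graph_iso_compl h); apply/graph_iso_sym/graph_compl_compl.
Qed.

(** * Schmidt's criterion *)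

Section LocalAutomorphisms.
Variable G : graph.
Implicit Types a b x y : vert G.

Definition fixes_off (S : pred (vert G)) (f : {perm vert G}) : Prop :=
  forall x, ~~ S x -> f x = x.

Lemma schmidtI (S T : pred (vert G)) (f g : {perm vert G}) :
  is_aut f -> is_aut g -> f != 1%g -> g != 1%g ->
  fixes_off S f -> fixes_off T g -> (forall x, S x -> ~~ T x) -> schmidt G.
Proof.
move=> af ag f1 g1 fS gT ST; exists f, g; split=> //; [exact/eqP | exact/eqP |].
rewrite -setI_eq0; apply/eqP/setP => x; rewrite !inE.
have [Sx|/fS ->] := boolP (S x); last by rewrite eqxx.
by rewrite (gT x (ST x Sx)) eqxx andbF.
Qed.

Lemma component_aut_extend a (f : {perm vert (component a)}) : is_aut f ->
  exists g : {perm vert G}, [/\ is_aut g, fixes_off (cn a) g &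
    forall x : vert (component a), g (val x) = val (f x)].
Proof.
move=> af; pose s x := if insub x is Some x' then val (f x') else x.
have sE (x : vert (component a)) : s (val x) = val (f x) by rewrite /s valK.
have sN x : ~~ cn a x -> s x = x by move=> h; rewrite /s insubN.
have vE x (h : cn a x) : x = val (exist _ x h : vert (component a)) by [].
have sC x : cn a (s x) = cn a x.
  have [h|h] := boolP (cn a x); last by rewrite sN // (negbTE h).
  by rewrite (vE x h) sE; apply: (svalP (f _)).
have si : injective s.
  move=> x y sxy; have := sC x; rewrite sxy sC => cxy; move: sxy.
  have [hx|hx] := boolP (cn a x); have [hy|hy] := boolP (cn a y).
  - by rewrite (vE x hx) (vE y hy) !sE => /val_inj/perm_inj ->.
  - by rewrite hx (negbTE hy) in cxy.
  - by rewrite hy (negbTE hx) in cxy.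
  - by rewrite !sN.
exists (perm si); split=> [x y|x /sN|x]; rewrite !permE ?sE //.
have [hx|hx] := boolP (cn a x); have [hy|hy] := boolP (cn a y).
- by rewrite (vE x hx) (vE y hy) !sE; apply: af.
- by rewrite (sN y hy) edge_sym [RHS]edge_sym !(edge_cn hy) ?sC.
- by rewrite (sN x hx) !(edge_cn hx) ?sC.
- by rewrite !sN.
Qed.

(** The isomorphisms [h] and [k] between the two components are chosen independently, so the
    permutation need not be an involution; it exchanges the components and is therefore not the
    identity. *)
Lemma component_swap a b : same_type a b -> ~~ cn a b ->
  exists g : {perm vert G}, [/\ is_aut g, fixes_off (fun x => cn a x || cn b x) g & g != 1%g].
Proof.
move=> ab nab; have [h [hX hi he]] := component_iso_fun (elimT (asboolP _) ab).
have ba : same_type b a by rewrite same_type_sym.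
have [k [kX ki ke]] := component_iso_fun (elimT (asboolP _) ba).
have dab x : cn a x -> cn b x = false.
  by move=> ax; apply/negP => bx; rewrite (cn_eqr _ bx) -(cn_eqr _ ax) connect0 in nab.
have dba x : cn b x -> cn a x = false by move=> bx; apply/negP => /dab; rewrite bx.
pose s x := if cn a x then h x else if cn b x then k x else x.
have sa x : cn a x -> s x = h x by rewrite /s => ->.
have sb x : cn b x -> s x = k x by move=> bx; rewrite /s bx dba.
have sn x : ~~ cn a x -> ~~ cn b x -> s x = x.
  by rewrite /s => /negbTE -> /negbTE ->.
have sCa x : cn a (s x) = cn b x.
  have [ax|nax] := boolP (cn a x); first by rewrite sa // dab // dba // hX.
  have [bx|nbx] := boolP (cn b x); first by rewrite sb // kX.
  by rewrite sn // (negbTE nax).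
have sCb x : cn b (s x) = cn a x.
  have [ax|nax] := boolP (cn a x); first by rewrite sa // hX.
  have [bx|nbx] := boolP (cn b x); first by rewrite sb // dab // kX.
  by rewrite sn // (negbTE nbx).
have si : injective s.
  move=> x y sxy; have := sCa x; have := sCb x; rewrite sxy sCa sCb => ea eb.
  have [ax|nax] := boolP (cn a x).
    by apply: hi; rewrite ?ea // -!sa // ea.
  have [bx|nbx] := boolP (cn b x).
    by apply: ki; rewrite ?eb // -!sb // eb.
  by move: sxy; rewrite !sn // ?ea ?eb.
have sE x y : edge (s x) (s y) = edge x y.
  have [ax|nax] := boolP (cn a x); have [ay|nay] := boolP (cn a y).
  - by rewrite !sa // he.
  - by rewrite edge_sym [RHS]edge_sym (edge_cn nay ax) (edge_cn (z := b)) ?sCb.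
  - by rewrite (edge_cn nax ay) (edge_cn (z := b)) ?sCb.
  have [bx|nbx] := boolP (cn b x); have [yb|nyb] := boolP (cn b y).
  - by rewrite !sb // ke.
  - by rewrite edge_sym [RHS]edge_sym (edge_cn nyb bx) (edge_cn (z := a)) ?sCa.
  - by rewrite (edge_cn nbx yb) (edge_cn (z := a)) ?sCa.
  - by rewrite !sn.
exists (perm si); split=> [x y|x|]; first by rewrite !permE.
  by rewrite permE negb_or => /andP[]; apply: sn.
apply/eqP => /permP/(_ a); rewrite permE perm1 => E.
by have := sCb a; rewrite E connect0 cn_sym (negbTE nab).
Qed.

Lemma component_nontrivial_aut a : ~ aut_trivial (component a) ->
  exists g : {perm vert G}, [/\ is_aut g, fixes_off (cn a) g & g != 1%g].
Proof.
move=> nt; have [f [af f1]] : exists f : {perm vert (component a)}, is_aut f /\ f <> 1%g.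
  apply: contrapT => h; apply: nt => f af; apply: contrapT => f1.
  by apply: h; exists f.
have [g [ag gS gE]] := component_aut_extend af; exists g; split=> //.
apply/eqP => g1; apply: f1; apply/permP => x; apply: val_inj.
by rewrite -gE g1 !perm1.
Qed.

Lemma schmidt_component a : schmidt (component a) -> schmidt G.
Proof.
move=> [f [g [af ag f1 g1 d]]].
have [f' [af' fS' fE']] := component_aut_extend af.
have [g' [ag' gS' gE']] := component_aut_extend ag.
have ne (p : {perm vert (component a)}) (p' : {perm vert G}) :
    (forall x : vert (component a), p' (val x) = val (p x)) -> p <> 1%g -> p' <> 1%g.
  move=> pE p1 p1'; apply: p1; apply/permP => x; apply: val_inj.
  by rewrite -pE p1' !perm1.
exists f', g'; split=> //; [exact: ne fE' f1 | exact: ne gE' g1 |].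
rewrite -setI_eq0; apply/eqP/setP => x; rewrite !inE.
have [h|h] := boolP (cn a x); last by rewrite (fS' _ h) eqxx.
pose x' : vert (component a) := exist _ x h.
have E : x = val x' by [].
rewrite E fE' gE' !(inj_eq val_inj).
move: d; rewrite -setI_eq0 => /eqP/setP/(_ x'); rewrite !inE.
by move=> <-.
Qed.

Section NotSchmidt.
Hypothesis nS : ~ schmidt G.

(** Local automorphisms come from one component or exchange two isomorphic ones. This lemma and the
    next two exclude disjoint supports: two components, an exchange and a component, two
    exchanges. *)
Lemma nschmidt_rigid a b : ~~ cn a b ->
  aut_trivial (component a) \/ aut_trivial (component b).
Proof.
move=> nab; apply: contrapT => /not_orP[/component_nontrivial_aut[f [af fa f1]]].
move=> /component_nontrivial_aut[g [ag gb g1]]; apply: nS.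
apply: schmidtI af ag f1 g1 fa gb _ => x ax; apply: contraNN nab => bx.
by rewrite (cn_eqr _ bx) -(cn_eqr _ ax).
Qed.

Lemma nschmidt_swap_rigid a a' b : same_type a a' -> ~~ cn a a' -> ~~ cn a b ->
  ~~ cn a' b -> aut_trivial (component b).
Proof.
move=> /component_swap h /h{h}[f [af fa f1]] nab na'b.
apply: contrapT => /component_nontrivial_aut[g [ag gb g1]]; apply: nS.
apply: schmidtI af ag f1 g1 fa gb _ => x /= h; apply/negP => bx.
by move: h; rewrite -(cn_eqr a bx) -(cn_eqr a' bx) (negbTE nab) (negbTE na'b).
Qed.

Lemma nschmidt_swap_swap a a' b b' : same_type a a' -> ~~ cn a a' ->
  same_type b b' -> ~~ cn b b' ->
  ~~ cn a b -> ~~ cn a b' -> ~~ cn a' b -> ~~ cn a' b' -> False.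
Proof.
move=> /component_swap h /h{h}[f [af fa f1]] /component_swap h /h{h}[g [ag gb g1]].
move=> n1 n2 n3 n4; apply: nS; apply: schmidtI af ag f1 g1 fa gb _ => x.
have dis c d : ~~ cn c d -> cn c x -> ~~ cn d x.
  by move=> ncd cx; apply: contraNN ncd => dx; rewrite (cn_eqr _ dx) -(cn_eqr _ cx).
rewrite negb_or => /orP[] hx; rewrite !(dis _ _ _ hx) //.
Qed.

End NotSchmidt.

End LocalAutomorphisms.

Lemma is_aut_compl (G : graph) (f : {perm vert G}) :
  is_aut (G := graph_compl G) f <-> is_aut f.
Proof.
split=> h x y; last by rewrite /= /compl_edge (inj_eq perm_inj) h.
have := h x y; rewrite /= /compl_edge (inj_eq perm_inj).
by case: eqP => [->|_ /negb_inj //]; rewrite !edge_irr.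
Qed.

Lemma schmidt_compl (G : graph) : schmidt (graph_compl G) -> schmidt G.
Proof. by move=> [f [g [/is_aut_compl af /is_aut_compl ag f1 g1 d]]]; exists f, g. Qed.

(** Two nonzero entries in a row would give two isomorphisms from [H] to [G] with different values
    at [x], hence a nontrivial automorphism of [G]. *)
Lemma rigid_row (A : pzRingType) (H G : graph) (e : A) (u : vert H -> vert G -> A) :
  qmagic e u -> (forall x a y b, u x a * u y b = u y b * u x a) -> aut_trivial G ->
  forall x a c, u x a != 0 -> u x c != 0 -> a = c.
Proof.
move=> hu uC aG x a c ua uc.
have [f [[f' fK f'K] hf fx]] := qmagic_commutative_iso hu uC ua.
have [g [bg hg gx]] := qmagic_commutative_iso hu uC uc.
have inj : injective (g \o f') by apply: inj_comp (bij_inj bg) (can_inj f'K).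
have /permP/(_ a) : perm inj = 1%g.
  by apply: aG => y z; rewrite !permE /= hg -hf !f'K.
by rewrite permE perm1 /= -{1}fx fK gx.
Qed.

(** Inside a block the entries commute by hypothesis; if only one of the pairs [x], [y] and [a], [b]
    is connected, both products vanish. For [a] and [b] in components of different types, one
    component is rigid and without copy, so its entries are [0] or [e]. For equal types both
    components are rigid, and four of this type would allow two disjoint exchanges; with at most
    three, the entries commute as those of a magic unitary of size 3 do. *)
Lemma split_commute (G : graph) : ~ schmidt G ->
  (forall a : vert G, quantum_rigid (component a)) ->
  (forall a : vert G, ~ schmidt (component a) ->
     forall (A : pzRingType) (H : graph) (e : A) (u : vert H -> vert (component a) -> A),
     natregular A -> qmagic e u -> forall x a y b, u x a * u y b = u y b * u x a) ->
  forall (A : pzRingType) (H : graph) (e : A) (u : vert H -> vert G -> A),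
    natregular A -> qmagic e u -> forall x a y b, u x a * u y b = u y b * u x a.
Proof.
move=> nS rG cG A H e u tA hu.
have st := quantum_rigid_same_type tA hu rG.
have bC x a y b : cn x y -> cn a b -> u x a * u y b = u y b * u x a.
  move=> xy ab; have nSa : ~ schmidt (component a) by move=> /schmidt_component.
  have := cG a nSa A _ _ _ tA (block_qmagic hu x a).
  by move=> /(_ (exist _ x (connect0 _ x)) (exist _ a (connect0 _ a)) (exist _ y xy)
                (exist _ b ab)).
have rrow x a c : aut_trivial (component a) -> cn a c -> u x a != 0 -> u x c != 0 -> a = c.
  move=> ta ac ua uc.
  have nSa : ~ schmidt (component a) by move=> /schmidt_component.
  have uC := cG a nSa A _ _ _ tA (block_qmagic hu x a).
  have := rigid_row (block_qmagic hu x a) uC ta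
    (x := exist _ x (connect0 _ x)) (a := exist _ a (connect0 _ a)) (c := exist _ c ac) ua uc.
  by case.
(* a rigid component without isomorphic copy: its entries are [0] or [e] *)
have alone x a y b : aut_trivial (component a) ->
    (forall a', same_type a a' -> cn a a') -> u x a * u y b = u y b * u x a.
  move=> ta al; have [->|ua] := eqVneq (u x a) 0; first by rewrite mul0r mulr0.
  suff -> : u x a = e by rewrite (qmagic_unitl hu) (qmagic_unitr hu).
  rewrite -(qmagic_row hu x) (bigD1 a) //= big1 ?addr0 // => c ca.
  apply/eqP; apply: contraNT ca => uc; apply/eqP/esym; apply: (rrow x) => //.
  by apply: al; rewrite (same_type_eql (b := x)) ?st // same_type_sym st.
have alone_or (a : vert G) : (forall a', same_type a a' -> cn a a') \/
    exists2 a', same_type a a' & ~~ cn a a'.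
  apply/or_asboolP/contraT; rewrite negb_or => /andP[/asboolPn h1 /asboolPn h2].
  case: h1 => a' aa'; apply: contrapT => /negP ncn; by apply: h2; exists a'.
move=> x a y b.
have [E|ne] := eqVneq (cn x y) (cn a b); last first.
  by rewrite (qmagic_connect hu ne) (qmagic_connect hu) // cn_sym [X in _ != X]cn_sym.
have [ab|nab] := boolP (cn a b); first by apply: bC; rewrite ?E.
have nxy : ~~ cn x y by rewrite E.
have [tab|ntab] := boolP (same_type a b); last first.
  (* If the rigid component of [c] has a copy, their exchange forces the component of [d] to be
     rigid too; if that one also had a copy, there would be two disjoint exchanges. *)
  have half (c d : vert G) (z t : vert H) : ~~ cn c d -> ~~ same_type c d ->
      aut_trivial (component c) -> u z c * u t d = u t d * u z c.
    move=> ncd ntcd tc; have [al|[c' tc' nc']] := alone_or c; first exact: alone.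
    have nc'd : ~~ cn c' d.
      apply: contraNN ntcd => /same_type_cn; exact: same_type_trans.
    have td : aut_trivial (component d) by apply: nschmidt_swap_rigid tc' nc' ncd nc'd.
    have [al|[d' td' nd']] := alone_or d; first by apply/esym/alone.
    case: (nschmidt_swap_swap nS tc' nc' td' nd') => //.
      apply: contraNN ntcd => /same_type_cn h; apply: same_type_trans h _.
      by rewrite same_type_sym.
    apply: contraNN ntcd => /same_type_cn h; apply: same_type_trans tc' _.
    by apply: same_type_trans h _; rewrite same_type_sym.
  have [ta|tb] := nschmidt_rigid nS nab; first exact: half.
  by apply/esym/half; rewrite // 1?cn_sym // same_type_sym.
have [ta tb] : aut_trivial (component a) /\ aut_trivial (component b).
  have iab := elimT (asboolP _) tab.
  have [ta|tb] := nschmidt_rigid nS nab; split=> //; first exact: aut_trivial_iso iab ta.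
  exact: aut_trivial_iso (graph_iso_sym iab) tb.
(* Replacing [u y b] by [e] minus the rest of its row leaves terms [u x a * u y d * u x c]. A
   nonzero one would put [a], [b], [c], [d] in four distinct components of one type. *)
have triple a' c : aut_trivial (component a') -> same_type a' b -> ~~ cn a' b ->
    c != a' -> u x a' * u y b * u x c = 0.
  move: a' => {ta tab nab E}a ta tab nab ca; have [->|ua] := eqVneq (u x a) 0; first by rewrite !mul0r.
  have [->|uc] := eqVneq (u x c) 0; first by rewrite mulr0.
  have [ac|nac] := boolP (cn a c); first by rewrite (rrow x a c) ?eqxx in ca.
  have tac : same_type a c.
    by apply: same_type_trans (st _ _ uc); rewrite same_type_sym st.
  have [bc|nbc] := boolP (cn b c).
    by rewrite -mulrA (qmagic_connect hu) ?mulr0 // cn_sym (negbTE nxy) bc.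
  have [->|ub] := eqVneq (u y b) 0; first by rewrite mulr0 mul0r.
  have -> : u y b = e - \sum_(d | d != b) u y d.
    by rewrite -(qmagic_row hu y) (bigD1 b) //= addrK.
  rewrite mulrBr mulrBl (qmagic_unitr hu) (qmagic_mulr hu) eq_sym (negbTE ca).
  rewrite mulr_sumr mulr_suml big1 ?subr0 // => d db.
  have [->|ud] := eqVneq (u y d) 0; first by rewrite mulr0 mul0r.
  have tbd : same_type b d.
    by apply: same_type_trans (st _ _ ud); rewrite same_type_sym st.
  have nbd : ~~ cn b d by apply: contraNN db => bd; rewrite (rrow y b d).
  have [ad|nad] := boolP (cn a d).
    by rewrite (qmagic_connect hu) ?mul0r // (negbTE nxy) ad.
  have [cd|ncd] := boolP (cn c d).
    by rewrite -mulrA (qmagic_connect hu) ?mulr0 // cn_sym (negbTE nxy) cn_sym cd.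
  case: (nschmidt_swap_swap nS tac nac tbd nbd) => //; by rewrite cn_sym.
apply: (qmagic_commW hu) => c ca; first exact: triple.
have [->|uc] := eqVneq (u x c) 0; first by rewrite !mul0r.
have [->|ua] := eqVneq (u x a) 0; first by rewrite mulr0.
have tac : same_type a c by apply: same_type_trans (st _ _ uc); rewrite same_type_sym st.
have [bc|nbc] := boolP (cn b c).
  by rewrite (qmagic_connect hu) ?mul0r // (negbTE nxy) cn_sym bc.
apply: triple; rewrite 1?eq_sym //; last by rewrite cn_sym.
- exact: aut_trivial_iso (elimT (asboolP _) tac) ta.
- by rewrite -(same_type_eql _ tac).
Qed.

Theorem co_le5_commute (G : graph) : co graphs_le5 G -> ~ schmidt G ->
  forall (A : pzRingType) (H : graph) (e : A) (u : vert H -> vert G -> A),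
    natregular A -> qmagic e u -> forall x a y b, u x a * u y b = u y b * u x a.
Proof.
move: G; apply: co_le5_ind => [G _ crit|G FG sG IH|G IH] nS A H e u tA hu.
- by case: crit => [l|[c4 c4']]; [apply: (linked_colors_commute hu) |
    apply: (C4_free_both_commute hu)].
- apply: (split_commute nS _ _ tA hu) => [a|a nSa B K f v tB hv].
    exact: co_le5_quantum_rigid (co_le5_induced _ FG).
  exact: (IH _ (co_le5_induced _ FG) (component_lt a sG) nSa B K f v tB hv).
- by apply: (IH _ A _ e _ tA (qmagic_compl hu)) => /schmidt_compl.
Qed.

(** * C*-algebras *)

Section CStar.
Variables (R : realType) (X : cstarAlgType R[i]).
Implicit Types (x y z : X) (r s : R).

Definition scal r : X := inC r%:C.

(** A real-valued version of [cnorm], on which [lra] and [nra] can work. *)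
Definition nm x : R := complex.Re (cnorm x).

Lemma cnormE x : cnorm x = (nm x)%:C.
Proof. by rewrite /nm RRe_real // ger0_real // cnorm_ge0. Qed.

Lemma nm_ge0 x : 0 <= nm x.
Proof. by rewrite -ler0c -cnormE cnorm_ge0. Qed.

Lemma nm0 : nm 0 = 0.
Proof.
have := @cnormZ _ X 0 0; rewrite inC0 mul0r normr0 mul0r /nm => ->.
by [].
Qed.

Lemma nm_eq0 x : nm x = 0 -> x = 0.
Proof. by move=> h; apply: cnorm_eq0; rewrite cnormE h. Qed.

Lemma nmD x y : nm (x + y) <= nm x + nm y.
Proof. by rewrite -lecR rmorphD /= -!cnormE cnormD. Qed.

Lemma nmM x y : nm (x * y) <= nm x * nm y.
Proof. by rewrite -lecR rmorphM /= -!cnormE cnormM. Qed.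

Lemma nmCZ (c : R[i]) x : nm (inC c * x) = complex.Re `|c| * nm x.
Proof.
apply: complexI; rewrite rmorphM /= -!cnormE cnormZ; congr (_ * _).
Qed.

Lemma nmZ r x : nm (scal r * x) = `|r| * nm x.
Proof. by rewrite nmCZ normc_def /= expr0n addr0 sqrtr_sqr. Qed.

Lemma scalD r s : scal (r + s) = scal r + scal s.
Proof. by rewrite /scal rmorphD inCD. Qed.
Lemma scalM r s : scal (r * s) = scal r * scal s.
Proof. by rewrite /scal rmorphM inCM. Qed.
Lemma scal1 : scal 1 = 1.
Proof. exact: inC1. Qed.
Lemma scal_comm r x : scal r * x = x * scal r.
Proof. exact: inC_central. Qed.
Lemma star_scal r : star (scal r) = scal r.
Proof.
rewrite /scal star_inC; congr inC.
by apply: conj_Creal; apply/complex_realP; exists r.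
Qed.
Lemma scalN1 x : scal (-1) * x = - x.
Proof. by rewrite /scal rmorphN inCN1 mulN1r. Qed.
Lemma scal0 : scal 0 = 0.
Proof. exact: inC0. Qed.

Lemma nmN x : nm (- x) = nm x.
Proof. by rewrite -scalN1 nmZ normrN1 mul1r. Qed.

Lemma nmB x y : nm (x - y) <= nm x + nm y.
Proof. by rewrite -(nmN y) nmD. Qed.

Lemma nm_cstar x : nm (star x * x) = nm x ^+ 2.
Proof. by apply: complexI; rewrite rmorphXn /= -!cnormE cnorm_star. Qed.

Lemma nm_star x : nm (star x) = nm x.
Proof.
have le z : nm z <= nm (star z).
  have [->|z0] := eqVneq (nm z) 0; first exact: nm_ge0.
  have zp : 0 < nm z by rewrite lt_def z0 nm_ge0.
  by rewrite -(ler_pM2r zp) -expr2 -nm_cstar nmM.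
by apply/eqP; rewrite eq_le le -{2}(starK x) le.
Qed.

Lemma nm_sa x : star x = x -> nm (x * x) = nm x ^+ 2.
Proof. by move=> {1}<-; apply: nm_cstar. Qed.

Lemma nm_proj x : star x = x -> x * x = x -> nm x <= 1.
Proof.
move=> /nm_sa h xx; move: h; rewrite xx => h.
by have := nm_ge0 x; nra.
Qed.

Lemma nm1 : nm 1 <= 1.
Proof. by apply: nm_proj; rewrite ?mulr1 // star1. Qed.

Definition cvgs (u : nat -> X) x : Prop :=
  forall e : R, 0 < e -> exists N, forall n, (N <= n)%N -> nm (u n - x) < e.

Definition cauchys (u : nat -> X) : Prop :=
  forall e : R, 0 < e -> exists N, forall m n, (N <= m)%N -> (N <= n)%N ->
    nm (u m - u n) < e.

Lemma cauchys_cvg u : cauchys u -> exists x, cvgs u x.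
Proof.
move=> cu; have [e e0|x hx] := @cnorm_complete _ X u.
  have er : (complex.Re e)%:C = e by rewrite RRe_real // gtr0_real.
  have [|N hN] := cu (complex.Re e); first by rewrite -ltcR er.
  by exists N => m n Nm Nn; rewrite cnormE -er ltcR hN.
exists x => e e0; have [|N hN] := hx e%:C; first by rewrite ltcR.
by exists N => n /hN; rewrite cnormE ltcR.
Qed.

Lemma nm_small x : (forall e, 0 < e -> nm x < e) -> x = 0.
Proof.
move=> h; apply: nm_eq0; apply/eqP; apply: contraT => ne.
have /h : 0 < nm x by rewrite lt_def ne nm_ge0.
by rewrite ltxx.
Qed.

Lemma cvgs_uniq u x y : cvgs u x -> cvgs u y -> x = y.
Proof.
move=> ux uy; apply/eqP; rewrite -subr_eq0; apply/eqP/nm_small => e e0.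
have e2 : 0 < e / 2 by lra.
have [N hN] := ux _ e2; have [M hM] := uy _ e2.
have := hN _ (leq_maxl N M); have := hM _ (leq_maxr N M).
set n := maxn N M; have -> : x - y = (u n - y) - (u n - x).
  by rewrite opprB [RHS]addrC addrA subrK.
have := nmB (u n - y) (u n - x); lra.
Qed.

Lemma cvgs_cst x : cvgs (fun=> x) x.
Proof. by move=> e e0; exists 0%N => n _; rewrite subrr nm0. Qed.

Lemma cvgsD u v x y : cvgs u x -> cvgs v y -> cvgs (fun n => u n + v n) (x + y).
Proof.
move=> ux vy e e0; have e2 : 0 < e / 2 by lra.
have [N hN] := ux _ e2; have [M hM] := vy _ e2.
exists (maxn N M) => n; rewrite geq_max => /andP[/hN h1 /hM h2].
have := nmD (u n - x) (v n - y).
by rewrite addrACA -opprD; lra.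
Qed.

Lemma cvgs_bound u x (M : R) : cvgs u x -> (exists N, forall n, (N <= n)%N -> nm (u n) <= M) ->
  nm x <= M.
Proof.
move=> ux [K hu]; rewrite leNgt; apply/negP => lt.
have [|N hN] := ux (nm x - M); first by rewrite subr_gt0.
have := hN _ (leq_maxl N K); have := hu _ (leq_maxr N K); set n := maxn _ _.
have := nmB (u n) (u n - x).
rewrite opprB addrC subrK; lra.
Qed.

Lemma cvgs_star u x : cvgs u x -> cvgs (fun n => star (u n)) (star x).
Proof.
move=> ux e /ux[N hN]; exists N => n /hN.
by rewrite -nm_star starD -scalN1 starM star_scal -scal_comm scalN1.
Qed.

Lemma cvgs_nm_bound u x : cvgs u x ->
  exists2 M : R, 0 < M & exists N, forall n, (N <= n)%N -> nm (u n) <= M.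
Proof.
move=> ux; have [|N hN] := ux 1; first by lra.
exists (nm x + 1); first by have := nm_ge0 x; lra.
exists N => n /hN; have := nmD (u n - x) x; rewrite subrK; lra.
Qed.

Lemma cvgsM u v x y : cvgs u x -> cvgs v y -> cvgs (fun n => u n * v n) (x * y).
Proof.
move=> ux vy e e0; have [M M0 [K hM]] := cvgs_nm_bound ux.
have y0 := nm_ge0 y; pose d := e / (M + nm y + 1).
have D0 : 0 < M + nm y + 1 by lra.
have d0 : 0 < d by rewrite divr_gt0.
have [N1 h1] := ux _ d0; have [N2 h2] := vy _ d0.
exists (maxn K (maxn N1 N2)) => n; rewrite !geq_max => /and3P[/hM hu /h1 hx /h2 hy].
have -> : u n * v n - x * y = u n * (v n - y) + (u n - x) * y.
  by rewrite mulrBr mulrBl addrA subrK.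
have := nmD (u n * (v n - y)) ((u n - x) * y).
have := nmM (u n) (v n - y); have := nmM (u n - x) y.
have ed : e = d * (M + nm y + 1) by rewrite divfK // gt_eqF.
have : nm (u n) * nm (v n - y) <= M * d by rewrite ler_pM ?nm_ge0 // ltW.
have : nm (u n - x) * nm y <= d * nm y by rewrite ler_wpM2r // ltW.
have : e = M * d + d * nm y + d by rewrite {1}ed; ring.
lra.
Qed.

Lemma cvgs_ext u v x : (forall n, u n = v n) -> cvgs u x -> cvgs v x.
Proof. by move=> /funext ->. Qed.

Lemma cvgs_shift u x : cvgs u x -> cvgs (fun n => u n.+1) x.
Proof. by move=> ux e /ux[N hN]; exists N => n Nn; apply/hN/leqW. Qed.

End CStar.

(** A Bernoulli-type estimate, [B]; [N] exceeds the inverse of [e * (1 - r)]. *)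
Lemma geometric_small (R : realType) (r e : R) : 0 <= r -> r < 1 -> 0 < e ->
  exists N, forall n, (N <= n)%N -> r ^+ n < e.
Proof.
move=> r0 r1 e0.
have B n : r ^+ n * (1 + n%:R * (1 - r)) <= 1.
  elim: n => [|n IHn]; first by rewrite expr0 mul0r addr0 mulr1.
  apply: le_trans IHn; rewrite exprSr -mulrA ler_wpM2l ?exprn_ge0 //.
  rewrite -natr1 -subr_ge0.
  have -> : 1 + n%:R * (1 - r) - r * (1 + (n%:R + 1) * (1 - r)) =
    (n%:R + 1) * ((1 - r) * (1 - r)) by ring.
  by rewrite !mulr_ge0 ?subr_ge0 ?(ltW r1) ?addr_ge0 ?ler0n.
have p1 : 0 < e * (1 - r) by apply: mulr_gt0; lra.
have := archi_boundP (ltW (divr_gt0 ltr01 p1)).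
set N := Num.bound _ => hN; exists N => n Nn.
rewrite ltNge; apply/negP => h.
have n0 : N%:R <= n%:R :> R by rewrite ler_nat.
have : 1 < N%:R * (e * (1 - r)) by rewrite -ltr_pdivrMr.
have := B n; have : 0 <= r ^+ n by rewrite exprn_ge0.
have : N%:R * (e * (1 - r)) <= n%:R * (e * (1 - r)) by rewrite ler_wpM2r // ltW.
have : e * (1 + n%:R * (1 - r)) <= r ^+ n * (1 + n%:R * (1 - r)).
  rewrite ler_wpM2r // addr_ge0 // mulr_ge0 ?ler0n //; lra.
rewrite !mulrDr !mulr1; nra.
Qed.

(** * Square roots by iteration *)

Section SquareRoot.
Variables (R : realType) (X : cstarAlgType R[i]) (a : X).
Hypotheses (a_sa : star a = a) (a_lt1 : nm a < 1).

(* [1 - y] squares to [1 - a] when [y] is the fixed point of                   *)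
(* [y |-> (a + y ^ 2) / 2], a contraction of the ball of radius [nm a].        *)
Let half : X := scal X 2^-1.
Fixpoint sqrt_iter n : X :=
  if n is m.+1 then half * (a + sqrt_iter m * sqrt_iter m) else 0.
Local Notation y := sqrt_iter.
Let rho := nm a.

Let rho0 : 0 <= rho. Proof. exact: nm_ge0. Qed.

Let nm_half x : nm (half * x) = nm x / 2.
Proof. by rewrite nmZ ger0_norm ?invr_ge0 // mulrC. Qed.

Let y_bound n : nm (y n) <= rho.
Proof.
elim: n => [|n IHn]; rewrite /= ?nm0 // nm_half.
have := nmD a (y n * y n); have := nmM (y n) (y n); have := nm_ge0 (y n).
have := rho0; move: a_lt1; rewrite -/rho; nra.
Qed.

Let y_step n : nm (y n.+1 - y n) <= rho ^+ n.+1.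
Proof.
elim: n => [|n IHn].
  rewrite /= subr0 mulr0 addr0 nm_half expr1 -/rho; have := rho0; lra.
have -> : y n.+2 - y n.+1 =
    half * (y n.+1 * (y n.+1 - y n) + (y n.+1 - y n) * y n).
  rewrite [in RHS]mulrBr mulrBl addrA subrK /= -mulrBr; congr (_ * _).
  by rewrite opprD addrACA subrr add0r.
rewrite nm_half; set d := y n.+1 - y n in IHn *.
have := nmD (y n.+1 * d) (d * y n); have := nmM (y n.+1) d; have := nmM d (y n).
have := y_bound n; have := y_bound n.+1; have := nm_ge0 d.
have := nm_ge0 (y n); have := nm_ge0 (y n.+1).
rewrite [rho ^+ n.+2]exprS => *.
have : rho * nm d <= rho * rho ^+ n.+1 by rewrite ler_wpM2l.
nra.
Qed.

Let y_cauchy : cauchys y.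
Proof.
have dist n k : (1 - rho) * nm (y (n + k)%N - y n) <= rho ^+ n.+1 * (1 - rho ^+ k).
  elim: k => [|k IHk]; first by rewrite addn0 subrr nm0 mulr0 expr0 subrr mulr0.
  have := nmD (y (n + k).+1 - y (n + k)%N) (y (n + k)%N - y n).
  rewrite addrA subrK addnS => h; have := y_step (n + k).
  have := ler_wpM2l (_ : 0 <= 1 - rho) h; rewrite subr_ge0 (ltW a_lt1) => /(_ isT).
  have : rho ^+ (n + k).+1 = rho ^+ n.+1 * rho ^+ k by rewrite -exprD addSn.
  rewrite [rho ^+ k.+1]exprS => ->; set p := rho ^+ n.+1 * rho ^+ k.
  have -> : rho ^+ n.+1 * (1 - rho * rho ^+ k) = rho ^+ n.+1 - rho * p.
    by rewrite /p; ring.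
  have E : rho ^+ n.+1 * (1 - rho ^+ k) = rho ^+ n.+1 - p by rewrite /p; ring.
  move: IHk; rewrite E; have := a_lt1; rewrite -/rho; nra.
move=> e e0; have p0 : 0 < e * (1 - rho) / 2.
  by rewrite divr_gt0 // mulr_gt0 // subr_gt0.
have [N hN] := geometric_small rho0 a_lt1 p0; exists N => m n Nm Nn.
have near k : (N <= k)%N -> nm (y k - y N) < e / 2.
  move=> Nk; have := dist N (k - N)%N; rewrite subnKC // => h.
  have : rho ^+ N.+1 * (1 - rho ^+ (k - N)) <= rho ^+ N.+1.
    rewrite ler_piMr ?exprn_ge0 // gerBl exprn_ge0 //.
  have := hN N.+1 (leqnSn _); have : 0 < 1 - rho by rewrite subr_gt0.
  move=> *; rewrite -(ltr_pM2l (_ : 0 < 1 - rho)) //; lra.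
have := nmB (y m - y N) (y n - y N); rewrite opprB addrA subrK.
have := near m Nm; have := near n Nn; lra.
Qed.

(** Stands in for the continuous functional calculus: [1 - c] is a limit of real polynomials in [a],
    hence [c] is self-adjoint and commutes with whatever commutes with [a]. *)
Lemma cstar_sqrt : exists c : X, [/\ star c = c, c * c = 1 - a &
  forall z, a * z = z * a -> c * z = z * c].
Proof.
have [l yl] := cauchys_cvg y_cauchy.
have lE : l = half * (a + l * l).
  apply: (cvgs_uniq (cvgs_shift yl)); apply: cvgsM (cvgs_cst half) _.
  by apply: cvgsD (cvgs_cst a) _; apply: cvgsM.
have l2 : l + l = a + l * l.
  rewrite {1 2}lE -mulrDl -scalD (_ : 2^-1 + 2^-1 = 1) ?scal1 ?mul1r //; lra.
exists (1 - l); split.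
- have ys n : star (y n) = y n.
    elim: n => [|n IHn]; rewrite /= ?star0 // starM starD starM !IHn a_sa star_scal.
    by rewrite scal_comm.
  have ls : star l = l.
    by apply: (cvgs_uniq (cvgs_star yl)); apply: cvgs_ext yl => n; rewrite ys.
  by rewrite starD star1 -(scalN1 l) starM star_scal ls scal_comm.
- have -> : (1 - l) * (1 - l) = 1 - (l + l) + l * l.
    by rewrite mulrBl mul1r mulrBr mulr1 opprB opprD !addrA [LHS]addrAC.
  by rewrite l2 opprD addrA subrK.
move=> z az; have yz n : y n * z = z * y n.
  elim: n => [|n IHn]; rewrite /= ?mul0r ?mulr0 //.
  rewrite -mulrA mulrDl az -mulrA IHn mulrA IHn -mulrA -mulrDr.
  by rewrite mulrA scal_comm -mulrA.
suff lz : l * z = z * l by rewrite mulrBl mulrBr lz mul1r mulr1.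
apply: (cvgs_uniq (cvgsM yl (cvgs_cst z))).
by apply: cvgs_ext (cvgsM (cvgs_cst z) yl) => n; rewrite yz.
Qed.

End SquareRoot.

Section CStarUnitary.
Variables (R : realType) (X : cstarAlgType R[i]).
Implicit Types (x y z f g : X) (r s t : R).
Local Notation scal := (@scal R X).

Definition iC : X := inC ('i%C : R[i]).

Lemma iC2 : iC * iC = -1.
Proof. by rewrite /iC -inCM -expr2 sqr_i inCN1. Qed.

Lemma star_iC : star iC = - iC.
Proof.
rewrite /iC star_inC -[RHS]mulN1r -inCN1 -inCM; congr inC.
by rewrite mulN1r; apply/eqP; rewrite eq_complex /= oppr0 !eqxx.
Qed.

Lemma starN (A : starAlgType R[i]) (x : A) : star (- x) = - star x.
Proof. by apply: (addIr (star x)); rewrite -starD !addNr star0. Qed.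

Lemma iC_comm x : iC * x = x * iC.
Proof. exact: inC_central. Qed.

Lemma scal_half x : scal 2^-1 * (x + x) = x.
Proof.
rewrite mulrDr -mulrDl -scalD (_ : 2^-1 + 2^-1 = 1) ?scal1 ?mul1r //; lra.
Qed.

Lemma scalK t x : t != 0 -> scal t * (scal t^-1 * x) = x.
Proof. by move=> t0; rewrite mulrA -scalM mulfV // scal1 mul1r. Qed.

Lemma scalVK t x : t != 0 -> scal t^-1 * (scal t * x) = x.
Proof. by move=> t0; rewrite mulrA -scalM mulVf // scal1 mul1r. Qed.

Section Combine.
Variables f g : X.
Hypotheses (f_sa : star f = f) (g_sa : star g = g) (fg : f * g = g * f).

Let u := f + iC * g.

Lemma star_combine : star u = f - iC * g.
Proof. by rewrite /u starD starM star_iC f_sa g_sa mulrN -iC_comm. Qed.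

Lemma combineM : star u * u = f * f + g * g.
Proof.
have ig : iC * g * (iC * g) = - (g * g).
  by rewrite mulrA -[iC * g * iC]mulrA -iC_comm mulrA iC2 mulN1r mulNr.
have ifg : iC * g * f = f * (iC * g) by rewrite -mulrA -fg mulrA iC_comm mulrA.
by rewrite star_combine /u mulrBl !mulrDr ig ifg opprD opprK addrA addrK.
Qed.

Lemma combineMr : u * star u = f * f + g * g.
Proof.
have ig : iC * g * (iC * g) = - (g * g).
  by rewrite mulrA -[iC * g * iC]mulrA -iC_comm mulrA iC2 mulN1r mulNr.
have ifg : iC * g * f = f * (iC * g) by rewrite -mulrA -fg mulrA iC_comm mulrA.
by rewrite star_combine /u mulrBr !mulrDl ig ifg opprD opprK addrA addrK.
Qed.

Lemma combine_real : f = scal 2^-1 * (u + star u).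
Proof. by rewrite star_combine /u addrACA subrr addr0 scal_half. Qed.

(** [f] is the real part of [u], so its norm is at most that of [u], and [star u * u] is the sum of
    squares. This replaces monotonicity of the norm on positive elements. *)
Lemma nm_sum_squares : nm f ^+ 2 <= nm (f * f + g * g).
Proof.
rewrite -combineM nm_cstar lerXn2r ?nnegrE ?nm_ge0 // combine_real nmZ.
rewrite ger0_norm ?invr_ge0 //; have := nmD u (star u); rewrite nm_star; lra.
Qed.

End Combine.

Lemma star_scalM r x : star (scal r * x) = scal r * star x.
Proof. by rewrite starM star_scal scal_comm. Qed.

Lemma scale_lt1 t x : nm x < t -> nm (scal t^-1 * x) < 1.
Proof.
move=> xt; have t0 : 0 < t by apply: le_lt_trans xt; exact: nm_ge0.
by rewrite nmZ ger0_norm ?invr_ge0 ?(ltW t0) // mulrC ltr_pdivrMr // mul1r.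
Qed.

(** Makes [b] the real part of the unitary [b + iC * c]. *)
Lemma sqrt_one_minus_square (b : X) : star b = b -> nm b < 1 ->
  exists c, [/\ star c = c, b * b + c * c = 1 & b * c = c * b].
Proof.
move=> bs b1; have [||c [cs cc cz]] := cstar_sqrt (a := b * b).
- by rewrite starM bs.
- have := nmM b b; have := nm_ge0 b; nra.
exists c; split=> //; first by rewrite cc addrC subrK.
by apply/esym/cz; rewrite mulrA.
Qed.

(* [y + eps p] and [- y + eps p] are squares of commuting self-adjoint         *)
(* elements, and their sum [2 eps p] dominates both.                           *)
Definition corner_pos (p y : X) : Prop := exists2 t : R, 0 <= t & nm (scal t * p - y) <= t.

(** For a self-adjoint [y] in the corner of the projection [p], [corner_pos p y] is the norm
    criterion for positivity. In this form additivity is the triangle inequality. *)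
Lemma corner_pos_sum (p : X) (I : Type) (r : seq I) (P : pred I) (F : I -> X) :
  (forall i, P i -> corner_pos p (F i)) -> corner_pos p (\sum_(i <- r | P i) F i).
Proof.
move=> h; apply: big_ind => //.
  by exists 0; rewrite // scal0 mul0r subrr nm0.
move=> x y [s s0 hs] [t t0 ht]; exists (s + t); first exact: addr_ge0.
have -> : scal (s + t) * p - (x + y) = (scal s * p - x) + (scal t * p - y).
  by rewrite scalD mulrDl opprD addrACA.
have := nmD (scal s * p - x) (scal t * p - y); lra.
Qed.

Lemma corner_pos_eq0 (p y : X) : star p = p -> p * p = p -> star y = y ->
  p * y = y -> y * p = y -> corner_pos p y -> corner_pos p (- y) -> y = 0.
Proof.
move=> ps pp ys py yp [s s0 hs] [t t0 ht].
have p1 := nm_proj ps pp.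
pose T := s + t; have T0 : 0 <= T by exact: addr_ge0.
have hT : nm (scal T * p - y) <= T.
  have -> : scal T * p - y = (scal s * p - y) + scal t * p by rewrite scalD mulrDl addrAC.
  have := nmD (scal s * p - y) (scal t * p); rewrite nmZ ger0_norm // /T; nra.
have hT' : nm (scal T * p - - y) <= T.
  have -> : scal T * p - - y = scal s * p + (scal t * p - - y) by rewrite scalD mulrDl addrA.
  have := nmD (scal s * p) (scal t * p - - y); rewrite nmZ ger0_norm // /T; nra.
(* The argument bounds [d p + y] by [2 d], hence [y] by [3 d], which is below [eps] for
   [d = eps / 4]. *)
apply: nm_small => eps eps0; pose d := eps / 4; have d0 : 0 < d by rewrite /d; lra.
pose D := T + d; have D0 : 0 < D by rewrite /D; lra.
have Dn : D != 0 by rewrite gt_eqF.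
pose a x := scal D^-1 * (scal T * p - x).
have as_ x : star x = x -> star (a x) = a x.
  by move=> xs; rewrite /a star_scalM starD starN star_scalM ps xs.
have a1 x : nm (scal T * p - x) <= T -> nm (a x) < 1.
  by move=> h; apply: scale_lt1; apply: le_lt_trans h _; rewrite /D; lra.
have am x z : p * z = z * p -> x * z = z * x -> a x * z = z * a x.
  move=> pz xz; rewrite /a -mulrA mulrA [z * _]mulrA -scal_comm -!mulrA; congr (_ * _).
  by rewrite mulrBl mulrBr xz mulrA -scal_comm -!mulrA pz.
have Ny : star (- y) = - y by rewrite starN ys.
have [c [cs cc cz]] := cstar_sqrt (as_ _ ys) (a1 _ hT).
have [e [es ee ez]] := cstar_sqrt (as_ _ Ny) (a1 _ hT').
have cp : c * p = p * c by apply: cz; apply: am => //; rewrite yp py.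
have ep : e * p = p * e by apply: ez; apply: am => //; rewrite mulrN mulNr yp py.
have ce : c * e = e * c.
  apply: cz; apply/esym/ez; apply: (@am).
    by apply/esym/am; rewrite // yp py.
  by rewrite mulNr mulrN; congr (- _); apply/esym/am; rewrite // yp py.
have sq (k x : X) : k * p = p * k -> k * k = 1 - a x -> p * x = x ->
    p * k * (p * k) = scal D^-1 * (scal d * p + x).
  move=> kp kk px; rewrite mulrA -[p * k * p]mulrA kp mulrA pp -mulrA kk.
  have pa : p * a x = a x.
    by rewrite /a mulrA -scal_comm -mulrA mulrBr mulrA -scal_comm -mulrA pp px.
  have -> : scal d = scal D - scal T by rewrite /D scalD addrAC subrr add0r.
  rewrite mulrBr mulr1 pa /a mulrBl -addrA [RHS]mulrDr scalVK // -mulrN opprB.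
  by rewrite [- _ + x]addrC.
have fs (k : X) : star k = k -> k * p = p * k -> star (p * k) = p * k.
  by move=> ks kp; rewrite starM ps ks.
have fg : p * c * (p * e) = p * e * (p * c).
  by rewrite -!mulrA [c * _]mulrA [e * (p * c)]mulrA cp ep -!mulrA ce.
have := nm_sum_squares (fs _ cs cp) (fs _ es ep) fg.
rewrite -nm_sa ?fs // (sq c y) // (sq e (- y)) ?mulrN ?py //.
rewrite -mulrDr addrACA subrr addr0 !nmZ (ger0_norm (_ : 0 <= D^-1)) ?invr_ge0 ?(ltW D0) //.
rewrite ler_pM2l ?invr_gt0 // -mulrDl -scalD nmZ ger0_norm ?addr_ge0 ?(ltW d0) // => h.
have := nmB (scal d * p + y) (scal d * p); rewrite addrAC subrr add0r nmZ.
rewrite ger0_norm ?(ltW d0) //; rewrite /d in h *; nra.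
Qed.

Lemma nm_isometry_le1 x : star x * x = 1 -> nm x <= 1.
Proof.
move=> xx; have := nm1 X; rewrite -xx nm_cstar => h.
by rewrite -(@ler_pXn2r _ 2) ?nnegrE ?nm_ge0 // expr1n.
Qed.

Lemma nm_reflection_le1 (q : X) : star q = q -> q * q = q -> nm (1 - (q + q)) <= 1.
Proof.
move=> qs qq; apply: nm_isometry_le1.
rewrite starD star1 starN starD qs mulrBl mul1r mulrBr mulr1 mulrDl !mulrDr qq.
by rewrite opprB addrK subrK.
Qed.

(** Compress by [P = p j]: the elements [P p_k P] are positive with sum [P], and the one for [k = j]
    is already [P]. The others are positive with sum zero, hence vanish, and the C*-identity turns
    [P p_i P = 0] into [p_i P = 0]. *)
Lemma projections_orthogonal (I : finType) (p : I -> X) :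
  (forall i, star (p i) = p i) -> (forall i, p i * p i = p i) -> \sum_i p i = 1 ->
  forall i j, i != j -> p i * p j = 0.
Proof.
move=> ps pp p1 i j ij; set P := p j; pose y k := P * p k * P.
have ys k : star (y k) = y k by rewrite /y !starM !ps mulrA.
have Py k : P * y k = y k by rewrite /y !mulrA pp.
have yP k : y k * P = y k by rewrite /y -!mulrA pp.
have pos k : corner_pos P (y k).
  (* The element to bound is half the compression of [1 - (p k + p k)], a reflection, of norm at
     most 1. *)
  exists 2^-1; first by rewrite invr_ge0.
  have -> : scal 2^-1 * P - y k = scal 2^-1 * (P * (1 - (p k + p k)) * P).
    have E : P * (p k + p k) * P = y k + y k by rewrite mulrDr mulrDl.
    by rewrite mulrBr mulr1 mulrBl E pp mulrBr scal_half.
  rewrite nmZ ger0_norm ?invr_ge0 // ler_piMr ?invr_ge0 //.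
  have := nmM (P * (1 - (p k + p k))) P; have := nmM P (1 - (p k + p k)).
  have := nm_reflection_le1 (ps k) (pp k); have := nm_proj (ps j) (pp j).
  have := nm_ge0 P; have := nm_ge0 (1 - (p k + p k)); have := nm_ge0 (P * (1 - (p k + p k))).
  rewrite -/P; nra.
have sy : \sum_k y k = P.
  by rewrite -mulr_suml -mulr_sumr p1 mulr1 pp.
have Ny : - y i = \sum_(k | (k != j) && (k != i)) y k.
  move: sy; rewrite (bigD1 j) //= (bigD1 i) //= {1}/y pp pp.
  move=> /(canRL (addKr _)); rewrite addNr => /eqP; rewrite addr_eq0 => /eqP ->.
  by rewrite opprK.
have y0 : y i = 0.
  apply: (corner_pos_eq0 (ps j) (pp j)) => //; rewrite Ny.
  by apply: corner_pos_sum => k _.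
apply: nm_eq0; apply/eqP; rewrite -sqrf_eq0 -nm_cstar starM !ps.
by rewrite mulrA -[P * p i * p i]mulrA pp -/(y i) y0 nm0.
Qed.

End CStarUnitary.

Lemma magic_unitary_orthogonal (R : realType) (X : cstarAlgType R[i]) (I J : finType)
    (u : I -> J -> X) : magic_unitary u ->
  (forall i j k, u i j * u i k = if j == k then u i j else 0) /\
  (forall i j k, u j i * u k i = if j == k then u j i else 0).
Proof.
move=> [us uu ur uc]; split=> i j k; case: eqP => [<-//|/eqP jk].
  by apply: (projections_orthogonal (p := u i)).
by apply: (projections_orthogonal (p := fun j => u j i)).
Qed.

(** * Contractivity of star morphisms and commutative envelopes *)

Section StarHomContractive.
Variables (R : realType) (B X : cstarAlgType R[i]) (f : B -> X).
Hypothesis hf : star_hom f.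

Lemma star_hom_scal r x : f (scal B r * x) = scal X r * f x.
Proof. by case: hf => _ fM fC _; rewrite fM fC. Qed.

(** Scale a self-adjoint [b] to norm below 1 and complete it to [b^2 + c^2 = 1]. The images satisfy
    the same equation, so [nm_sum_squares] bounds [f b]. The general case follows from the
    C*-identity. *)
Lemma star_hom_contractive x : nm (f x) <= nm x.
Proof.
have [fD fM fC fS] := hf.
have sa (b : B) : star b = b -> nm (f b) <= nm b.
  move=> bs; apply/ler_addgt0Pr => d d0; set t := nm b + d.
  have bt : nm b < t by rewrite ltrDl.
  have t0 : 0 < t by apply: le_lt_trans bt; apply: nm_ge0.
  set b' := scal B t^-1 * b.
  have b's : star b' = b' by rewrite star_scalM bs.
  have [c [cs bc cb]] := sqrt_one_minus_square b's (scale_lt1 bt).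
  have := @nm_sum_squares R X (f b') (f c) _ _ _; rewrite -!fS -!fM -fD b's cs bc cb.
  move=> /(_ erefl erefl erefl); rewrite (star_hom1 hf) => h.
  have : nm (f b') <= 1.
    rewrite -(@ler_pXn2r _ 2) ?nnegrE ?nm_ge0 // expr1n.
    exact: le_trans h (nm1 X).
  rewrite star_hom_scal nmZ ger0_norm ?invr_ge0 ?(ltW t0) // mulrC.
  by rewrite ler_pdivrMr // mul1r.
rewrite -(@ler_pXn2r _ 2) ?nnegrE ?nm_ge0 // -!nm_cstar -fS -fM.
by apply: sa; rewrite starM starK.
Qed.

End StarHomContractive.

Section CommutativeEnvelope.
Variables (R : realType) (A : starAlgType R[i]) (B : cstarAlgType R[i]).
Variable iota : starMorphism A B.
Hypothesis env : cstar_envelope iota.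

(* Conjugation by a unitary commuting with the image of [A] is the identity,   *)
(* by the uniqueness part of the universal property.                           *)
Lemma envelope_unitary_central (w : B) : star w * w = 1 -> w * star w = 1 ->
  (forall a, w * iota a = iota a * w) -> forall x, w * x = x * w.
Proof.
move=> ww ww' wi.
have idh : star_hom (fun x : B => x) by [].
have adh : star_hom (fun x => w * x * star w).
  split=> [x y|x y|c|x].
  - by rewrite mulrDr mulrDl.
  - by rewrite !mulrA -[w * x * star w * w]mulrA ww mulr1.
  - by rewrite -inC_central -mulrA ww' mulr1.
  - by rewrite !starM starK mulrA.
have [_ uniq] := env iota.
have h1 a : star_morphism adh (iota a) = iota a.
  by rewrite star_morphismE wi -mulrA ww' mulr1.
move=> x; have E : w * x * star w = x by exact: (uniq _ (star_morphism idh) h1 (fun=> erefl)).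
by rewrite -{2}E -!mulrA ww mulr1.
Qed.

(** A generator [a] gives the unitary [1 - 2 iota a], which commutes with the image of [A] and is
    therefore central; so the whole image is central. Then every unitary of [B] commutes with the
    image and is central in turn, and unitaries span [B]. *)
Lemma envelope_commutative (S : A -> Prop) :
  star_generated_by S -> (forall a, S a -> star a = a /\ a * a = a) ->
  (forall a b : A, a * b = b * a) -> forall x y : B, x * y = y * x.
Proof.
move=> gS pS aC.
have [iD iM iCc iS] := starMorphismP iota.
have cenP : star_subalg (fun a : A => forall x, iota a * x = x * iota a).
  split=> [c x|a b ha hb x|a b ha hb x|a ha x].
  - by rewrite iCc inC_central.
  - by rewrite iD mulrDl mulrDr ha hb.
  - by rewrite iM -mulrA hb mulrA ha mulrA.
  - by rewrite iS -[x]starK -!starM ha.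
have cen a x : iota a * x = x * iota a.
  move: a x; apply: (gS _ cenP) => a /pS [as_ aa] x.
  set q := iota a; pose w := 1 - (q + q).
  have qs : star q = q by rewrite /q -iS as_.
  have qq : q * q = q by rewrite /q -iM aa.
  have ws : star w = w by rewrite /w starD star1 starN starD qs.
  have ww : w * w = 1.
    by rewrite /w mulrBl mul1r mulrBr mulr1 mulrDl !mulrDr qq opprB addrK subrK.
  have wc : forall x, w * x = x * w.
    apply: envelope_unitary_central; rewrite ?ws // => b.
    by rewrite /w mulrBl mulrBr mul1r mulr1 mulrDl mulrDr /q -!iM aC.
  have := wc x; rewrite /w mulrBl mulrBr mul1r mulr1 mulrDl mulrDr => /addrI/oppr_inj E.
  by rewrite -[LHS](scal_half (q * x)) E scal_half.
have uni (w : B) : star w * w = 1 -> w * star w = 1 -> forall x, w * x = x * w.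
  by move=> ww ww'; apply: envelope_unitary_central => // a; rewrite cen.
have scalC (r : R) (b : B) : (forall x, b * x = x * b) ->
    forall x, scal B r * b * x = x * (scal B r * b).
  by move=> bC x; rewrite -mulrA bC !mulrA scal_comm.
have sa (b : B) : star b = b -> forall x, b * x = x * b.
  move=> bs; pose t := nm b + 1.
  have bt : nm b < t by rewrite ltrDl.
  have t0 : t != 0 by rewrite gt_eqF // (le_lt_trans _ bt) // nm_ge0.
  have b's : star (scal B t^-1 * b) = scal B t^-1 * b by rewrite star_scalM bs.
  have [c [cs bc cb]] := sqrt_one_minus_square b's (scale_lt1 bt).
  have h1 := combineM b's cs cb; have h2 := combineMr b's cs cb.
  rewrite bc in h1 h2.
  have uC := uni _ h1 h2; set u := scal B t^-1 * b + _ in h1 h2 uC.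
  have usC : forall x, star u * x = x * star u by apply: uni; rewrite starK.
  rewrite -(scalK b t0); apply: (@scalC) => x.
  rewrite (combine_real b's cs); apply: (@scalC) => {}x.
  by rewrite mulrDl mulrDr uC usC.
move=> x; rewrite -(scal_half x); apply: scalC => y.
pose d := iC B * (x - star x).
have ds : star d = d.
  by rewrite starM star_iC starD starN starK mulrN -mulNr opprB -iC_comm.
have -> : x + x = (x + star x) - iC B * d.
  by rewrite /d mulrA iC2 mulN1r opprK addrACA subrr addr0.
have hx : star (x + star x) = x + star x by rewrite starD starK addrC.
rewrite mulrBl mulrBr (sa _ hx); congr (_ - _).
by rewrite -mulrA (sa _ ds) !mulrA iC_comm.
Qed.

End CommutativeEnvelope.

(** * The enveloping C*-algebra *)

Local Open Scope quotient_scope.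

Lemma sub_sub_sub (V : zmodType) (x y x' y' : V) :
  x - y = (x' - y') - ((x' - x) - (y' - y)).
Proof.
have xE : x' = (x' - x) + x by rewrite subrK.
have yE : y' = (y' - y) + y by rewrite subrK.
rewrite {1}xE {1}yE; move: (x' - x) (y' - y) => a b.
by rewrite opprD addrACA [a - b + _]addrC addrK.
Qed.

(** Finiteness of the largest C*-seminorm. *)
Definition bounded_alg (R : realType) (A : starAlgType R[i]) : Prop :=
  forall a : A, exists M : R, forall (X : cstarAlgType R[i]) (f : starMorphism A X),
    nm (f a) <= M.

(* The universal enveloping C*-algebra: sequences of [A] that are Cauchy for   *)
(* the supremum of the C*-seminorms, identified when they have the same limit  *)
(* in every C*-algebra.                                                        *)
Section Completion.
Variables (R : realType) (A : starAlgType R[i]) (bA : bounded_alg A).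

Definition ucauchy (s : nat -> A) : Prop :=
  forall e : R, 0 < e -> exists N, forall m n, (N <= m)%N -> (N <= n)%N ->
    forall (X : cstarAlgType R[i]) (f : starMorphism A X), nm (f (s m) - f (s n)) <= e.

Record cseq := CSeq { cseq_val :> nat -> A; cseqP : ucauchy cseq_val }.

HB.instance Definition _ := gen_eqMixin cseq.
HB.instance Definition _ := gen_choiceMixin cseq.

Lemma ev_cauchy (X : cstarAlgType R[i]) (f : starMorphism A X) (s : cseq) :
  cauchys (fun n => f (s n)).
Proof.
move=> e e0; have [|N hN] := cseqP s (e := e / 2); first by lra.
exists N => m n Nm Nn; have := hN _ _ Nm Nn X f; lra.
Qed.

Definition ev (X : cstarAlgType R[i]) (f : starMorphism A X) (s : cseq) : X :=
  projT1 (cid (cauchys_cvg (ev_cauchy f s))).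

Lemma evP (X : cstarAlgType R[i]) (f : starMorphism A X) (s : cseq) :
  cvgs (fun n => f (s n)) (ev f s).
Proof. by rewrite /ev; case: cid. Qed.

Lemma ev_near (s : cseq) (e : R) : 0 < e -> exists N, forall n, (N <= n)%N ->
  forall (X : cstarAlgType R[i]) (f : starMorphism A X), nm (ev f s - f (s n)) <= e.
Proof.
move=> /(cseqP s)[N hN]; exists N => n Nn X f.
apply: (cvgs_bound (cvgsD (evP f s) (cvgs_cst (- f (s n))))).
by exists N => m Nm; apply: hN.
Qed.

Lemma cseq_bounded (s : cseq) : exists M : R, exists N, forall n, (N <= n)%N ->
  forall (X : cstarAlgType R[i]) (f : starMorphism A X), nm (f (s n)) <= M.
Proof.
have [|N hN] := cseqP s (e := 1); first by lra.
have [M hM] := bA (s N); exists (M + 1), N => n Nn X f.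
have := nmD (f (s n) - f (s N)) (f (s N)); rewrite subrK.
have := hM X f; have := hN _ _ Nn (leqnn N) X f; lra.
Qed.

Lemma cst_ucauchy a : ucauchy (fun=> a).
Proof. by move=> e e0; exists 0%N => m n _ _ X f; rewrite subrr nm0 ltW. Qed.
Definition cseq_cst a := CSeq (cst_ucauchy a).

Lemma add_ucauchy (s t : cseq) : ucauchy (fun n => s n + t n).
Proof.
move=> e e0; have e2 : 0 < e / 2 by lra.
have [N hN] := cseqP s e2; have [M hM] := cseqP t e2.
exists (maxn N M) => m n; rewrite !geq_max => /andP[Nm Mm] /andP[Nn Mn] X f.
have := hN _ _ Nm Nn X f; have := hM _ _ Mm Mn X f.
rewrite !raddfD /= addrACA.
have := nmD (f (s m) - f (s n)) (f (t m) - f (t n)); lra.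
Qed.
Definition cseq_add s t := CSeq (add_ucauchy s t).

Lemma mul_ucauchy (s t : cseq) : ucauchy (fun n => s n * t n).
Proof.
have [K [N1 h1]] := cseq_bounded s; have [L [N2 h2]] := cseq_bounded t.
move=> e e0; pose D := `|K| + `|L| + 1.
have K0 : 0 <= `|K| by []; have L0 : 0 <= `|L| by [].
have D0 : 0 < D by rewrite /D; lra.
have d0 : 0 < e / D by apply: divr_gt0.
have [N3 h3] := cseqP s d0; have [N4 h4] := cseqP t d0.
exists (maxn (maxn N1 N2) (maxn N3 N4)) => m n.
rewrite !geq_max => /andP[/andP[m1 m2] /andP[m3 m4]] /andP[/andP[n1 n2] /andP[n3 n4]] X f.
rewrite !rmorphM /=.
have -> : f (s m) * f (t m) - f (s n) * f (t n) =
    f (s m) * (f (t m) - f (t n)) + (f (s m) - f (s n)) * f (t n).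
  by rewrite mulrBr mulrBl addrA subrK.
have b1 := h1 _ m1 X f; have b2 := h2 _ n2 X f.
have b3 := h3 _ _ m3 n3 X f; have b4 := h4 _ _ m4 n4 X f.
have dD : e / D * D = e by rewrite divfK // gt_eqF.
set d := e / D in d0 b3 b4 dD; clearbody d.
have eE : e = `|K| * d + `|L| * d + d by rewrite -dD /D; ring.
have i1 : nm (f (s m) * (f (t m) - f (t n))) <= `|K| * d.
  apply: le_trans (nmM _ _) _; rewrite ler_pM ?nm_ge0 //.
  exact: le_trans b1 (ler_norm K).
have i2 : nm ((f (s m) - f (s n)) * f (t n)) <= `|L| * d.
  apply: le_trans (nmM _ _) _; rewrite mulrC ler_pM ?nm_ge0 //.
  exact: le_trans b2 (ler_norm L).
apply: le_trans (nmD _ _) _; rewrite eE; lra.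
Qed.
Definition cseq_mul s t := CSeq (mul_ucauchy s t).

Lemma star_ucauchy (s : cseq) : ucauchy (fun n => star (s n)).
Proof.
move=> e /(cseqP s)[N hN]; exists N => m n Nm Nn X f.
by rewrite !starmorph_star -starN -starD nm_star hN.
Qed.
Definition cseq_star s := CSeq (star_ucauchy s).

Section Ev.
Variables (X : cstarAlgType R[i]) (f : starMorphism A X).
Lemma ev_cst a : ev f (cseq_cst a) = f a.
Proof. exact: (cvgs_uniq (evP f (cseq_cst a)) (cvgs_cst (f a))). Qed.
Lemma ev_add s t : ev f (cseq_add s t) = ev f s + ev f t.
Proof.
apply: (cvgs_uniq (evP f _)); apply: cvgs_ext (cvgsD (evP f s) (evP f t)) => n /=.
by rewrite raddfD.
Qed.
Lemma ev_mul s t : ev f (cseq_mul s t) = ev f s * ev f t.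
Proof.
apply: (cvgs_uniq (evP f _)); apply: cvgs_ext (cvgsM (evP f s) (evP f t)) => n /=.
by rewrite rmorphM.
Qed.
Lemma ev_star s : ev f (cseq_star s) = star (ev f s).
Proof.
apply: (cvgs_uniq (evP f _)); apply: cvgs_ext (cvgs_star (evP f s)) => n /=.
by rewrite starmorph_star.
Qed.
End Ev.

Definition cseq_eqv (s t : cseq) : bool :=
  `[< forall (X : cstarAlgType R[i]) (f : starMorphism A X), ev f s = ev f t >].

Fact cseq_eqv_equiv : equiv_class_of cseq_eqv.
Proof.
split=> [s|s t|t s u]; first by apply/asboolP.
  by apply/asboolP/asboolP=> h X f; rewrite h.
by move=> /asboolP h1 /asboolP h2; apply/asboolP => X f; rewrite h1.
Qed.

Canonical cseq_eqv_rel := EquivRelPack cseq_eqv_equiv.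

Definition completion : Type := {eq_quot cseq_eqv_rel}.
HB.instance Definition _ := Choice.on completion.
HB.instance Definition _ := EqQuotient.on completion.

Implicit Types x y z : completion.

Definition cev (X : cstarAlgType R[i]) (f : starMorphism A X) x : X := ev f (repr x).

Lemma cevE (X : cstarAlgType R[i]) (f : starMorphism A X) s :
  cev f (\pi_completion s) = ev f s.
Proof.
rewrite /cev; case: piP => t /eqP; rewrite eqmodE => /asboolP h.
by rewrite h.
Qed.

Lemma cev_inj x y :
  (forall (X : cstarAlgType R[i]) (f : starMorphism A X), cev f x = cev f y) -> x = y.
Proof.
move=> h; rewrite -[x]reprK -[y]reprK; apply/eqP; rewrite eqmodE.
by apply/asboolP => X f; apply: h.
Qed.

Definition comp_cst a : completion := \pi_completion (cseq_cst a).
Definition comp_inC (c : R[i]) : completion := comp_cst (inC c).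
Definition comp_add x y : completion := \pi_completion (cseq_add (repr x) (repr y)).
Definition comp_mul x y : completion := \pi_completion (cseq_mul (repr x) (repr y)).
Definition comp_star x : completion := \pi_completion (cseq_star (repr x)).
Definition comp_opp x : completion := comp_mul (comp_inC (-1)) x.

Section Cev.
Variables (X : cstarAlgType R[i]) (f : starMorphism A X).
Lemma cev_cst a : cev f (comp_cst a) = f a.
Proof. by rewrite cevE ev_cst. Qed.
Lemma cev_inC c : cev f (comp_inC c) = inC c.
Proof. by rewrite cev_cst starmorph_inC. Qed.
Lemma cev_add x y : cev f (comp_add x y) = cev f x + cev f y.
Proof. by rewrite cevE ev_add. Qed.
Lemma cev_mul x y : cev f (comp_mul x y) = cev f x * cev f y.
Proof. by rewrite cevE ev_mul. Qed.
Lemma cev_star x : cev f (comp_star x) = star (cev f x).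
Proof. by rewrite cevE ev_star. Qed.
Lemma cev_opp x : cev f (comp_opp x) = - cev f x.
Proof. by rewrite cev_mul cev_inC inCN1 mulN1r. Qed.
Definition cevW := (cev_inC, cev_opp, cev_add, cev_mul, cev_star).
End Cev.

Local Ltac cev_tac :=
  let X := fresh "X" in let f := fresh "f" in
  apply: cev_inj; intros X f; rewrite !(cevW f).

Fact comp_addA : associative comp_add.
Proof. by move=> x y z; cev_tac; rewrite addrA. Qed.
Fact comp_addC : commutative comp_add.
Proof. by move=> x y; cev_tac; rewrite addrC. Qed.
Fact comp_add0 : left_id (comp_inC 0) comp_add.
Proof. by move=> x; cev_tac; rewrite inC0 add0r. Qed.
Fact comp_addN : left_inverse (comp_inC 0) comp_opp comp_add.
Proof. by move=> x; cev_tac; rewrite inC0 addNr. Qed.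

HB.instance Definition _ :=
  GRing.isZmodule.Build completion comp_addA comp_addC comp_add0 comp_addN.

Fact comp_mulA : associative comp_mul.
Proof. by move=> x y z; cev_tac; rewrite mulrA. Qed.
Fact comp_mul1 : left_id (comp_inC 1) comp_mul.
Proof. by move=> x; cev_tac; rewrite inC1 mul1r. Qed.
Fact comp_mulr1 : right_id (comp_inC 1) comp_mul.
Proof. by move=> x; cev_tac; rewrite inC1 mulr1. Qed.
Fact comp_mulDl : left_distributive comp_mul comp_add.
Proof. by move=> x y z; cev_tac; rewrite mulrDl. Qed.
Fact comp_mulDr : right_distributive comp_mul comp_add.
Proof. by move=> x y z; cev_tac; rewrite mulrDr. Qed.

HB.instance Definition _ := GRing.Zmodule_isPzRing.Build completion
  comp_mulA comp_mul1 comp_mulr1 comp_mulDl comp_mulDr.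

Fact comp_inCD : {morph comp_inC : c d / c + d}.
Proof. by move=> c d; cev_tac; rewrite inCD. Qed.
Fact comp_inCM : {morph comp_inC : c d / c * d}.
Proof. by move=> c d; cev_tac; rewrite inCM. Qed.
Fact comp_inC_central c x : comp_inC c * x = x * comp_inC c.
Proof. by cev_tac; rewrite inC_central. Qed.
Fact comp_starK : involutive comp_star.
Proof. by move=> x; cev_tac; rewrite starK. Qed.
Fact comp_starD : {morph comp_star : x y / x + y}.
Proof. by move=> x y; cev_tac; rewrite starD. Qed.
Fact comp_starM x y : comp_star (x * y) = comp_star y * comp_star x.
Proof. by cev_tac; rewrite starM. Qed.
Fact comp_star_inC c : comp_star (comp_inC c) = comp_inC (Num.conj c).
Proof. by cev_tac; rewrite star_inC. Qed.

HB.instance Definition _ := PzRing_isStarAlgebra.Build R[i] completion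
  comp_inCD comp_inCM erefl comp_inC_central
  comp_starK comp_starD comp_starM comp_star_inC.

(** The value [0] makes the set nonempty without exhibiting a morphism. *)
Definition norms x : R -> Prop := fun r =>
  r = 0 \/ exists (X : cstarAlgType R[i]) (f : starMorphism A X), r = nm (cev f x).

Definition comp_nm x : R := sup (norms x).

Lemma norms_has_sup x : classical_sets.has_sup (norms x).
Proof.
split; first by exists 0; left.
have [M [N hM]] := cseq_bounded (repr x); exists `|M| => _ [->//|[X [f ->]]].
apply: le_trans (ler_norm M).
by apply: (cvgs_bound (evP f _)); exists N => n Nn; apply: hM.
Qed.

Lemma comp_nm_ub x (X : cstarAlgType R[i]) (f : starMorphism A X) :
  nm (cev f x) <= comp_nm x.
Proof. by apply: sup_upper_bound; [exact: norms_has_sup | right; exists X, f]. Qed.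

Lemma comp_nm_ge0 x : 0 <= comp_nm x.
Proof. by apply: sup_upper_bound; [exact: norms_has_sup | left]. Qed.

Lemma comp_nm_le x (M : R) : 0 <= M ->
  (forall (X : cstarAlgType R[i]) (f : starMorphism A X), nm (cev f x) <= M) ->
  comp_nm x <= M.
Proof.
move=> M0 h; apply: ge_sup; first by exists 0; left.
by move=> _ [->//|[X [f ->]]].
Qed.

Definition comp_cnorm x : R[i] := (comp_nm x)%:C.

Fact comp_cnorm_ge0 x : 0 <= comp_cnorm x.
Proof. by rewrite /comp_cnorm ler0c comp_nm_ge0. Qed.
Fact comp_cnorm_eq0 x : comp_cnorm x = 0 -> x = 0.
Proof.
move=> /complexI x0; apply: cev_inj => X f; rewrite (cevW f) inC0.
by apply: nm_eq0; apply/eqP; rewrite eq_le nm_ge0 andbT -x0 comp_nm_ub.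
Qed.
Fact comp_cnormD x y : comp_cnorm (x + y) <= comp_cnorm x + comp_cnorm y.
Proof.
rewrite /comp_cnorm -rmorphD /= lecR; apply: comp_nm_le => [|X f].
  by rewrite addr_ge0 ?comp_nm_ge0.
rewrite (cev_add f); apply: le_trans (nmD _ _) _.
by rewrite lerD ?comp_nm_ub.
Qed.
Fact comp_cnormM x y : comp_cnorm (x * y) <= comp_cnorm x * comp_cnorm y.
Proof.
rewrite /comp_cnorm -rmorphM /= lecR; apply: comp_nm_le => [|X f].
  by rewrite mulr_ge0 ?comp_nm_ge0.
rewrite (cev_mul f); apply: le_trans (nmM _ _) _.
by rewrite ler_pM ?nm_ge0 ?comp_nm_ub.
Qed.
Fact comp_cnormZ (c : R[i]) x : comp_cnorm (inC c * x) = `|c| * comp_cnorm x.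
Proof.
have [->|c0] := eqVneq c 0.
  rewrite normr0 !mul0r /comp_cnorm; congr (_%:C).
  apply/eqP; rewrite eq_le comp_nm_ge0 andbT; apply: comp_nm_le => // X f.
  by rewrite (cevW f) inC0 nm0.
pose r := complex.Re `|c|; have rE : `|c| = r%:C by rewrite /r normc_def.
have r0 : 0 < r by rewrite -ltcR -rE normr_gt0.
have cE (X : cstarAlgType R[i]) (f : starMorphism A X) :
    nm (cev f (inC c * x)) = r * nm (cev f x).
  by rewrite (cevW f) (cevW f) nmCZ.
rewrite /comp_cnorm rE -rmorphM; congr (_%:C); apply/eqP; rewrite eq_le; apply/andP; split.
  apply: comp_nm_le => [|X f]; first by rewrite mulr_ge0 ?comp_nm_ge0 // ltW.
  by rewrite cE ler_pM2l // comp_nm_ub.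
rewrite mulrC -ler_pdivlMr //; apply: comp_nm_le => [|X f].
  by rewrite divr_ge0 ?comp_nm_ge0 // ltW.
by rewrite ler_pdivlMr // mulrC -cE comp_nm_ub.
Qed.
Fact comp_cnorm_star x : comp_cnorm (star x * x) = comp_cnorm x ^+ 2.
Proof.
rewrite /comp_cnorm -rmorphXn; congr (_%:C).
have cE (X : cstarAlgType R[i]) (f : starMorphism A X) :
    nm (cev f (star x * x)) = nm (cev f x) ^+ 2.
  by rewrite (cev_mul f) (cev_star f) nm_cstar.
apply/eqP; rewrite eq_le; apply/andP; split.
  apply: comp_nm_le => [|X f]; first by rewrite exprn_ge0 ?comp_nm_ge0.
  by rewrite cE lerXn2r ?nnegrE ?nm_ge0 ?comp_nm_ge0 // comp_nm_ub.
rewrite -(sqr_sqrtr (comp_nm_ge0 (star x * x))) lerXn2r ?nnegrE ?sqrtr_ge0 ?comp_nm_ge0 //.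
apply: comp_nm_le => [|X f]; first exact: sqrtr_ge0.
by rewrite -(ger0_norm (nm_ge0 (cev f x))) -sqrtr_sqr ler_wsqrtr // -cE comp_nm_ub.
Qed.

Lemma comp_dense x (e : R) : 0 < e -> exists a : A,
  forall (X : cstarAlgType R[i]) (f : starMorphism A X), nm (cev f x - f a) <= e.
Proof. by move=> /(ev_near (repr x))[N hN]; exists (repr x N) => X f; apply: hN. Qed.

(** Diagonal argument: elements [a n] of [A] at distance at most [1 / (n + 1)] from [u n] form a
    sequence that is Cauchy uniformly in all representations, and its class is the limit. *)
Fact comp_cnorm_complete (u : nat -> completion) :
  (forall e : R[i], 0 < e -> exists N, forall m n,
     (N <= m)%N -> (N <= n)%N -> comp_cnorm (u m - u n) < e) ->
  exists l, forall e : R[i], 0 < e -> exists N, forall n,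
     (N <= n)%N -> comp_cnorm (u n - l) < e.
Proof.
move=> cu.
have inv0 n : 0 < n.+1%:R^-1 :> R by rewrite invr_gt0.
pose a n := projT1 (cid (comp_dense (u n) (inv0 n))).
have aP n (X : cstarAlgType R[i]) (f : starMorphism A X) : nm (cev f (u n) - f (a n)) <= n.+1%:R^-1.
  by rewrite /a; case: cid.
have small (e : R) : 0 < e -> exists N, forall n, (N <= n)%N -> n.+1%:R^-1 < e.
  move=> e0; have := archi_boundP (ltW (inv0 0%N)).
  have := archi_boundP (ltW (divr_gt0 ltr01 e0)); set N := Num.bound _ => hN _.
  exists N => n Nn; rewrite invf_plt ?posrE // -div1r; apply: lt_le_trans hN _.
  by rewrite ler_nat leqW.
have cevB (X : cstarAlgType R[i]) (f : starMorphism A X) x y :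
    cev f (x - y) = cev f x - cev f y.
  by rewrite (cev_add f) (cev_opp f).
have ca : ucauchy a.
  move=> e e0; have e3 : 0 < e / 3 by lra.
  have [N hN] := small _ e3; have [|M hM] := cu (e / 3)%:C; first by rewrite ltcR.
  exists (maxn N M) => m n; rewrite !geq_max => /andP[Nm Mm] /andP[Nn Mn] X f.
  have := hM _ _ Mm Mn; rewrite ltcR => h.
  have := comp_nm_ub (u m - u n) f; rewrite cevB => h'.
  have -> : f (a m) - f (a n) = (cev f (u m) - cev f (u n)) -
      ((cev f (u m) - f (a m)) - (cev f (u n) - f (a n))).
    exact: sub_sub_sub.
  have := nmB (cev f (u m) - cev f (u n))
    ((cev f (u m) - f (a m)) - (cev f (u n) - f (a n))).
  have := nmB (cev f (u m) - f (a m)) (cev f (u n) - f (a n)).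
  have := le_lt_trans (aP m X f) (hN _ Nm).
  have := le_lt_trans (aP n X f) (hN _ Nn); lra.
exists (\pi_completion (CSeq ca)) => e e0.
have er : (complex.Re e)%:C = e by rewrite RRe_real // gtr0_real.
move: e0; rewrite -er ltcR; move: (complex.Re e) => {er}e e0.
have e3 : 0 < e / 3 by lra.
have [N hN] := small _ e3; have [M hM] := ev_near (CSeq ca) e3.
exists (maxn N M) => n; rewrite geq_max => /andP[Nn Mn]; rewrite ltcR.
have : comp_nm (u n - \pi_completion (CSeq ca)) <= e / 3 + e / 3.
  apply: comp_nm_le => [|X f]; first by lra.
  rewrite cevB cevE; have h : nm (ev f (CSeq ca) - f (a n)) <= e / 3 := hM _ Mn X f.
  have -> : cev f (u n) - ev f (CSeq ca) =
      (cev f (u n) - f (a n)) - (ev f (CSeq ca) - f (a n)).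
    by rewrite opprB addrA subrK.
  have := nmB (cev f (u n) - f (a n)) (ev f (CSeq ca) - f (a n)).
  have := le_lt_trans (aP n X f) (hN _ Nn); lra.
lra.
Qed.

HB.instance Definition _ := isCStarAlgebra.Build R[i] completion
  comp_cnorm_ge0 comp_cnorm_eq0 comp_cnormD comp_cnormZ comp_cnormM
  comp_cnorm_star comp_cnorm_complete.

Definition envelope : cstarAlgType R[i] := completion.

Lemma comp_cst_hom : star_hom (comp_cst : A -> envelope).
Proof.
split=> [a b|a b|c|a]; apply: cev_inj => X f; rewrite ?(cevW f) ?cev_cst.
- by rewrite raddfD.
- by rewrite rmorphM.
- by rewrite ?starmorph_inC.
- by rewrite starmorph_star.
Qed.

Lemma cev_hom (X : cstarAlgType R[i]) (f : starMorphism A X) :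
  star_hom (cev f : envelope -> X).
Proof. by split=> [x y|x y|c|x]; rewrite (cevW f). Qed.

(** Existence is evaluation of limits. Uniqueness follows from the density of [A], the morphisms
    being continuous by [star_hom_contractive]. *)
Lemma envelope_universal : cstar_envelope (star_morphism comp_cst_hom).
Proof.
move=> X f; split.
  by exists (star_morphism (cev_hom f)) => a; rewrite !star_morphismE cev_cst.
move=> g h gf hf x; apply/eqP; rewrite -subr_eq0; apply/eqP/nm_small => e e0.
have e3 : 0 < e / 3 by lra.
have [a ha] := comp_dense x e3.
have xa : nm (x - comp_cst a : envelope) <= e / 3.
  rewrite /nm /= /comp_cnorm /=; apply: comp_nm_le => [|Y k]; first by lra.
  by rewrite (cev_add k) (cev_opp k) cev_cst.
have hx (k : starMorphism envelope X) : nm (k (x - comp_cst a)) <= e / 3.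
  by apply: le_trans (star_hom_contractive (starMorphismP k) _) xa.
have -> : g x - h x = g (x - comp_cst a) - h (x - comp_cst a).
  have kB (k : starMorphism envelope X) : k (comp_cst a) = f a ->
      k (x - comp_cst a) = k x - f a by move=> <-; apply: raddfB.
  by rewrite (kB g (gf a)) (kB h (hf a)) opprB addrA subrK.
have := nmB (g (x - comp_cst a)) (h (x - comp_cst a)).
have := hx g; have := hx h; lra.
Qed.

End Completion.

Local Close Scope quotient_scope.

(** * Two by two complex matrices *)

(** The limit is the supremum of the eventual lower bounds. *)
Lemma real_cauchy_cvg (R : realType) (u : nat -> R) :
  (forall e, 0 < e -> exists N, forall m n, (N <= m)%N -> (N <= n)%N -> `|u m - u n| < e) ->
  exists l, forall e, 0 < e -> exists N, forall n, (N <= n)%N -> `|u n - l| < e.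
Proof.
move=> cu; pose S (a : R) := exists N, forall n, (N <= n)%N -> a <= u n.
have near e N : (forall m n, (N <= m)%N -> (N <= n)%N -> `|u m - u n| < e) ->
    S (u N - e) /\ forall a, S a -> a <= u N + e.
  move=> hN; split.
    by exists N => n Nn; have := hN _ _ (leqnn N) Nn; rewrite ltr_distl => /andP[]; lra.
  move=> a [M hM]; have := hM _ (leq_maxr N M).
  have := hN _ _ (leqnn N) (leq_maxl N M); rewrite ltr_distl => /andP[]; lra.
have hS : classical_sets.has_sup S.
  have [N /near[h1 h2]] := cu 1 ltr01; split; first by exists (u N - 1).
  by exists (u N + 1).
exists (sup S) => e e0; have e4 : 0 < e / 4 by lra.
have [N hN] := cu _ e4; have [h1 h2] := near _ _ hN; exists N => n Nn.
have := sup_upper_bound hS h1; have : sup S <= u N + e / 4 by apply: ge_sup => //; case: hS.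
have := hN _ _ Nn (leqnn N); rewrite !ltr_distl => /andP[*]; apply/andP; split; lra.
Qed.

Lemma complex_cauchy_cvg (R : realType) (u : nat -> R[i]) :
  (forall e : R, 0 < e -> exists N, forall m n, (N <= m)%N -> (N <= n)%N ->
    `|u m - u n| < e%:C) ->
  exists l, forall e : R, 0 < e -> exists N, forall n, (N <= n)%N -> `|u n - l| < e%:C.
Proof.
have nRe (z : R[i]) (e : R) : `|z| < e%:C -> `|complex.Re z| < e.
  by move=> h; rewrite -ltcR; apply: le_lt_trans (normc_ge_Re z) h.
have nIm (z : R[i]) (e : R) : `|z| < e%:C -> `|complex.Im z| < e.
  move=> h; have -> : complex.Im z = - complex.Re (z * 'i%C) by rewrite ReiNIm opprK.
  rewrite normrN; apply: nRe; rewrite normrM (_ : `|'i%C| = 1) ?mulr1 //.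
  by rewrite normc_def /= expr0n expr1n add0r sqrtr1.
move=> cu.
have [|a ha] := @real_cauchy_cvg R (fun n => complex.Re (u n)).
  move=> e /cu[N hN]; exists N => m n Nm Nn.
  by have /nRe := hN _ _ Nm Nn; rewrite raddfB.
have [|b hb] := @real_cauchy_cvg R (fun n => complex.Im (u n)).
  move=> e /cu[N hN]; exists N => m n Nm Nn.
  by have /nIm := hN _ _ Nm Nn; rewrite raddfB.
exists (a +i* b) => e e0; have e2 : 0 < e / 2 by lra.
have [N hN] := ha _ e2; have [M hM] := hb _ e2; exists (maxn N M) => n.
rewrite geq_max => /andP[/hN h1 /hM h2].
have -> : u n - (a +i* b) = (complex.Re (u n) - a)%:C + 'i%C * (complex.Im (u n) - b)%:C.
  by case: (u n) => x y; apply/eqP; rewrite eq_complex /=; apply/andP; split; apply/eqP; ring.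
apply: le_lt_trans (ler_normD _ _) _; rewrite normrM.
have -> : `|'i%C| = 1 :> R[i] by rewrite normc_def /= expr0n expr1n add0r sqrtr1.
have nR (x : R) : `|x%:C| = `|x|%:C by rewrite normc_def /= expr0n addr0 sqrtr_sqr.
by rewrite mul1r !nR -rmorphD /= ltcR; lra.
Qed.

Lemma real_leD (R : realType) (x y z : R) (a b c : R[i]) :
  x%:C = a -> y%:C = b -> z%:C = c -> a <= b + c -> x <= y + z.
Proof. by move=> <- <- <-; rewrite -rmorphD lecR. Qed.

Lemma real_leM (R : realType) (y z : R) (a b c : R[i]) :
  y%:C = b -> z%:C = c -> a <= b * c -> a <= (y * z)%:C.
Proof. by move=> <- <-; rewrite -rmorphM. Qed.

Lemma sqrtC_scale (R : realType) (y z : R) (r a b : R[i]) : 0 <= r -> 0 <= b ->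
  y%:C = sqrtC a -> z%:C = sqrtC b -> a = r ^+ 2 * b -> y%:C = r * z%:C.
Proof.
move=> r0 b0 -> -> ->; rewrite sqrtCM ?nnegrE ?exprn_ge0 //.
by rewrite sqrCK.
Qed.

Section MatrixCStar.
Variable R : realType.
Local Notation C := R[i].
Local Notation V := 'rV[C]_2.
Local Notation M := 'M[C]_2.
Local Notation "''[' u , v ]" := (dotmx u v) : ring_scope.
Local Notation "''[' u ]" := (dotmx u u) : ring_scope.
Implicit Types (u v : V) (x y : M).

Definition vnorm v : R := complex.Re (sqrtC '[v]).

Lemma vnormE v : (vnorm v)%:C = sqrtC '[v].
Proof. by rewrite /vnorm RRe_real // ger0_real // sqrt_dnorm_ge0. Qed.

Lemma vnorm_ge0 v : 0 <= vnorm v.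
Proof. by rewrite -ler0c vnormE sqrt_dnorm_ge0. Qed.

Lemma vnormD u v : vnorm (u + v) <= vnorm u + vnorm v.
Proof.
have [h _] := triangle_lerif (@dotmx C 2) u v.
exact: real_leD (vnormE _) (vnormE _) (vnormE _) h.
Qed.

Lemma vnormZ (c : C) v : (vnorm (c *: v))%:C = `|c| * (vnorm v)%:C.
Proof.
have h := dnormZ (@dotmx C 2) c v.
exact: sqrtC_scale (normr_ge0 c) (dnorm_ge0 (@dotmx C 2) v) (vnormE _) (vnormE _) h.
Qed.

Lemma vnorm_sqr v : (vnorm v ^+ 2)%:C = '[v].
Proof. by rewrite rmorphXn /= vnormE sqrtCK. Qed.

Lemma vnorm_CS u v : `|'[u, v]| <= (vnorm u * vnorm v)%:C.
Proof.
have [h _] := CauchySchwarz_sqrt (@dotmx C 2) u v.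
exact: real_leM (vnormE _) (vnormE _) h.
Qed.

End MatrixCStar.

Section MatrixCStarAlgebra.
Variable R : realType.
Local Notation C := R[i].
Local Notation V := 'rV[C]_2.
Local Notation M := 'M[C]_2.
Local Notation "''[' u , v ]" := (dotmx u v) : ring_scope.
Local Notation "''[' u ]" := (dotmx u u) : ring_scope.
Implicit Types (u v : V) (x y : M).

Lemma vnorm0 : vnorm (0 : V) = 0.
Proof. by apply: complexI; rewrite vnormE linear0r sqrtC0. Qed.

Lemma vnorm_eq0 v : vnorm v = 0 -> v = 0.
Proof.
move=> h; have := vnorm_sqr v; rewrite h expr0n => /esym/eqP.
by rewrite dnorm_eq0 => /eqP.
Qed.

Lemma vnormZr (r : R) v : 0 <= r -> vnorm (r%:C *: v) = r * vnorm v.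
Proof.
move=> r0; apply: complexI; rewrite vnormZ rmorphM /= ger0_norm //.
by rewrite ler0c.
Qed.

Local Notation ee i := (delta_mx 0 i : V).

Lemma vnorm_ee i : vnorm (ee i) = 1.
Proof.
apply: complexI; rewrite vnormE dotmxE !mxE (bigD1 i) //= big1 => [|j ji].
  by rewrite !mxE !eqxx addr0 mul1r conjC1 sqrtC1.
by rewrite !mxE eqxx (negbTE ji) mul0r.
Qed.

Lemma dotmx_ee v i : '[v, ee i] = v 0 i.
Proof.
rewrite dotmxE !mxE (bigD1 i) //= big1 => [|j ji].
  by rewrite !mxE !eqxx addr0 conjC1 mulr1.
by rewrite !mxE eqxx (negbTE ji) conjC0 mulr0.
Qed.

Lemma entry_le_vnorm v i : `|v 0 i| <= (vnorm v)%:C.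
Proof. by rewrite -dotmx_ee; apply: le_trans (vnorm_CS _ _) _; rewrite vnorm_ee mulr1. Qed.

Definition opbound x : R := \sum_i vnorm (row i x).

Lemma vnorm_sum (I : finType) (F : I -> V) : vnorm (\sum_i F i) <= \sum_i vnorm (F i).
Proof.
elim/big_ind2: _ => [|a b c d h k|//]; first by rewrite vnorm0.
by apply: le_trans (vnormD _ _) _; apply: lerD.
Qed.

Lemma vnorm_mul_le x v : vnorm (v *m x) <= opbound x * vnorm v.
Proof.
rewrite mulmx_sum_row; apply: le_trans (vnorm_sum _) _; rewrite mulr_suml.
apply: ler_sum => i _; rewrite -lecR vnormZ rmorphM /= mulrC ler_wpM2l //.
  by rewrite ler0c vnorm_ge0.
exact: entry_le_vnorm.
Qed.

Definition opset x : R -> Prop := fun r => exists2 v, vnorm v <= 1 & r = vnorm (v *m x).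
Definition opnorm x : R := sup (opset x).

Lemma opbound_ge0 x : 0 <= opbound x.
Proof. by apply: sumr_ge0 => i _; apply: vnorm_ge0. Qed.

Lemma opset_has_sup x : classical_sets.has_sup (opset x).
Proof.
split; first by exists 0, 0; rewrite ?vnorm0 // mul0mx vnorm0.
exists (opbound x) => _ [v v1 ->]; apply: le_trans (vnorm_mul_le x v) _.
by rewrite ler_piMr ?opbound_ge0.
Qed.

Lemma opnorm_ge0 x : 0 <= opnorm x.
Proof.
apply: sup_upper_bound; first exact: opset_has_sup.
by exists 0; rewrite ?vnorm0 // mul0mx vnorm0.
Qed.

Lemma opnormP x v : vnorm (v *m x) <= opnorm x * vnorm v.
Proof.
have [v0|v0] := eqVneq (vnorm v) 0.
  by rewrite (vnorm_eq0 v0) mul0mx !vnorm0 mulr0.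
have vp : 0 < vnorm v by rewrite lt_def v0 vnorm_ge0.
rewrite -ler_pdivrMr // mulrC -vnormZr ?invr_ge0 ?vnorm_ge0 //.
apply: sup_upper_bound; first exact: opset_has_sup.
exists ((vnorm v)^-1%:C *: v); last by rewrite scalemxAl.
by rewrite vnormZr ?invr_ge0 ?vnorm_ge0 // mulVf.
Qed.

Lemma opnorm_le x (B : R) : 0 <= B -> (forall v, vnorm (v *m x) <= B * vnorm v) ->
  opnorm x <= B.
Proof.
move=> B0 h; apply: ge_sup; first by case: (opset_has_sup x).
by move=> _ [v v1 ->]; apply: le_trans (h v) _; rewrite ler_piMr.
Qed.

Lemma opnorm_le_bound x : opnorm x <= opbound x.
Proof. by apply: opnorm_le; [exact: opbound_ge0 | exact: vnorm_mul_le]. Qed.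

Lemma entry_le_opnorm x i j : `|x i j| <= (opnorm x)%:C.
Proof.
have -> : x i j = (ee i *m x) 0 j by rewrite -rowE mxE.
apply: le_trans (entry_le_vnorm _ _) _; rewrite lecR.
by apply: le_trans (opnormP x _) _; rewrite vnorm_ee mulr1.
Qed.

Definition adjoint x : M := map_mx Num.Def.conjC x^T.

Lemma adjointK : involutive adjoint.
Proof. by move=> x; apply/matrixP => i j; rewrite !mxE; apply: conjCK. Qed.
Lemma adjointD : {morph adjoint : x y / x + y}.
Proof. by move=> x y; apply/matrixP => i j; rewrite !mxE rmorphD. Qed.
Lemma adjointM x y : adjoint (x *m y) = adjoint y *m adjoint x.
Proof. by rewrite /adjoint trmx_mul map_mxM. Qed.

Lemma dot_adjoint u v x : '[u *m x, v] = '[u, v *m adjoint x].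
Proof.
have E : map_mx Num.Def.conjC (adjoint x)^T = x.
  by apply/matrixP => i j; rewrite !mxE; apply: conjCK.
by rewrite !dotmxE [in RHS]trmx_mul [in RHS]map_mxM E mulmxA.
Qed.

#[local] Opaque adjoint opnorm.

Lemma opnormM x y : opnorm (x *m y) <= opnorm x * opnorm y.
Proof.
apply: opnorm_le => [|v]; first by rewrite mulr_ge0 ?opnorm_ge0.
rewrite mulmxA; apply: le_trans (opnormP _ _) _.
by rewrite [leRHS]mulrAC [leRHS]mulrC ler_wpM2l ?opnorm_ge0 // opnormP.
Qed.

(** Cauchy-Schwarz applied to [v] and [v *m (x *m adjoint x)]. Matrices act on row vectors from the
    right, whence this order of the factors. *)
Lemma opnorm_sqr x : opnorm x ^+ 2 <= opnorm (x *m adjoint x).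
Proof.
rewrite -(sqr_sqrtr (opnorm_ge0 (x *m adjoint x))) lerXn2r ?nnegrE ?opnorm_ge0 ?sqrtr_ge0 //.
apply: opnorm_le => [|v]; first exact: sqrtr_ge0.
rewrite -(ler_pXn2r (n := 2)) ?nnegrE ?vnorm_ge0 ?mulr_ge0 ?sqrtr_ge0 ?vnorm_ge0 //.
rewrite exprMn sqr_sqrtr ?opnorm_ge0 //.
have h : `|'[v, v *m (x *m adjoint x)]| <= (vnorm v * vnorm (v *m (x *m adjoint x)))%:C.
  exact: vnorm_CS.
move: h; rewrite mulmxA -dot_adjoint -vnorm_sqr ger0_norm ?ler0c ?sqr_ge0 // lecR -mulmxA => h.
apply: le_trans h _; rewrite expr2 mulrA [leRHS]mulrC ler_wpM2l ?vnorm_ge0 //.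
exact: opnormP.
Qed.

Lemma opnorm_adjoint x : opnorm (adjoint x) = opnorm x.
Proof.
have le z : opnorm z <= opnorm (adjoint z).
  have [->|z0] := eqVneq (opnorm z) 0; first exact: opnorm_ge0.
  have zp : 0 < opnorm z by rewrite lt_def z0 opnorm_ge0.
  have := le_trans (opnorm_sqr z) (opnormM z (adjoint z)).
  by rewrite expr2 ler_pM2l.
have h1 := le x; have h2 := le (adjoint x); rewrite adjointK in h2.
exact: (le_anti (introT andP (conj h2 h1))).
Qed.

Lemma opnorm_cstar x : opnorm (adjoint x *m x) = opnorm x ^+ 2.
Proof.
have h1 := opnormM (adjoint x) x; have h2 := opnorm_sqr (adjoint x).
rewrite opnorm_adjoint -expr2 in h1; rewrite adjointK opnorm_adjoint in h2.
exact: (le_anti (introT andP (conj h1 h2))).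
Qed.

#[local] Transparent adjoint opnorm.

Definition mat2 : Type := M.
HB.instance Definition _ := GRing.PzRing.on mat2.

Definition mat2_inC (c : C) : mat2 := c%:M.

Fact mat2_inCD : {morph mat2_inC : c d / c + d}.
Proof. by move=> c d; apply: raddfD. Qed.
Fact mat2_inCM : {morph mat2_inC : c d / c * d}.
Proof. by move=> c d; apply: scalar_mxM. Qed.
Fact mat2_inC_central c (x : mat2) : mat2_inC c * x = x * mat2_inC c.
Proof. exact: (esym (scalar_mxC c (x : M))). Qed.
Fact mat2_starM (x y : mat2) : adjoint (x * y) = (adjoint y : mat2) * adjoint x.
Proof. exact: adjointM. Qed.
Fact mat2_star_inC c : adjoint (mat2_inC c) = mat2_inC (Num.conj c).
Proof.
apply/matrixP => i j; rewrite !mxE eq_sym; case: eqP => _; rewrite ?mulr1n // !mulr0n.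
exact: conjC0.
Qed.

HB.instance Definition _ := PzRing_isStarAlgebra.Build C mat2
  mat2_inCD mat2_inCM erefl mat2_inC_central
  adjointK adjointD mat2_starM mat2_star_inC.

Definition mat2_cnorm (x : mat2) : C := (opnorm x)%:C.

Fact mat2_cnorm_ge0 x : 0 <= mat2_cnorm x.
Proof. by rewrite /mat2_cnorm ler0c opnorm_ge0. Qed.
Fact mat2_cnorm_eq0 (x : mat2) : mat2_cnorm x = 0 -> x = 0.
Proof.
move=> h; apply/matrixP => i j; have := entry_le_opnorm x i j.
by rewrite -/(mat2_cnorm x) h normr_le0 mxE => /eqP.
Qed.
Fact mat2_cnormD (x y : mat2) : mat2_cnorm (x + y) <= mat2_cnorm x + mat2_cnorm y.
Proof.
rewrite /mat2_cnorm -rmorphD /= lecR; apply: opnorm_le => [|v].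
  by rewrite addr_ge0 ?opnorm_ge0.
by rewrite mulmxDr mulrDl; apply: le_trans (vnormD _ _) _; apply: lerD; apply: opnormP.
Qed.
Fact mat2_cnormM (x y : mat2) : mat2_cnorm (x * y) <= mat2_cnorm x * mat2_cnorm y.
Proof. by rewrite /mat2_cnorm -rmorphM /= lecR; apply: opnormM. Qed.
Lemma opnormZ_le (c : C) x : (opnorm (c *: x))%:C <= `|c| * (opnorm x)%:C.
Proof.
have rE : `|c| = (complex.Re `|c|)%:C by rewrite [in RHS]normc_def normc_def.
rewrite rE -rmorphM /= lecR; apply: opnorm_le => [|v].
  by rewrite mulr_ge0 ?opnorm_ge0 // -ler0c -rE.
rewrite -scalemxAr -lecR vnormZ rmorphM rmorphM /= -rE -mulrA ler_wpM2l //.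
by rewrite -rmorphM /= lecR opnormP.
Qed.
Fact mat2_cnormZ (c : C) (x : mat2) : mat2_cnorm (inC c * x) = `|c| * mat2_cnorm x.
Proof.
have -> : inC c * x = c *: (x : M) by exact: mul_scalar_mx.
apply/eqP; rewrite /mat2_cnorm eq_le opnormZ_le /=.
have [->|c0] := eqVneq c 0; first by rewrite normr0 mul0r ler0c opnorm_ge0.
have := opnormZ_le c^-1 (c *: (x : M)); rewrite scalerA mulVf // scale1r normfV.
by rewrite ler_pdivlMl ?normr_gt0.
Qed.
Fact mat2_cnorm_star (x : mat2) : mat2_cnorm (star x * x) = mat2_cnorm x ^+ 2.
Proof. by rewrite /mat2_cnorm -rmorphXn; congr (_%:C); apply: opnorm_cstar. Qed.

Lemma opnorm_le_entries x : (opnorm x)%:C <= \sum_i \sum_j `|x i j|.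
Proof.
apply: le_trans (_ : (opbound x)%:C <= _); first by rewrite lecR opnorm_le_bound.
rewrite rmorph_sum /=; apply: ler_sum => i _.
have -> : row i x = \sum_j x i j *: ee j.
  by rewrite {1}(row_sum_delta (row i x)); apply: eq_bigr => j _; rewrite mxE.
apply: le_trans (_ : (\sum_j vnorm (x i j *: ee j))%:C <= _).
  by rewrite lecR vnorm_sum.
by rewrite rmorph_sum /=; apply: ler_sum => j _; rewrite vnormZ vnorm_ee mulr1.
Qed.

Fact mat2_cnorm_complete (u : nat -> mat2) :
  (forall e : C, 0 < e -> exists N, forall m n,
     (N <= m)%N -> (N <= n)%N -> mat2_cnorm (u m - u n) < e) ->
  exists l, forall e : C, 0 < e -> exists N, forall n,
     (N <= n)%N -> mat2_cnorm (u n - l) < e.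
Proof.
move=> cu.
have h i j : exists l : C, forall e : R, 0 < e -> exists N, forall n, (N <= n)%N ->
    `|(u n : M) i j - l| < e%:C.
  apply: complex_cauchy_cvg => e e0; have [|N hN] := cu e%:C; first by rewrite ltcR.
  exists N => m n Nm Nn; apply: le_lt_trans (hN _ _ Nm Nn).
  by have := entry_le_opnorm (u m - u n : M) i j; rewrite !mxE.
pose l i j := projT1 (cid (h i j)).
have lP i j e : 0 < e -> exists N, forall n, (N <= n)%N -> `|(u n : M) i j - l i j| < e%:C.
  by rewrite /l; case: cid => /= a; apply.
exists (\matrix_(i, j) l i j) => e e0.
have er : (complex.Re e)%:C = e by rewrite RRe_real // gtr0_real.
move: e0; rewrite -er ltcR; move: (complex.Re e) => {er}e e0.
(* Four entries, each within [e / 5] of its limit, stay below [e] in total. *)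
have e4 : 0 < e / 5 by lra.
pose N i j := projT1 (cid (lP i j _ e4)).
have NP i j n : (N i j <= n)%N -> `|(u n : M) i j - l i j| < (e / 5)%:C.
  by rewrite /N; case: cid => /= a; apply.
exists (\max_i \max_j N i j) => n hn; rewrite /mat2_cnorm.
apply: le_lt_trans (opnorm_le_entries _) _.
apply: le_lt_trans (_ : \sum_(i < 2) \sum_(j < 2) (e / 5)%:C < _).
  apply: ler_sum => i _; apply: ler_sum => j _; rewrite !mxE; apply/ltW/NP.
  apply: leq_trans hn; apply: leq_trans (leq_bigmax i).
  exact: (leq_bigmax (F := fun j => N i j) j).
rewrite !big_ord_recl !big_ord0 !addr0 -!rmorphD /= ltcR; lra.
Qed.

HB.instance Definition _ := isCStarAlgebra.Build C mat2
  mat2_cnorm_ge0 mat2_cnorm_eq0 mat2_cnormD mat2_cnormZ mat2_cnormM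
  mat2_cnorm_star mat2_cnorm_complete.

Definition mat2_cstar : cstarAlgType C := mat2.

End MatrixCStarAlgebra.

(** * Quantum automorphism groups *)

Section StarQMagic.
Variable C : numClosedFieldType.

Lemma inC_nat (A : starAlgType C) n : inC n%:R = n%:R :> A.
Proof. by elim: n => [|n IHn]; rewrite ?inC0 // -natr1 inCD IHn inC1 natr1. Qed.

Lemma star_natregular (A : starAlgType C) : natregular A.
Proof.
move=> x n; rewrite -mulr_natl -inC_nat => h.
have nz : n.+1%:R != 0 :> C by rewrite pnatr_eq0.
by rewrite -[x]mul1r -inC1 -(mulVf nz) inCM -mulrA h mulr0.
Qed.

Lemma star_nat (A : starAlgType C) n : star (n%:R : A) = n%:R.
Proof. by rewrite -inC_nat star_inC conjC_nat. Qed.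

(** Multiplying the intertwining relation by [u x a] on the left and [u y b] on the right leaves
    [u x a * u y b] with coefficient [edge a b] on one side and [edge x y] on the other. *)
Lemma magic_qmagic (A : starAlgType C) (H G : graph) (u : vert H -> vert G -> A) :
  magic_unitary u ->
  (forall i j k, u i j * u i k = if j == k then u i j else 0) ->
  (forall i j k, u j i * u k i = if j == k then u j i else 0) ->
  adj_intertwines u -> qmagic (H := H) (G := G) 1 u.
Proof.
move=> [us uu ur uc] hr hc hi; split=> // x y a b ne.
have := congr1 (fun z => u x a * z * u y b) (hi x b); rewrite /adj.
have -> : u x a * (\sum_z u x z * (edge z b)%:R) = u x a * (edge a b)%:R.
  rewrite mulr_sumr (bigD1 a) //= big1 ?addr0 ?mulrA ?hr ?eqxx // => c ca.
  by rewrite mulrA hr eq_sym (negbTE ca) mul0r.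
rewrite -[X in _ = X]mulrA.
have -> : (\sum_z (edge x z)%:R * u z b) * u y b = (edge x y)%:R * u y b.
  rewrite mulr_suml (bigD1 y) //= big1 ?addr0 -?mulrA ?hc ?eqxx // => z zy.
  by rewrite -mulrA hc (negbTE zy) mulr0.
case: (edge x y) (edge a b) ne => [] [] //= _;
  rewrite ?mulr0 ?mul0r ?mulr1 ?mul1r ?mulr0 // => h; by [exact: h | exact: esym h].
Qed.

Lemma qmagic_adj_intertwines (A : starAlgType C) (H G : graph) (e : A)
    (u : vert H -> vert G -> A) : qmagic e u -> adj_intertwines u.
Proof.
move=> hu y x; rewrite /adj.
transitivity (\sum_(z | edge x z) u y z).
  rewrite [RHS]big_mkcond; apply: eq_bigr => z _; rewrite edge_sym.
  by case: edge; rewrite ?mulr1 ?mulr0.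
rewrite -(qmagic_intertwine hu) big_mkcond; apply: eq_bigr => z _.
by case: edge; rewrite ?mul1r ?mul0r.
Qed.

Lemma qmagic_Qu_rels (G : graph) (A : starAlgType C) (u : vert G * vert G -> A) :
  (forall x y, star (u (x, y)) = u (x, y)) ->
  qmagic (H := G) (G := G) 1 (fun x y => u (x, y)) -> Qu_rels u.
Proof.
move=> us hu; split; last exact: (qmagic_adj_intertwines hu).
split; first split=> [//|i j|i|j].
- exact: (qmagic_idem hu).
- exact: (qmagic_row hu).
- exact: (qmagic_col hu).
- by move=> i j k /negbTE h; rewrite (qmagic_mulr hu) h.
- by move=> i j k /negbTE h; rewrite (qmagic_mulc hu) h.
Qed.

Lemma Qu_qmagic (G : graph) : qmagic (H := G) (G := G) 1 (@Qu_mat C G).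
Proof.
case: (Qu_Ps C G) => hm _ _; apply: magic_qmagic => // [i j k|i j k|].
- exact: (Ps_mulr (Qu_Ps C G)).
- exact: (Ps_mulc (Qu_Ps C G)).
- exact: Qu_intertwines.
Qed.

Lemma iso_qmagic (A : pzRingType) (H G : graph) (f : vert G -> vert H) :
  bijective f -> (forall x y, edge (f x) (f y) = edge x y) ->
  qmagic (H := H) (G := G) (1 : A) (fun y x => (y == f x)%:R).
Proof.
move=> bf hf; have [g fK gK] := bf.
have sum1 (I : finType) (i : I) : \sum_j (j == i)%:R = 1 :> A.
  by rewrite (bigD1 i) //= eqxx big1 ?addr0 // => j /negbTE ->.
split=> [x a b|x y a|x|a|x y a b].
- case: (eqVneq x (f a)) => [->|_]; last by rewrite mul0r; case: ifP.
  by rewrite (bij_eq bf) mul1r; case: eqP.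
- case: (eqVneq x (f a)) => [->|_]; last by rewrite mul0r; case: ifP.
  by rewrite mul1r eq_sym; case: eqP.
- rewrite -[RHS](sum1 _ (g x)); apply: eq_bigr => a _.
  by rewrite [in RHS]eq_sym (can2_eq gK fK).
- exact: sum1.
case: (eqVneq x (f a)) => [->|_]; last by rewrite mul0r.
case: (eqVneq y (f b)) => [->|_]; last by rewrite mulr0.
by rewrite hf eqxx.
Qed.

Lemma star_generated_commute (A : starAlgType C) (S : A -> Prop) :
  star_generated_by S -> (forall a, S a -> star a = a) ->
  (forall a b, S a -> S b -> a * b = b * a) -> forall a b : A, a * b = b * a.
Proof.
move=> gS sS cS.
have h t : S t -> forall x : A, x * t = t * x.
  move=> St; apply: gS => [|x Sx]; last exact: cS.
  by apply: (star_subalg_commute (f := fun x : A => x)) => //; apply: sS.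
move=> a b; move: b a.
apply: gS => [|t St a]; last exact: h.
split=> [c x|x y hx hy z|x y hx hy z|x hx z].
- by rewrite inC_central.
- by rewrite mulrDr mulrDl hx hy.
- by rewrite mulrA hx -mulrA hy mulrA.
- by rewrite -[z]starK -!starM hx.
Qed.

End StarQMagic.

(* Rows in the support of one automorphism hesitate between the identity and   *)
(* that automorphism according to the first projection, rows in the support of *)
(* the other according to the second.                                          *)
Section TwoProjections.
Variables (T : pzRingType) (G : graph) (s : {perm vert G}) (h : vert G -> T).
Hypotheses (s_aut : is_aut s) (h_idem : forall x, h x * h x = h x).
Hypothesis h_s : forall x, h (s x) = h x.
Hypothesis h_edge : forall x y, h x = h y \/ edge (s x) y = edge x y.

Definition hesitant x y : T :=
  (y == x)%:R * h x + (y == s x)%:R * (1 - h x).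

Let h1 x : h x * (1 - h x) = 0. Proof. by rewrite mulrBr mulr1 h_idem subrr. Qed.
Let h2 x : (1 - h x) * h x = 0. Proof. by rewrite mulrBl mul1r h_idem subrr. Qed.
Let h3 x : (1 - h x) * (1 - h x) = 1 - h x.
Proof. by rewrite mulrBr mulr1 h2 subr0. Qed.

Lemma natr_mulAC (b c : bool) (x y : T) :
  b%:R * x * (c%:R * y) = (b && c)%:R * (x * y).
Proof. by case: b c => [] []; rewrite ?mul1r ?mul0r ?mulr0 ?mul0r. Qed.

Lemma natr_mul0 (b : bool) (x : T) : (b -> x = 0) -> b%:R * x = 0.
Proof. by case: b => [->|]; rewrite ?mul0r ?mulr0. Qed.

Lemma hesitantM x y a b : hesitant x a * hesitant y b =
  ((a == x) && (b == y))%:R * (h x * h y) +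
  ((a == x) && (b == s y))%:R * (h x * (1 - h y)) +
  (((a == s x) && (b == y))%:R * ((1 - h x) * h y) +
   ((a == s x) && (b == s y))%:R * ((1 - h x) * (1 - h y))).
Proof.
rewrite /hesitant; move: (1 - h x) (1 - h y) => hx' hy'.
by rewrite mulrDl !mulrDr !natr_mulAC.
Qed.

Lemma sum_natr (x : vert G) (z : T) : \sum_a (a == x)%:R * z = z.
Proof. by rewrite (bigD1 x) //= eqxx mul1r big1 ?addr0 // => a /negbTE ->; rewrite mul0r. Qed.

(** Columns sum to 1 because [h] is constant along the orbits of [s]. In a mixed product, where one
    vertex moves and the other stays, [h_edge] offers either [h x = h y], which gives zero, or an
    unchanged adjacency. *)
Lemma hesitant_qmagic : qmagic (H := G) (G := G) 1 hesitant.
Proof.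
split=> [x a b|x y a|x|a|x y a b ne].
- rewrite hesitantM h_idem h1 h2 h3 !mulr0 addr0 add0r.
  case: (eqVneq a b) => [->|ab]; first by rewrite !andbb.
  have k z : (a == z) && (b == z) = false.
    by apply/negP => /andP[/eqP az /eqP bz]; rewrite az bz eqxx in ab.
  by rewrite !k !mul0r addr0.
- rewrite hesitantM; case: (eqVneq x y) => [<-|xy].
    by rewrite h_idem h1 h2 h3 !mulr0 addr0 add0r !andbb.
  have -> : (a == x) && (a == y) = false.
    by apply/negP => /andP[/eqP ax /eqP ay]; rewrite -ax -ay eqxx in xy.
  have -> : (a == s x) && (a == s y) = false.
    by apply/negP => /andP[/eqP -> /eqP/perm_inj sxy]; rewrite sxy eqxx in xy.
  rewrite !mul0r add0r addr0 !natr_mul0 ?addr0 // => /andP[/eqP E1 /eqP E2].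
    by rewrite -E2 E1 h_s h2.
  by rewrite -E1 E2 h_s h1.
- by rewrite big_split /= !sum_natr addrC subrK.
- rewrite big_split /=.
  under eq_bigr => x _ do rewrite eq_sym.
  rewrite (bigD1 a) //= eqxx mul1r big1 => [|x xa]; last by rewrite (negbTE xa) mul0r.
  rewrite (bigD1 (s^-1 a)%g) //= permKV eqxx mul1r big1 => [|x xa].
    have -> : h (s^-1 a)%g = h a by rewrite -[in RHS](permKV s a) h_s.
    by rewrite !addr0 addrC subrK.
  rewrite (_ : (a == s x) = false) ?mul0r //; apply/negP => /eqP E.
  by rewrite E permK eqxx in xa.
rewrite hesitantM !natr_mul0 ?addr0 // => /andP[/eqP E1 /eqP E2]; move: ne; rewrite E1 E2.
- by rewrite s_aut eqxx.
- by have [->|->] := h_edge x y; [rewrite h2 | rewrite eqxx].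
- rewrite edge_sym [X in _ != X]edge_sym.
  by have [->|->] := h_edge y x; [rewrite h1 | rewrite eqxx].
- by rewrite eqxx.
Qed.

End TwoProjections.

(** * Superrigidity and the three conditions of tractability *)

Section Mat2Representations.
Variable R : realType.
Local Notation C := R[i].
Local Notation T := (mat2_cstar R).

Lemma mat2_one_neq0 : (1 : T) <> 0.
Proof.
move=> /(congr1 (fun x : 'M[C]_2 => x 0 0)); rewrite !mxE eqxx mulr1n => /eqP.
by rewrite oner_eq0.
Qed.

Lemma mat2_inC_inj : injective (inC : C -> T).
Proof.
by move=> c d /(congr1 (fun x : 'M[C]_2 => x 0 0)); rewrite !mxE eqxx !mulr1n.
Qed.

Definition proj1_mx : T := \matrix_(i < 2, j < 2) ((i == 0) && (j == 0))%:R.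
Definition proj2_mx : T := \matrix_(i < 2, j < 2) (2^-1 : C).

Lemma sum_ord2 (F : 'I_2 -> C) : \sum_i F i = F 0 + F 1.
Proof. by rewrite big_ord_recl big_ord1; congr (_ + F _); apply: val_inj. Qed.

Lemma ord2P (i : 'I_2) : i = 0 \/ i = 1.
Proof. by case: i => [[|[|//]] h]; [left | right]; apply: val_inj. Qed.

Lemma proj1_star : star proj1_mx = proj1_mx.
Proof. by apply/matrixP => i j; rewrite !mxE conjC_nat andbC. Qed.
Lemma proj1_idem : proj1_mx * proj1_mx = proj1_mx.
Proof.
apply/matrixP => i j; rewrite !mxE sum_ord2 !mxE /=.
by case: (ord2P i) => ->; case: (ord2P j) => -> /=; rewrite ?mulr0 ?mul0r ?mulr1 ?addr0.
Qed.
Lemma proj2_star : star proj2_mx = proj2_mx.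
Proof.
apply/matrixP => i j; rewrite !mxE; apply: conj_Creal.
by rewrite rpredV realn.
Qed.
Lemma proj2_idem : proj2_mx * proj2_mx = proj2_mx.
Proof.
apply/matrixP => i j; rewrite !mxE sum_ord2 !mxE -mulrDl.
by rewrite -mulr2n -[X in X / _]mulr_natr mulVf ?mul1r ?pnatr_eq0.
Qed.
Lemma proj12_ncomm : proj1_mx * proj2_mx <> proj2_mx * proj1_mx.
Proof.
move=> /(congr1 (fun x : 'M[C]_2 => x 0 1)); rewrite !mxE !sum_ord2 !mxE /=.
rewrite !(mulr0, mul0r, mulr1, mul1r, addr0, add0r, mulr0n, mulr1n) => /eqP.
by rewrite invr_eq0 pnatr_eq0.
Qed.

Lemma iso_quantum_iso (G H : graph) : graph_iso G H -> quantum_iso C G H.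
Proof.
move=> iGH; split; first exact: graph_iso_card.
have [f [bf hf]] := iGH; have hq := iso_qmagic T bf hf.
exists T, (fun y x => (y == f x)%:R); split; first exact: mat2_one_neq0.
  split=> [y x|y x|y|x].
  - exact: star_nat.
  - exact: (qmagic_idem hq).
  - exact: (qmagic_row hq).
  - exact: (qmagic_col hq).
exact: (qmagic_adj_intertwines hq).
Qed.

Lemma co_le5_superrigid : superrigid C (co graphs_le5).
Proof.
move=> G H FG [_ [X [U [X0 mU iU]]]].
have [hr hc] := magic_unitary_orthogonal mU.
have hq := magic_qmagic mU hr hc iU.
apply: graph_iso_sym; apply: (co_le5_quantum_rigid FG (@star_natregular C X) hq).
exact/eqP.
Qed.

Lemma aut_Qu_rels (G : graph) (f : {perm vert G}) : is_aut f ->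
  Qu_rels (fun z : vert G * vert G => (z.1 == f z.2)%:R : T).
Proof.
move=> af; apply: qmagic_Qu_rels => [x y|]; first exact: star_nat.
have bf : bijective f by exists (f^-1)%g; [exact: permK | exact: permKV].
exact: (iso_qmagic T bf af).
Qed.

Lemma is_aut1 (G : graph) : is_aut (1%g : {perm vert G}).
Proof. by move=> x y; rewrite !perm1. Qed.

(** If all elements of the algebra are scalars, the representations attached to [f] and to the
    identity agree. Their values at the entry [(f x, x)] give [f x = x]. *)
Lemma Qu_trivial_aut (G : graph) : qperm_trivial (Qu C G) -> aut_trivial G.
Proof.
move=> [g gK Kg] f af; apply/permP => x; rewrite perm1; apply/eqP.
have h (k : {perm vert G}) (ak : is_aut k) :
    inC (g (Qu_mat C (f x) x)) = (f x == k x)%:R :> T.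
  have [_ _ kC _] := starMorphismP (pres_lift (aut_Qu_rels ak)).
  rewrite -kC Kg.
  exact: (pres_liftE (aut_Qu_rels ak)).
have := h 1%g (@is_aut1 G); rewrite (h f af) eqxx perm1.
by case: eqP => // _ /mat2_one_neq0.
Qed.

Lemma aut_trivial_nschmidt (G : graph) : aut_trivial G -> ~ schmidt G.
Proof. by move=> aG [f [g [af _ f1 _ _]]]; case: f1; apply: aG. Qed.

(** The entries commute, so a nonzero off-diagonal one would yield a nontrivial automorphism: the
    fundamental matrix is the identity and the algebra consists of scalars. The representation
    attached to the identity shows that it is not zero. *)
Lemma aut_trivial_Qu (G : graph) : co graphs_le5 G -> aut_trivial G ->
  qperm_trivial (Qu C G).
Proof.
move=> FG aG; have hq := Qu_qmagic C G.
have uC := co_le5_commute FG (aut_trivial_nschmidt aG) (@star_natregular C _) hq.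
have u0 (x a : vert G) : a != x -> Qu_mat C x a = 0.
  have [//|ne] := eqVneq (Qu_mat C x a : Qu_alg C G) 0.
  have [f [bf hf fx]] := qmagic_commutative_iso hq uC ne.
  have /permP/(_ x) : perm (bij_inj bf) = 1%g by apply: aG => y z; rewrite !permE hf.
  by rewrite permE perm1 fx => ->; rewrite eqxx.
have u1 (x : vert G) : Qu_mat C x x = 1.
  rewrite -(qmagic_row hq x) (bigD1 x) //= big1 ?addr0 // => a; exact: u0.
have surj (z : Qu_alg C G) : exists c, inC c = z.
  move: z; apply: Qu_generates => [|_ [x [a ->]]]; last first.
    have [->|/u0 ->] := eqVneq a x; first by exists 1; rewrite u1 inC1.
    by exists 0; rewrite inC0.
  split=> [c|_ _ [c <-] [d <-]|_ _ [c <-] [d <-]|_ [c <-]].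
  - by exists c.
  - by exists (c + d); rewrite inCD.
  - by exists (c * d); rewrite inCM.
  - by exists (Num.conj c); rewrite star_inC.
have inj : injective (inC : C -> Qu_alg C G).
  have [_ _ kC _] := starMorphismP (pres_lift (aut_Qu_rels (@is_aut1 G))).
  move=> c d /(congr1 (pres_lift (aut_Qu_rels (@is_aut1 G)))).
  by rewrite !kC => /mat2_inC_inj.
by exists (fun z => projT1 (cid (surj z))) => [c|z]; case: cid => //= d /inj.
Qed.

Lemma quantum_symmetry_schmidt (G : graph) : co graphs_le5 G ->
  quantum_symmetry C G -> schmidt G.
Proof.
move=> FG [B [iota [env nC]]]; apply: contrapT => nS; apply: nC.
have uC := co_le5_commute FG nS (@star_natregular C _) (Qu_qmagic C G).
apply: (envelope_commutative env (Qu_generates (G := G))).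
  move=> _ [x [y ->]]; split; first exact: (Ps_star (Qu_Ps C G)).
  by rewrite (Ps_mulr (Qu_Ps C G)) eqxx.
apply: star_generated_commute (Qu_generates (G := G)) _ _.
  by move=> _ [x [y ->]]; apply: (Ps_star (Qu_Ps C G)).
by move=> _ _ [x [y ->]] [z [t ->]]; apply: uC.
Qed.

Lemma Qu_bounded (G : graph) : bounded_alg (Qu_alg C G).
Proof.
apply: Qu_generates => [|_ [x [y ->]]]; last first.
  exists 1 => X f; apply: nm_proj; first by rewrite -starmorph_star (Ps_star (Qu_Ps C G)).
  by rewrite -rmorphM (Ps_mulr (Qu_Ps C G)) eqxx.
split=> [c|a b [M hM] [N hN]|a b [M hM] [N hN]|a [M hM]].
- exists (complex.Re `|c|) => X f; rewrite starmorph_inC -[inC c]mulr1 nmCZ.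
  by rewrite ler_piMr ?nm1 // -ler0c RRe_real ?normr_real.
- exists (M + N) => X f; rewrite raddfD /=; apply: le_trans (nmD _ _) _.
  by rewrite lerD.
- exists (M * N) => X f; rewrite rmorphM /=; apply: le_trans (nmM _ _) _.
  by rewrite ler_pM ?nm_ge0.
- by exists M => X f; rewrite starmorph_star nm_star.
Qed.

Lemma schmidt_quantum_symmetry (G : graph) : schmidt G -> quantum_symmetry C G.
Proof.
move=> [f [g [af ag f1 g1 dfg]]].
have dis x : f x = x \/ g x = x.
  move: dfg; rewrite disjoints_subset => /fintype.subsetP/(_ x); rewrite !inE.
  have [->|_ /(_ isT)] := eqVneq (f x) x; first by left.
  by rewrite negbK => /eqP; right.
have ff x : f (f x) = f x -> f x = x by move/perm_inj.
have gg x : g (g x) = g x -> g x = x by move/perm_inj.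
pose s := (f * g)%g.
have sE x : s x = g (f x) by rewrite permM.
have sf x : f x <> x -> s x = f x.
  by move=> fx; rewrite sE; have [/ff//|//] := dis (f x).
have sg x : f x = x -> s x = g x by move=> fx; rewrite sE fx.
(* Two noncommuting projections, one for each support; elsewhere [s] is the identity and the value 1
   leaves the vertex fixed. *)
pose h x : T := if f x != x then proj1_mx else if g x != x then proj2_mx else 1.
have h_idem x : h x * h x = h x.
  by rewrite /h; do 2?case: ifP => _; rewrite ?proj1_idem ?proj2_idem ?mulr1.
have h_star x : star (h x) = h x.
  by rewrite /h; do 2?case: ifP => _; rewrite ?proj1_star ?proj2_star ?star1.
have h_s x : h (s x) = h x.
  rewrite /h; have [fx|/eqP fx] := eqVneq (f x) x; last first.
    by rewrite sf //; case: eqP => // /ff.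
  have [gx|/eqP gx] := eqVneq (g x) x; first by rewrite sg // !gx fx !eqxx.
  have fgx : f (g x) = g x by have [//|/gg] := dis (g x).
  by rewrite sg // fgx !eqxx /=; case: eqP => [/gg|].
have s_aut : is_aut s by move=> x y; rewrite !sE ag af.
(* When [h x] and [h y] differ, [x] is fixed by [s], or [y] is fixed by whichever of [f] and [g]
   moves [x]. *)
have h_edge x y : h x = h y \/ edge (s x) y = edge x y.
  have [fx|/eqP fx] := eqVneq (f x) x; last first.
    have [fy|/eqP fy] := eqVneq (f y) y; first by right; rewrite sf // -{1}fy af.
    by left; rewrite /h; move/eqP: fx => ->; move/eqP: fy => ->.
  have [gx|/eqP gx] := eqVneq (g x) x; first by right; rewrite sg // gx.
  have [gy|/eqP gy] := eqVneq (g y) y; first by right; rewrite sg // -{1}gy ag.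
  have fy : f y = y by have [//|/gy] := dis y.
  by left; rewrite /h fx fy !eqxx /=; move/eqP: gx => ->; move/eqP: gy => ->.
have hq := hesitant_qmagic s_aut h_idem h_s h_edge.
have rU : Qu_rels (fun z : vert G * vert G => hesitant s h z.1 z.2 : T).
  apply: qmagic_Qu_rels hq => x y /=.
  have starb (b : bool) (z : T) : star z = z -> star (b%:R * z) = b%:R * z.
    by move=> zs; case: b; rewrite ?mul1r ?mul0r ?star0.
  by rewrite /hesitant starD !starb ?h_star // starD starN star1 h_star.
(* The representation factors through the envelope, so if the envelope were commutative the diagonal
   entries at a vertex moved by [f] and at one moved by [g], namely the two projections, would
   commute. *)
have [k kE] := (envelope_universal (Qu_bounded (G := G)) (pres_lift rU)).1.
exists (envelope (Qu_bounded (G := G))), (star_morphism (comp_cst_hom (Qu_bounded (G := G)))).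
split; first exact: envelope_universal.
have [x fx] : exists x, f x != x.
  apply: contrapT => h0; apply: f1; apply/permP => x; rewrite perm1.
  by apply/eqP/negPn/negP => fx; apply: h0; exists x.
have [y gy] : exists y, g y != y.
  apply: contrapT => h0; apply: g1; apply/permP => y; rewrite perm1.
  by apply/eqP/negPn/negP => gy; apply: h0; exists y.
have fy : f y = y by have [//|/eqP] := dis y; rewrite (negbTE gy).
have UE z : s z != z -> hesitant s h z z = h z.
  by move=> sz; rewrite /hesitant eqxx mul1r eq_sym (negbTE sz) mul0r addr0.
move=> Bc; apply: proj12_ncomm.
pose io := star_morphism (comp_cst_hom (Qu_bounded (G := G))).
have := congr1 k (Bc (io (Qu_mat C x x)) (io (Qu_mat C y y))).
have kU z : k (io (Qu_mat C z z)) = hesitant s h z z.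
  by rewrite [LHS](kE (Qu_mat C z z)); apply: (pres_liftE rU).
have [_ kM _ _] := starMorphismP k.
rewrite !kM !kU !UE; first by rewrite /h fx fy eqxx /= gy.
  by rewrite sg //.
by rewrite sf //; apply/eqP.
Qed.

End Mat2Representations.

(** * Isomorphisms of quantum permutation groups *)

Section QpermIso.
Variable C : numClosedFieldType.
Implicit Types (Q : qperm C) (G H K : graph).

Lemma star_hom_ext (A B : starAlgType C) (S : A -> Prop) (f g : A -> B) :
  star_generated_by S -> star_hom f -> star_hom g ->
  (forall a, S a -> f a = g a) -> f =1 g.
Proof.
move=> gS [fD fM fC fS] [gD gM gC gSt] fg x; apply: (gS (fun a => f a = g a)) => //.
split=> [c|a b ha hb|a b ha hb|a ha].
- by rewrite fC gC.
- by rewrite fD gD ha hb.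
- by rewrite fM gM ha hb.
- by rewrite fS gSt ha.
Qed.

Lemma tensor_generated (A B : starAlgType C) :
  star_generated_by (fun x : tens A B => exists a b, x = tensor a b).
Proof. by move=> P hP h; apply: pres_generated => // _ [[a b] ->]; apply: h; exists a, b. Qed.

Lemma tens_map_comp (A B D B' E F F' : starAlgType C) (g : A -> B) (f : B -> D)
    (g' : A -> B') (f' : B' -> D) (h : A -> F) (k : F -> E) (h' : A -> F') (k' : F' -> E)
    (hg : star_hom g) (hf : star_hom f) (hg' : star_hom g') (hf' : star_hom f')
    (hh : star_hom h) (hk : star_hom k) (hh' : star_hom h') (hk' : star_hom k') x :
  (forall a, f (g a) = f' (g' a)) -> (forall a, k (h a) = k' (h' a)) ->
  tens_map hf hk (tens_map hg hh x) = tens_map hf' hk' (tens_map hg' hh' x).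
Proof.
move=> E1 E2.
apply: (star_hom_ext (f := tens_map hf hk \o tens_map hg hh)
  (g := tens_map hf' hk' \o tens_map hg' hh') (@tensor_generated A A)).
- by apply: star_hom_comp; apply: starMorphismP.
- by apply: star_hom_comp; apply: starMorphismP.
by move=> _ [a [b ->]] /=; rewrite !tens_mapE E1 E2.
Qed.

Lemma tens_map_id (A : starAlgType C) (f : A -> A) (hf : star_hom f) :
  (forall a, f a = a) -> tens_map hf hf =1 id.
Proof.
move=> E; apply: (star_hom_ext (@tensor_generated A A)).
- exact: starMorphismP.
- by [].
by move=> _ [a [b ->]] /=; rewrite !tens_mapE !E.
Qed.

Lemma star_hom_id (A : starAlgType C) : star_hom (fun a : A => a).
Proof. by []. Qed.

Lemma qperm_iso_refl Q : qperm_iso Q Q.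
Proof.
exists (star_morphism (star_hom_id (qalg Q))); split; first by exists id.
by move=> x; rewrite tens_map_id.
Qed.

Lemma qperm_iso_intro Q Q' (S : qalg Q -> Prop) (S' : qalg Q' -> Prop)
    (f : starMorphism (qalg Q) (qalg Q')) (g : starMorphism (qalg Q') (qalg Q)) :
  star_generated_by S -> star_generated_by S' ->
  (forall a, S a -> g (f a) = a) -> (forall a, S' a -> f (g a) = a) ->
  (forall a, S a -> qcomult Q' (f a) =
     tens_map (starMorphismP f) (starMorphismP f) (qcomult Q a)) ->
  qperm_iso Q Q'.
Proof.
move=> gS gS' gf fg hD; have hf := starMorphismP f; have hg := starMorphismP g.
exists f; split.
  exists g.
    exact: (star_hom_ext gS (star_hom_comp hg hf) (star_hom_id _) gf).
  exact: (star_hom_ext gS' (star_hom_comp hf hg) (star_hom_id _) fg).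
apply: (star_hom_ext gS _ _ hD); apply: star_hom_comp => //; exact: starMorphismP.
Qed.

Lemma qperm_iso_sym Q Q' : qperm_iso Q Q' -> qperm_iso Q' Q.
Proof.
move=> [f [[g fK gK] hD]].
have [fD fM fC fS] := starMorphismP f.
have hg : star_hom g.
  split=> [x y|x y|c|x]; apply: (can_inj fK); rewrite ?(fD, fM, fC, fS) !gK //.
exists (star_morphism hg); split; first by exists f.
move=> y; rewrite star_morphismE -{2}(gK y) hD.
have E := tens_map_comp (starMorphismP f) (starMorphismP (star_morphism hg))
  (star_hom_id _) (star_hom_id _) (starMorphismP f) (starMorphismP (star_morphism hg))
  (star_hom_id _) (star_hom_id _) (qcomult Q (g y)) fK fK.
by rewrite [RHS]E !tens_map_id.
Qed.

Lemma qperm_iso_trans Q Q' Q'' : qperm_iso Q Q' -> qperm_iso Q' Q'' -> qperm_iso Q Q''.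
Proof.
move=> [f [bf hf]] [g [bg hg]].
have hgf := star_hom_comp (starMorphismP g) (starMorphismP f).
exists (star_morphism hgf); split; first exact: bij_comp bg bf.
move=> x; rewrite star_morphismE /= hg hf.
have E := tens_map_comp (starMorphismP f) (starMorphismP g)
  (starMorphismP (star_morphism hgf)) (star_hom_id _) (starMorphismP f) (starMorphismP g)
  (starMorphismP (star_morphism hgf)) (star_hom_id _) (qcomult Q x) (fun=> erefl) (fun=> erefl).
by rewrite [LHS]E tens_map_id.
Qed.

(** The comultiplications agree automatically: on both sides they are matrix multiplication of the
    coefficients, which [phi] merely relabels. *)
Lemma Qu_iso_intro G Q (phi : vert G -> qidx Q) (g : starMorphism (qalg Q) (Qu_alg C G)) :
  bijective phi -> Qu_rels (fun z => qmat (phi z.1) (phi z.2)) ->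
  (forall x y, g (qmat (phi x) (phi y)) = Qu_mat C x y) -> qperm_iso (Qu C G) Q.
Proof.
move=> [psi phiK psiK] rels hg; pose f := pres_lift rels : starMorphism (qalg (Qu C G)) (qalg Q).
have fE x y : f (Qu_mat C x y) = qmat (phi x) (phi y) := pres_liftE rels (x, y).
apply: (@qperm_iso_intro (Qu C G) Q _ _ f g (qmat_generates (q := Qu C G)) (qmat_generates (q := Q))).
- by move=> _ [x [y ->]]; rewrite fE hg.
- by move=> _ [x [y ->]]; rewrite -(psiK x) -(psiK y) hg fE.
move=> _ [x [y ->]]; rewrite fE qcomultE Qu_comultE rmorph_sum /=.
rewrite (reindex phi) /=; last by apply: onW_bij; exists psi.
by apply: eq_bigr => z _; rewrite tens_mapE !fE.
Qed.

Lemma Qu_mat_star G (x y : vert G) : star (Qu_mat C x y) = Qu_mat C x y.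
Proof. exact: (Ps_star (Qu_Ps C G)). Qed.

Lemma Qu_graph_iso G H : graph_iso G H -> qperm_iso (Qu C G) (Qu C H).
Proof.
move=> [f [[g fK gK] hf]].
have rG : Qu_rels (fun z : vert G * vert G => Qu_mat C (f z.1) (f z.2)).
  apply: qmagic_Qu_rels => [x y|]; first exact: Qu_mat_star.
  have bf : bijective f by exists g.
  exact: (qmagic_tr (qmagic_relabelr (qmagic_tr (qmagic_relabelr (Qu_qmagic C H) bf hf)) bf hf)).
have bg : bijective g by exists f.
have hg x y : edge (g x) (g y) = edge x y by rewrite -hf !gK.
have rH : Qu_rels (fun z : vert H * vert H => Qu_mat C (g z.1) (g z.2)).
  apply: qmagic_Qu_rels => [x y|]; first exact: Qu_mat_star.
  exact: (qmagic_tr (qmagic_relabelr (qmagic_tr (qmagic_relabelr (Qu_qmagic C G) bg hg)) bg hg)).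
apply: (Qu_iso_intro (phi := f : vert G -> qidx (Qu C H)) (g := pres_lift rH)) => //.
  by exists g.
by move=> x y; rewrite [LHS](pres_liftE rH) /= !fK.
Qed.

Lemma Qu_compl G : qperm_iso (Qu C G) (Qu C (graph_compl G)).
Proof.
have rG : Qu_rels (G := graph_compl G) (fun z : vert G * vert G => Qu_mat C z.1 z.2).
  apply: (qmagic_Qu_rels (G := graph_compl G)) => [x y|]; first exact: Qu_mat_star.
  exact: qmagic_compl (Qu_qmagic C G).
have rH : Qu_rels (fun z : vert G * vert G => @Qu_mat C (graph_compl G) z.1 z.2).
  apply: qmagic_Qu_rels => [x y|]; first exact: (@Qu_mat_star (graph_compl G)).
  have h := qmagic_compl (Qu_qmagic C (graph_compl G)).
  split; [exact: (qmagic_mulr h) | exact: (qmagic_mulc h) | exact: (qmagic_row h) |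
          exact: (qmagic_col h) |].
  have e2 (x y : vert G) : @edge (graph_compl (graph_compl G)) x y = @edge G x y.
    by rewrite /= /compl_edge /= /compl_edge; case: eqP => [->|_] /=; rewrite ?edge_irr ?negbK.
  by move=> x y a b ne; apply: (qmagic_edge h); rewrite (e2 x y) (e2 a b).
apply: (Qu_iso_intro (phi := id : vert G -> qidx (Qu C (graph_compl G)))
  (g := pres_lift rG)) => //; first by exists id.
by move=> x y; rewrite [LHS](pres_liftE rG).
Qed.

End QpermIso.

(** * Free products *)

Section FreeProductIso.
Variable C : numClosedFieldType.
Implicit Types (Q : qperm C) (G H K : graph).

Lemma qfree_comult_inl Q1 Q2 (a : qalg Q1) : qcomult (qfree Q1 Q2) (fp_inl (qalg Q2) a) =
  tens_map (@fp_inl_hom C (qalg Q1) (qalg Q2)) (@fp_inl_hom C (qalg Q1) (qalg Q2)) (qcomult Q1 a).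
Proof. exact: (pres_liftE (qfree_comult_rels Q1 Q2) (inl a)). Qed.

Lemma qfree_comult_inr Q1 Q2 (b : qalg Q2) : qcomult (qfree Q1 Q2) (fp_inr (qalg Q1) b) =
  tens_map (@fp_inr_hom C (qalg Q1) (qalg Q2)) (@fp_inr_hom C (qalg Q1) (qalg Q2)) (qcomult Q2 b).
Proof. exact: (pres_liftE (qfree_comult_rels Q1 Q2) (inr b)). Qed.

Section Freeprod2Map.
Variables (A B T : starAlgType C) (f : A -> T) (g : B -> T).
Hypotheses (hf : star_hom f) (hg : star_hom g).

Definition freeprod2_fun (x : (A + B)%type) : T :=
  match x with inl a => f a | inr b => g b end.

Fact freeprod2_fun_rels : freeprod2_rels freeprod2_fun.
Proof. by split. Qed.

Definition freeprod2_lift : starMorphism (freeprod2 A B) T := pres_lift freeprod2_fun_rels.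

Lemma freeprod2_lift_inl a : freeprod2_lift (fp_inl B a) = f a.
Proof. exact: (pres_liftE freeprod2_fun_rels (inl a)). Qed.
Lemma freeprod2_lift_inr b : freeprod2_lift (fp_inr A b) = g b.
Proof. exact: (pres_liftE freeprod2_fun_rels (inr b)). Qed.
End Freeprod2Map.

Lemma qfree_iso Q1 Q2 Q1' Q2' : qperm_iso Q1 Q1' -> qperm_iso Q2 Q2' ->
  qperm_iso (qfree Q1 Q2) (qfree Q1' Q2').
Proof.
move=> [f1 [[g1 fK1 gK1] D1]] [f2 [[g2 fK2 gK2] D2]].
have [k1 [[k1' kK1 kK1'] _]] := qperm_iso_sym (ex_intro _ f1 (conj (Bijective fK1 gK1) D1)).
have inv (A B : starAlgType C) (f : starMorphism A B) (g : B -> A) :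
    cancel f g -> cancel g f -> star_hom g.
  move=> fK gK; have [fD fM fC fS] := starMorphismP f.
  by split=> [x y|x y|c|x]; apply: (can_inj fK); rewrite ?(fD, fM, fC, fS) !gK.
have hg1 := inv _ _ _ _ fK1 gK1; have hg2 := inv _ _ _ _ fK2 gK2.
have hF1 := star_hom_comp (@fp_inl_hom C (qalg Q1') (qalg Q2')) (starMorphismP f1).
have hF2 := star_hom_comp (@fp_inr_hom C (qalg Q1') (qalg Q2')) (starMorphismP f2).
have hG1 := star_hom_comp (@fp_inl_hom C (qalg Q1) (qalg Q2)) hg1.
have hG2 := star_hom_comp (@fp_inr_hom C (qalg Q1) (qalg Q2)) hg2.
pose F := freeprod2_lift hF1 hF2; pose G := freeprod2_lift hG1 hG2.
apply: (@qperm_iso_intro C (qfree Q1 Q2) (qfree Q1' Q2') _ _ F G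
  (@freeprod2_generated C _ _) (@freeprod2_generated C _ _)).
- by move=> _ [[a ->]|[b ->]]; rewrite ?freeprod2_lift_inl ?freeprod2_lift_inr /=
    ?freeprod2_lift_inl ?freeprod2_lift_inr /= ?fK1 ?fK2.
- by move=> _ [[a ->]|[b ->]]; rewrite ?freeprod2_lift_inl ?freeprod2_lift_inr /=
    ?freeprod2_lift_inl ?freeprod2_lift_inr /= ?gK1 ?gK2.
move=> _ [[a ->]|[b ->]].
  rewrite freeprod2_lift_inl [LHS]qfree_comult_inl D1 [in RHS]qfree_comult_inl.
  apply: tens_map_comp => c; by rewrite freeprod2_lift_inl.
rewrite freeprod2_lift_inr [LHS]qfree_comult_inr D2 [in RHS]qfree_comult_inr.
apply: tens_map_comp => c; by rewrite freeprod2_lift_inr.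
Qed.

(** The free product with the scalars changes nothing. The hypotheses say that every element of
    [qalg Q0] is a scalar and that [qalg Q0] maps to any algebra. *)
Lemma qfree_trivialr Q0 Q : (forall a : qalg Q0, exists c, a = inC c) ->
  (forall T : starAlgType C, exists f : qalg Q0 -> T, star_hom f) ->
  qperm_iso Q (qfree Q Q0).
Proof.
move=> triv /(_ (qalg Q))[e he].
pose F := star_morphism (@fp_inl_hom C (qalg Q) (qalg Q0)).
pose G := freeprod2_lift (star_hom_id (qalg Q)) he.
have GF b : G (F b) = b by exact: freeprod2_lift_inl.
apply: (@qperm_iso_intro C Q (qfree Q Q0) (fun _ => True) _ F G _ (@freeprod2_generated C _ _)).
- by move=> P _ h x; apply: h.
- by move=> a _; apply: GF.
- have [_ _ FC _] := starMorphismP F; have [_ _ GC _] := starMorphismP G.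
  move=> _ [[a ->]|[b ->]]; first by rewrite freeprod2_lift_inl.
  have [c ->] := triv b; have [_ _ iC _] := @fp_inr_hom C (qalg Q) (qalg Q0).
  by rewrite iC GC FC.
by move=> b _; rewrite [LHS]qfree_comult_inl.
Qed.

Lemma Qu_one_vertex G : #|vert G| = 1%N ->
  (forall a : qalg (Qu C G), exists c, a = inC c) /\
  (forall T : starAlgType C, exists f : qalg (Qu C G) -> T, star_hom f).
Proof.
move=> c1; have [x0 x0P] : exists x0 : vert G, forall x, x = x0.
  by have /fintype1P[x0 h] := introT eqP c1; exists x0.
have sum1 (A : starAlgType C) (F : vert G -> A) : \sum_x F x = F x0.
  by rewrite (bigD1 x0) //= big1 ?addr0 // => x; rewrite (x0P x) eqxx.
split.
  apply: (qmat_generates (q := Qu C G)) => [|_ [x [y ->]]]; last first.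
    exists 1; rewrite (x0P x) (x0P y) inC1 -(qmagic_row (Qu_qmagic C G) x0).
    by rewrite sum1.
  split=> [c|_ _ [c ->] [d ->]|_ _ [c ->] [d ->]|_ [c ->]].
  - by exists c.
  - by exists (c + d); rewrite inCD.
  - by exists (c * d); rewrite inCM.
  - by exists (Num.conj c); rewrite star_inC.
move=> T; have rels : Qu_rels (fun _ : vert G * vert G => 1 : T).
  apply: qmagic_Qu_rels => [x y|]; first exact: star1.
  split=> [x a b|x y a|x|a|x y a b]; rewrite ?mulr1 ?sum1 //.
  - by rewrite (x0P a) (x0P b) eqxx.
  - by rewrite (x0P x) (x0P y) eqxx.
  - by rewrite (x0P x) (x0P y) (x0P a) (x0P b) !edge_irr.
by exists (pres_lift rels); apply: starMorphismP.
Qed.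

(** Once the mixed blocks vanish, the relations on the fundamental matrix split into those of
    [Qu C G] and of [Qu C H], with none between the two: this is the presentation of the free
    product. *)
Lemma Qu_union G H :
  (forall (x : vert G) (y : vert H), @Qu_mat C (graph_union G H) (inl x) (inr y) = 0) ->
  (forall (x : vert G) (y : vert H), @Qu_mat C (graph_union G H) (inr y) (inl x) = 0) ->
  qperm_iso (Qu C (graph_union G H)) (qfree (Qu C G) (Qu C H)).
Proof.
move=> lr0 rl0; pose U := @Qu_mat C (graph_union G H).
have hU : qmagic (H := graph_union G H) (G := graph_union G H) 1 U := Qu_qmagic C _.
have hl : Qu_rels (fun z : vert G * vert G => U (inl z.1) (inl z.2)).
  apply: qmagic_Qu_rels => [x y|]; first exact: Qu_mat_star.
  split=> [x a b|x y a|x|a|x y a b h].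
  - exact: (qmagic_mulr hU).
  - exact: (qmagic_mulc hU).
  - rewrite -(qmagic_row hU (inl x)) [RHS]big_sumType /= [X in _ + X]big1 ?addr0 //.
  - rewrite -(qmagic_col hU (inl a)) [RHS]big_sumType /= [X in _ + X]big1 ?addr0 //.
  - exact: (qmagic_edge hU).
have hr : Qu_rels (fun z : vert H * vert H => U (inr z.1) (inr z.2)).
  apply: qmagic_Qu_rels => [x y|]; first exact: Qu_mat_star.
  split=> [x a b|x y a|x|a|x y a b h].
  - exact: (qmagic_mulr hU).
  - exact: (qmagic_mulc hU).
  - rewrite -(qmagic_row hU (inr x)) [RHS]big_sumType /= [X in X + _]big1 ?add0r //.
  - rewrite -(qmagic_col hU (inr a)) [RHS]big_sumType /= [X in X + _]big1 ?add0r //.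
  - exact: (qmagic_edge hU).
pose g := freeprod2_lift (starMorphismP (pres_lift hl)) (starMorphismP (pres_lift hr)).
apply: (@Qu_iso_intro C (graph_union G H) (qfree (Qu C G) (Qu C H)) id g).
- by exists id.
- have hp := qfree_Ps (Qu C G) (Qu C H).
  have [fD fM fC _] := @fp_inl_hom C (Qu_alg C G) (Qu_alg C H).
  have [gD gM gC _] := @fp_inr_hom C (Qu_alg C G) (Qu_alg C H).
  have f0 : fp_inl (Qu_alg C H) (0 : Qu_alg C G) = 0 by rewrite -(inC0 (Qu_alg C G)) fC inC0.
  have g0 : fp_inr (Qu_alg C G) (0 : Qu_alg C H) = 0 by rewrite -(inC0 (Qu_alg C H)) gC inC0.
  apply: (qmagic_Qu_rels (G := graph_union G H)) => [x y|]; first exact: (Ps_star hp).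
  split=> [x a b|x y a|x|a|].
  + exact: (Ps_mulr hp).
  + exact: (Ps_mulc hp).
  + exact: (Ps_row hp).
  + exact: (Ps_col hp).
  case=> x [] y [] a [] b h //=; rewrite ?mul0r ?mulr0 //.
    by rewrite -fM (qmagic_edge (Qu_qmagic C G)).
  by rewrite -gM (qmagic_edge (Qu_qmagic C H)).
case=> x [] y /=.
- by rewrite [LHS]freeprod2_lift_inl (pres_liftE hl).
- have [_ _ gC _] := starMorphismP g.
  by rewrite -(inC0 (freeprod2 _ _)) gC inC0 lr0.
- have [_ _ gC _] := starMorphismP g.
  by rewrite -(inC0 (freeprod2 _ _)) gC inC0 rl0.
- by rewrite [LHS]freeprod2_lift_inr (pres_liftE hr).
Qed.

End FreeProductIso.

(** * Wreath products *)

Section WreathIso.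
Variable C : numClosedFieldType.
Implicit Types (Q : qperm C).

Lemma wreath_generated Q n (n_gt0 : (0 < n)%N) :
  star_generated_by (fun x : qalg (qwreath Q n_gt0) =>
    (exists i a, x = @wreath_nu C Q n n_gt0 i a) \/ (exists s, x = @wreath_S C Q n n_gt0 s)).
Proof.
move=> P hP h; apply: (wreath_generates (n_gt0 := n_gt0)) => // _ [x [y ->]].
have [_ _ PM _] := hP; apply: PM; apply: h; first by left; do 2!eexists.
by right; eexists.
Qed.

Lemma qwreath_iso Q Q' n (n_gt0 : (0 < n)%N) : qperm_iso Q Q' ->
  qperm_iso (qwreath Q n_gt0) (qwreath Q' n_gt0).
Proof.
move=> [f [[g fK gK] D]].
have hf := starMorphismP f; have hg : star_hom g.
  have [fD fM fC fS] := hf.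
  by split=> [x y|x y|c|x]; apply: (can_inj fK); rewrite ?(fD, fM, fC, fS) !gK.
pose F := wreath_lift (fun i => star_hom_comp (wreath_nu_hom Q' n_gt0 i) hf)
  (wreath_S_hom Q' n_gt0) (fun i j a => @wreath_comm C Q' n n_gt0 i j (f a)).
pose G := wreath_lift (fun i => star_hom_comp (wreath_nu_hom Q n_gt0 i) hg)
  (wreath_S_hom Q n_gt0) (fun i j a => @wreath_comm C Q n n_gt0 i j (g a)).
have Fnu i a : F (wreath_nu n_gt0 i a) = wreath_nu n_gt0 i (f a) by exact: wreath_lift_nu.
have Gnu i a : G (wreath_nu n_gt0 i a) = wreath_nu n_gt0 i (g a) by exact: wreath_lift_nu.
have FS s : F (wreath_S Q s) = wreath_S Q' s by exact: wreath_lift_S.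
have GS s : G (wreath_S Q' s) = wreath_S Q s by exact: wreath_lift_S.
apply: (@qperm_iso_intro C (qwreath Q n_gt0) (qwreath Q' n_gt0) _ _ F G
  (@wreath_generated Q n n_gt0) (@wreath_generated Q' n n_gt0)).
- by move=> _ [[i [a ->]]|[s ->]]; rewrite ?Fnu ?FS ?Gnu ?GS ?fK.
- by move=> _ [[i [a ->]]|[s ->]]; rewrite ?Gnu ?GS ?Fnu ?FS ?gK.
move=> _ [[i [a ->]]|[s ->]].
  rewrite Fnu [LHS]wreath_lift_nu [in RHS]wreath_lift_nu /wreath_comult_nu rmorph_sum.
  have [_ FFM _ _] := starMorphismP (tens_map (starMorphismP F) (starMorphismP F)).
  apply: eq_bigr => r _; rewrite [RHS]FFM D; congr (_ * _); last first.
    by rewrite [RHS]tens_mapE FS (star_hom1 (starMorphismP F)).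
  by apply: tens_map_comp => b; rewrite Fnu.
rewrite FS [LHS]wreath_lift_S [in RHS]wreath_lift_S /=.
have E := tens_map_comp (wreath_S_hom Q n_gt0) (starMorphismP F) (wreath_S_hom Q' n_gt0)
  (star_hom_id _) (wreath_S_hom Q n_gt0) (starMorphismP F) (wreath_S_hom Q' n_gt0)
  (star_hom_id _) (qcomult (Splus C n_gt0) s) FS FS.
by rewrite [RHS]E tens_map_id.
Qed.

End WreathIso.

(** * Disjoint copies of a graph *)

Section Copies.
Variables (K : graph) (n : nat).
Hypothesis n_gt0 : (0 < n)%N.

Definition copies_edge : rel ('I_n * vert K) := fun a b => (a.1 == b.1) && edge a.2 b.2.
Fact copies_edge_sym : symmetric copies_edge.
Proof. by move=> a b; rewrite /copies_edge eq_sym edge_sym. Qed.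
Fact copies_edge_irr : irreflexive copies_edge.
Proof. by move=> a; rewrite /copies_edge edge_irr andbF. Qed.
Fact copies_vert_gt0 : (0 < #|{: 'I_n * vert K}|)%N.
Proof. by rewrite card_prod card_ord muln_gt0 n_gt0 vert_gt0. Qed.

Definition copies : graph := Graph copies_edge_sym copies_edge_irr copies_vert_gt0.

Lemma copies_cn_eq (a b : vert copies) : cn a b -> a.1 = b.1.
Proof.
move=> /connectP[p]; elim: p a => [|c p IHp] a /=; first by move=> _ ->.
by move=> /andP[/andP[/eqP -> _] pc] bE; apply: IHp pc bE.
Qed.

Lemma copies_component i (k : vert K) :
  graph_iso (component k) (component ((i, k) : vert copies)).
Proof.
apply: (component_embed (f := fun k => (i, k) : vert copies)) => [x y [] //|x y|x z].
  by rewrite /= /copies_edge eqxx.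
by case: z => j y /andP[/= /eqP <- _]; exists y.
Qed.

Hypothesis K_connected : forall x y : vert K, cn x y.

Lemma copies_cn (a b : vert copies) : cn a b = (a.1 == b.1).
Proof.
apply/idP/eqP; first exact: copies_cn_eq.
case: a b => i k [j l] /= <-; have /connectP[p] := K_connected k l.
elim: p k => [|m p IHp] k /=; first by move=> _ ->.
move=> /andP[km pm] lE; apply: connect_trans (IHp m pm lE); apply: connect1.
by rewrite /= /copies_edge eqxx.
Qed.

End Copies.

Lemma co_copies F (K : graph) n (n_gt0 : (0 < n)%N) : co F K -> co F (copies K n_gt0).
Proof.
move=> FK; case: n n_gt0 => // n; elim: n => [|n IHn] n_gt0.
  apply: (co_iso_class _ FK); exists (fun k => (ord0, k)); split=> [|x y].
    by exists (fun z => z.2) => // -[i k] /=; rewrite (ord1 i).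
  by rewrite /= /copies_edge eqxx.
apply: co_iso_class (co_union FK (IHn isT)).
exists (fun z => match z with inl k => (ord0, k) | inr z => (lift ord0 z.1, z.2) end
  : 'I_n.+2 * vert K).
split.
  apply: inj_card_bij => [x y E|].
    case: x y E => [k|[i k]] [l|[j l]] E; move: (congr1 fst E) (congr1 snd E) => /= e1 e2.
    - by rewrite e2.
    - by case/eqP: (neq_lift ord0 j).
    - by case/eqP: (neq_lift ord0 i).
    - by rewrite e2 (lift_inj e1).
  by rewrite /= card_sum !card_prod !card_ord -mulSn.
move=> [k|[i k]] [l|[j l]] //=; rewrite /copies_edge /= ?eqxx //.
Qed.

Lemma component_inner (G : graph) (a : vert G) (x : vert (component a)) :
  same_type x (val x).
Proof.
apply/asboolP; apply: (component_embed (f := fun x : vert (component a) => val x)) => //.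
  by move=> y z /val_inj.
move=> y z yz; have az : cn a z by apply: connect_trans (svalP y) (connect1 yz).
by exists (exist _ z az).
Qed.

Lemma component_conn (G : graph) (a : vert G) (x y : vert (component a)) : cn x y.
Proof.
have cx : #|[pred z | cn x z]| = #|{: vert (component a)}|.
  rewrite -card_component (graph_iso_card (elimT (asboolP _) (component_inner x))).
  by apply/esym/graph_iso_card/component_eq/(svalP x).
have /subset_cardP/(_ (subset_predT _))/(_ y) := cx.
by rewrite !inE.
Qed.

(** [n] is the number of components, counted by canonical representatives; there is a single type,
    so [iso_of_component_counts] only has to compare numbers of vertices. *)
Lemma iso_copies (G : graph) (a : vert G) : (forall x : vert G, same_type a x) ->
  exists n (n_gt0 : (0 < n)%N), graph_iso (copies (component a) n_gt0) G.
Proof.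
move=> h; have sym := sym_connect_sym (@edge_sym G).
pose n := #|[pred r : vert G | fingraph.root (@edge G) r == r]|.
have cG : #|vert G| = (n * #|vert (component a)|)%N.
  rewrite -sum1_card (partition_big (fingraph.root (@edge G)) [pred r | fingraph.root (@edge G) r == r]) /=.
    rewrite -sum_nat_const; apply: eq_bigr => r /eqP rr; rewrite sum1_card.
    rewrite (graph_iso_card (elimT (asboolP _) (h r))) card_component.
    apply: eq_card => x; transitivity (fingraph.root (@edge G) x == r); first by [].
    by rewrite -[X in _ == X]rr (root_connect sym) sym.
  by move=> x _; apply: (roots_root sym x).
have n0 : (0 < n)%N by move: (vert_gt0 G); rewrite cG muln_gt0 => /andP[].
exists n, n0; apply: iso_of_component_counts => [|[i k]].
  by rewrite /= card_prod card_ord.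
have tk (x : vert (component a)) : same_type x a.
  by apply: same_type_trans (component_inner x) (same_type_cn _); rewrite cn_sym; apply: (svalP x).
have tc (z : vert (copies (component a) n0)) : same_type z a.
  case: z => j x; apply: same_type_trans (tk x); rewrite same_type_sym.
  exact/asboolP/copies_component.
rewrite (eq_card (B := predT)) => [|z]; last first.
  by rewrite !inE (same_type_eql _ (tc _)) same_type_sym tc.
rewrite [RHS](eq_card (B := predT)) => [|z]; last first.
  by rewrite !inE (same_type_eql _ (tc _)) h.
by rewrite cG /= card_prod card_ord.
Qed.

Section QuCopies.
Variables (C : numClosedFieldType) (K : graph) (n : nat) (n_gt0 : (0 < n)%N).
Hypothesis K_connected : forall x y : vert K, cn x y.

Local Notation nK := (copies K n_gt0).
Local Notation A := (Qu_alg C nK).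
Let U := @Qu_mat C nK.
Let hU : qmagic (H := nK) (G := nK) 1 U := Qu_qmagic C nK.

Lemma sum_copies (B : nmodType) (F : vert nK -> B) :
  \sum_a F a = \sum_j \sum_l F (j, l).
Proof. by rewrite pair_bigA; apply: eq_bigr => [[j l]]. Qed.

Lemma sum_component (B : nmodType) (F : vert nK -> B) a :
  \sum_(b | cn a b) F b = \sum_l F (a.1, l).
Proof.
rewrite big_mkcond sum_copies (bigD1 a.1) //= [X in _ + X]big1 ?addr0 => [|j ji]; last first.
  by apply: big1 => l _; rewrite (copies_cn K_connected) /= eq_sym (negbTE ji).
by apply: eq_bigr => l _; rewrite (copies_cn K_connected) eqxx.
Qed.

Lemma wreath_mat_Qu_rels :
  Qu_rels (G := nK) (fun z => @wreath_mat C (Qu C K) n n_gt0 z.1 z.2).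
Proof.
have hw := wreath_Ps (Qu C K) n_gt0.
apply: qmagic_Qu_rels => [x y|]; first exact: (Ps_star hw).
split=> [x a b|x y a|x|a|].
- exact: (Ps_mulr hw).
- exact: (Ps_mulc hw).
- exact: (Ps_row hw).
- exact: (Ps_col hw).
move=> [i k] [i' k'] [j l] [j' l'] /=; rewrite /copies_edge /wreath_mat /= => ne.
have hS := Ps_hom (qmat_Ps (Splus C n_gt0)) (wreath_S_hom (Qu C K) n_gt0).
pose p i j := wreath_S (Qu C K) (@qmat C (Splus C n_gt0) i j).
have pr i1 i2 i3 : p i1 i2 * p i1 i3 = if i2 == i3 then p i1 i2 else 0 := Ps_mulr hS i1 i2 i3.
have pc i1 i2 i3 : p i2 i1 * p i3 i1 = if i2 == i3 then p i2 i1 else 0 := Ps_mulc hS i1 i2 i3.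
have hN := wreath_nu_hom (Qu C K) n_gt0.
rewrite mulrA; have [ii|ii] := eqVneq i i'; have [jj|jj] := eqVneq j j'.
- move: ne; rewrite -ii -jj !eqxx /= => ne.
  rewrite -(mulrA (wreath_nu _ _ _)) -wreath_comm mulrA.
  have [_ nM nC _] := hN i; have E := qmagic_edge (Qu_qmagic C K) ne.
  by rewrite -nM [X in wreath_nu _ _ X]E -(inC0 (Qu_alg C K)) nC inC0 !mul0r.
- rewrite -ii -(mulrA (wreath_nu _ _ _)) -wreath_comm -!mulrA.
  by rewrite -[X in _ * (_ * X)]/(p i j * p i j') pr (negbTE jj) !mulr0.
- rewrite -jj -mulrA [X in _ * X]wreath_comm mulrA -(mulrA (wreath_nu _ _ _)).
  by rewrite -[X in _ * X * _]/(p i j * p i' j) pc (negbTE ii) mulr0 mul0r.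
- by move: ne; rewrite (negbTE ii) (negbTE jj).
Qed.

(** The image of [nu_i(u_kl)] in [Qu] of the copies: in the wreath product, summing the coefficients
    [nu_i(u_kl) p_ij] over [j] removes [p_ij]. *)
Definition row_copy (i : 'I_n) (z : vert K * vert K) : A := \sum_j U (i, z.1) (j, z.2).

(** Rows of one copy are connected while columns of distinct copies are not, so cross terms vanish
    and the relations hold copy by copy. The column sums come from [block_col]. *)
Lemma row_copy_Qu_rels i : Qu_rels (G := K) (row_copy i).
Proof.
have cross k k' j j' l l' : j != j' -> U (i, k) (j, l) * U (i, k') (j', l') = 0.
  move=> jj; apply: (qmagic_connect hU).
  by rewrite !(copies_cn K_connected) /= eqxx (negbTE jj).
have mulE k k' l l' : row_copy i (k, l) * row_copy i (k', l') =
    \sum_j U (i, k) (j, l) * U (i, k') (j, l').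
  rewrite /row_copy mulr_suml; apply: eq_bigr => j _.
  rewrite mulr_sumr (bigD1 j) //= big1 ?addr0 // => j' jj.
  by rewrite cross // eq_sym.
apply: qmagic_Qu_rels => [x y|].
  by rewrite /row_copy star_sum; apply: eq_bigr => j _; apply: Qu_mat_star.
split=> [k l l'|k k' l|k|l|k k' l l' ne].
- rewrite mulE; case: eqP => [<-|/eqP ll].
    by apply: eq_bigr => j _; rewrite (qmagic_idem hU).
  rewrite big1 // => j _; rewrite (qmagic_mulr hU) xpair_eqE eqxx.
  by rewrite (negbTE ll).
- rewrite mulE; case: eqP => [<-|/eqP kk].
    by apply: eq_bigr => j _; rewrite (qmagic_idem hU).
  rewrite big1 // => j _; rewrite (qmagic_mulc hU) xpair_eqE eqxx.
  by rewrite (negbTE kk).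
- by rewrite /row_copy exchange_big /= -(qmagic_row hU (i, k)) [RHS]sum_copies.
- rewrite /row_copy exchange_big /=.
  transitivity (\sum_j \sum_m U (i, l) (j, m)).
    apply: eq_bigr => j _.
    by rewrite -[RHS](sum_component (U (i, l)) (j, l)) [RHS](block_col hU) sum_component.
  by rewrite -(qmagic_row hU (i, l)) [RHS]sum_copies.
rewrite mulE big1 // => j _; apply: (qmagic_edge hU).
by rewrite /= /copies_edge !eqxx.
Qed.

End QuCopies.

Section QuCopiesIso.
Variables (C : numClosedFieldType) (K : graph) (n : nat) (n_gt0 : (0 < n)%N).
Hypothesis K_connected : forall x y : vert K, cn x y.

Local Notation nK := (copies K n_gt0).
Local Notation A := (Qu_alg C nK).
Let U := @Qu_mat C nK.
Let hU : qmagic (H := nK) (G := nK) 1 U := Qu_qmagic C nK.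

Variable k0 : vert K.
(** The image of [p_ij]: the block between the copies [i] and [j]. The base row [k0] may be any row,
    by [perm_copy_row]. *)
Definition perm_copy (z : 'I_n * 'I_n) : A := \sum_l U (z.1, k0) (z.2, l).

Lemma perm_copy_row k i j : perm_copy (i, j) = \sum_l U (i, k) (j, l).
Proof.
rewrite /perm_copy -[LHS](sum_component K_connected (U (i, k0)) (j, k0)).
rewrite -[RHS](sum_component K_connected (U (i, k)) (j, k0)).
by apply: (block_cnl hU (j, k0)); rewrite (copies_cn K_connected).
Qed.

Lemma perm_copy_col l i j : perm_copy (i, j) = \sum_k U (i, k) (j, l).
Proof.
rewrite (perm_copy_row l) -[LHS](sum_component K_connected (U (i, l)) (j, l)).
by rewrite [LHS](block_col hU) sum_component.
Qed.

Lemma perm_copy_star z : star (perm_copy z) = perm_copy z.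
Proof. by rewrite /perm_copy star_sum; apply: eq_bigr => l _; apply: Qu_mat_star. Qed.

Lemma mat_perm_copy i j i' k l :
  U (i, k) (j, l) * perm_copy (i, i') = if i' == j then U (i, k) (j, l) else 0.
Proof.
rewrite (perm_copy_row k) mulr_sumr; case: eqP => [->|/eqP ne].
  rewrite (bigD1 l) //= (qmagic_idem hU) big1 ?addr0 // => m ml.
  by rewrite (qmagic_mulr hU) xpair_eqE eqxx eq_sym (negbTE ml).
by rewrite big1 // => m _; rewrite (qmagic_mulr hU) xpair_eqE eq_sym (negbTE ne).
Qed.

Lemma perm_copy_mat i j i' k l :
  perm_copy (i, i') * U (i, k) (j, l) = if i' == j then U (i, k) (j, l) else 0.
Proof.
have E := congr1 star (mat_perm_copy i j i' k l).
rewrite starM perm_copy_star Qu_mat_star in E; rewrite E.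
by case: ifP => _; rewrite ?star0 ?Qu_mat_star.
Qed.

Lemma perm_copy_Splus_rels : Splus_rels perm_copy.
Proof.
have hr i j j' : perm_copy (i, j) * perm_copy (i, j') =
    if j == j' then perm_copy (i, j) else 0.
  rewrite {1 3}/perm_copy mulr_suml /=; case: eqP => [<-|/eqP ne].
    by apply: eq_bigr => l _; rewrite mat_perm_copy eqxx.
  by rewrite big1 // => l _; rewrite mat_perm_copy eq_sym (negbTE ne).
split; first split=> [i j|i j|i|j].
- exact: perm_copy_star.
- by rewrite hr eqxx.
- by rewrite -(qmagic_row hU (i, k0)) [RHS]sum_copies.
- rewrite -(qmagic_col hU (j, k0)) [RHS]sum_copies.
  by apply: eq_bigr => i _; apply: perm_copy_col.
- by move=> i j j' ne; rewrite hr (negbTE ne).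
move=> i j j' ne; rewrite (perm_copy_col k0 j) (perm_copy_col k0 j') mulr_suml big1 // => k _.
rewrite mulr_sumr big1 // => k' _; rewrite (qmagic_mulc hU) xpair_eqE.
by rewrite (negbTE ne).
Qed.

Lemma row_copy_perm_copy i j k l :
  row_copy C n_gt0 i (k, l) * perm_copy (i, j) = U (i, k) (j, l).
Proof.
rewrite /row_copy mulr_suml (bigD1 j) //= big1 ?addr0 => [|j' jj].
  by rewrite mat_perm_copy eqxx.
by rewrite mat_perm_copy eq_sym (negbTE jj).
Qed.

Lemma perm_copy_row_copy i j k l :
  perm_copy (i, j) * row_copy C n_gt0 i (k, l) = U (i, k) (j, l).
Proof.
rewrite /row_copy mulr_sumr (bigD1 j) //= big1 ?addr0 => [|j' jj].
  by rewrite perm_copy_mat eqxx.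
by rewrite perm_copy_mat eq_sym (negbTE jj).
Qed.

Let f i := pres_lift (row_copy_Qu_rels C n_gt0 K_connected i).
Let g := pres_lift perm_copy_Splus_rels.

Let f_mat i k l : f i (Qu_mat C k l) = row_copy C n_gt0 i (k, l).
Proof. exact: (pres_liftE (row_copy_Qu_rels C n_gt0 K_connected i)). Qed.
Let g_mat i j : g (Splus_mat C i j) = perm_copy (i, j).
Proof. exact: (pres_liftE perm_copy_Splus_rels). Qed.

Let fg i j a : f i a * g (Splus_mat C i j) = g (Splus_mat C i j) * f i a.
Proof.
move: a; apply: (Qu_generates (G := K)).
  by apply: star_subalg_commute; [apply: starMorphismP | rewrite g_mat perm_copy_star].
by move=> _ [k [l ->]]; rewrite f_mat g_mat row_copy_perm_copy perm_copy_row_copy.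
Qed.

Lemma Qu_copies_pointed : qperm_iso (Qu C nK) (qwreath (Qu C K) n_gt0).
Proof.
pose F := wreath_lift (Q := Qu C K) (n_gt0 := n_gt0)
  (fun i => starMorphismP (f i)) (starMorphismP g) fg.
apply: (@Qu_iso_intro C nK (qwreath (Qu C K) n_gt0) id F).
- by exists id.
- exact: wreath_mat_Qu_rels.
move=> [i k] [j l]; have [_ FM _ _] := starMorphismP F.
rewrite [LHS]FM [X in X * _]wreath_lift_nu [X in _ * X]wreath_lift_S.
by rewrite [X in X * _]f_mat [X in _ * X]g_mat row_copy_perm_copy.
Qed.

End QuCopiesIso.

Lemma Qu_copies (C : numClosedFieldType) (K : graph) n (n_gt0 : (0 < n)%N) :
  (forall x y : vert K, cn x y) ->
  qperm_iso (Qu C (copies K n_gt0)) (qwreath (Qu C K) n_gt0).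
Proof.
by have [k0 _] := elimT card_gt0P (vert_gt0 K) => hK; apply: Qu_copies_pointed.
Qed.

(** * The Jordan decomposition *)

Fact unit_gt0 : (0 < #|{: unit}|)%N.
Proof. by rewrite card_unit. Qed.

Definition point_graph : graph := Graph (vert := unit) (edge := fun _ _ => false)
  (fun _ _ => erefl) (fun _ => erefl) unit_gt0.

Lemma induced_same_type (G : graph) (S : pred (vert G)) (S0 : exists x, S x)
    (x : vert (induced S0)) :
  (forall y z, S y -> edge y z -> S z) -> same_type x (val x).
Proof.
move=> hS; apply/asboolP.
apply: (component_embed (f := fun x : vert (induced S0) => val x)) => //.
  by move=> y z /val_inj.
by move=> y z yz; exists (exist _ z (hS _ _ (svalP y) yz)).
Qed.

Lemma induced_lt (G : graph) (S : pred (vert G)) (S0 : exists x, S x) y :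
  ~~ S y -> (#|vert (induced S0)| < #|vert G|)%N.
Proof.
move=> Sy; rewrite card_induced; apply: proper_card; apply/properP; split.
  exact: subset_predT.
by exists y.
Qed.

Section Jordan.
Variable R : realType.
Local Notation C := (R[i]).
Local Notation coF := (co graphs_le5).
Implicit Types (G H K : graph) (Q : qperm C).

Lemma Qu_mat_same_type G : coF G ->
  forall x a : vert G, ~~ same_type x a -> Qu_mat C x a = 0.
Proof.
move=> FG x a; apply: contraNeq.
apply: (quantum_rigid_same_type (@star_natregular C _) (Qu_qmagic C G)) => b.
exact/co_le5_quantum_rigid/co_le5_induced.
Qed.

Lemma same_type_union G H (x : vert G) (y : vert H) :
  @same_type (graph_union G H) (graph_union G H) (inl x) (inr y) = same_type x y.
Proof.
have hl : @same_type G (graph_union G H) x (inl x).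
  apply/asboolP; apply: (component_embed (f := inl : vert G -> vert (graph_union G H))) => //.
    by move=> a b [].
  by move=> a [b|//] _; exists b.
have hr : @same_type H (graph_union G H) y (inr y).
  apply/asboolP; apply: (component_embed (f := inr : vert H -> vert (graph_union G H))) => //.
    by move=> a b [].
  by move=> a [//|b] _; exists b.
by rewrite -(same_type_eql _ hl) same_type_sym -(same_type_eql _ hr) same_type_sym.
Qed.

Lemma Qu_union_types G H : coF G -> coF H ->
  (forall (x : vert G) (y : vert H), ~~ same_type x y) ->
  qperm_iso (Qu C (graph_union G H)) (qfree (Qu C G) (Qu C H)).
Proof.
move=> FG FH h; apply: Qu_union => x y; apply: (Qu_mat_same_type (co_union FG FH)).
  by rewrite same_type_union.
by rewrite same_type_sym same_type_union.
Qed.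

(** A disconnected graph whose components are all isomorphic consists of copies of one, hence a
    wreath product. Otherwise the components of the type of [a] and the remaining ones form two
    smaller graphs without common type, hence a free product. *)
Lemma Jor_Qu G : coF G -> Jor (Qu_family graphs_le5) (Qu C G).
Proof.
move: G; apply: co_le5_ind => [G G5 _|G FG sG IH|G IH]; last first.
- exact: Jor_iso (qperm_iso_sym (Qu_compl C G)) IH.
- have [a _] := elimT card_gt0P (vert_gt0 G).
  have [h|] := boolP [forall x : vert G, same_type a x].
    have [n [n0 iso]] := iso_copies (elimT forallP h).
    apply: (Jor_iso (Qu_graph_iso C iso)).
    apply: (Jor_iso (qperm_iso_sym (Qu_copies C n0 (@component_conn G a)))).
    by apply: Jor_wreath; apply: IH; [apply: co_le5_induced | apply: component_lt].
  rewrite negb_forall => /existsP[b ab].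
  pose S : pred (vert G) := fun x => same_type a x.
  have S0 : exists x, S x by exists a; apply: same_type_refl.
  have S1 : exists x, [predC S] x by exists b.
  have hS y z : S y -> edge y z -> S z.
    by move=> ay yz; apply: same_type_trans ay (same_type_cn (connect1 yz)).
  have hS' y z : [predC S] y -> edge y z -> [predC S] z.
    by move=> ay yz; apply: contra ay => az; apply: (hS z y az); rewrite edge_sym.
  have iso : graph_iso (graph_union (induced S0) (induced S1)) G.
    by apply: split_union_iso => x y Sx; apply: contra => xy; apply: hS xy.
  apply: (Jor_iso (Qu_graph_iso C iso)).
  have F0 := co_le5_induced S0 FG; have F1 := co_le5_induced S1 FG.
  have hST (x : vert (induced S0)) (y : vert (induced S1)) : ~~ same_type x y.
    rewrite (same_type_eql _ (induced_same_type x hS)) same_type_sym.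
    rewrite (same_type_eql _ (induced_same_type y hS')) same_type_sym.
    by apply: contra (svalP y) => xy; apply: same_type_trans (svalP x) xy.
  apply: (Jor_iso (qperm_iso_sym (Qu_union_types F0 F1 hST))).
  apply: Jor_free; apply: IH => //.
    exact: (induced_lt S0 ab).
  by apply: (@induced_lt G _ S1 a); rewrite negbK; apply: same_type_refl.
by apply: Jor_base; exists G => //; apply: qperm_iso_refl.
Qed.

(** A graph or its complement is connected, and [Qu] is the same for both. Connectedness is what
    [Qu_union_connected] and [Qu_copies] ask for. *)
Lemma connected_model G : coF G -> exists K, [/\ coF K,
  forall x y : vert K, cn x y & qperm_iso (Qu C K) (Qu C G)].
Proof.
move=> FG; have [h|h] := connected_or_compl G.
  by exists G; split=> //; apply: qperm_iso_refl.
exists (graph_compl G); split=> //; first exact: co_compl.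
exact/qperm_iso_sym/Qu_compl.
Qed.

Lemma Qu_union_connected G H : coF G -> coF H ->
  (forall x y : vert G, cn x y) -> (forall x y : vert H, cn x y) -> ~ graph_iso G H ->
  qperm_iso (Qu C (graph_union G H)) (qfree (Qu C G) (Qu C H)).
Proof.
move=> FG FH cG cH nGH; apply: Qu_union_types => // x y.
apply/negP => /asboolP h; apply: nGH.
apply: graph_iso_trans (component_connected cH y).
exact: graph_iso_trans (graph_iso_sym (component_connected cG x)) h.
Qed.

Lemma Qu_free G H : coF G -> coF H ->
  exists2 K, coF K & qperm_iso (Qu C K) (qfree (Qu C G) (Qu C H)).
Proof.
move=> /connected_model[G' [FG' cG iG]] /connected_model[H' [FH' cH iH]].
suff [K FK iK] : exists2 K, coF K & qperm_iso (Qu C K) (qfree (Qu C G') (Qu C H')).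
  by exists K => //; apply: qperm_iso_trans iK (qfree_iso iG iH).
(* The one-vertex case is apart: adding a point to a point would create two exchangeable components,
   hence a new symmetry. *)
have [H1|H1] := eqVneq #|vert H'| 1%N.
  have [t l] := Qu_one_vertex C H1; exists G' => //.
  exact: qfree_trivialr.
have [iGH|nGH] := pselect (graph_iso G' H'); last first.
  by exists (graph_union G' H'); [apply: co_union | apply: Qu_union_connected].
(* [H'] is replaced by the connected graph [(H' + K1)^c], which has the same  *)
(* quantum automorphism group but one more vertex.                                    *)
pose L := graph_compl (graph_union H' point_graph).
have FP : coF point_graph by apply: co_base; rewrite /graphs_le5 /= card_unit.
have FL : coF L by apply: co_compl; apply: co_union.
have cL : forall x y : vert L, cn x y.
  exact: split_compl_connected (split_graph_union H' point_graph).
have iL : qperm_iso (Qu C L) (Qu C H').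
  have [t l] := Qu_one_vertex C (card_unit : #|vert point_graph| = 1%N).
  apply: qperm_iso_trans (qperm_iso_sym (Qu_compl C _)) _.
  apply: qperm_iso_trans (qperm_iso_sym (qfree_trivialr _ t l)).
  apply: Qu_union_connected => //.
    by move=> [] [].
  by move=> /graph_iso_card; rewrite [RHS]card_unit => /eqP; apply/negP.
exists (graph_union G' L); first exact: co_union.
apply: qperm_iso_trans (Qu_union_connected FG' FL cG cL _) _.
  move=> /graph_iso_card /eqP; rewrite (graph_iso_card iGH) /= card_sum card_unit.
  by rewrite addn1 eqn_leq ltnn andbF.
exact: qfree_iso (qperm_iso_refl _) iL.
Qed.

Lemma Qu_family_Jor Q : Jor (Qu_family graphs_le5) Q -> Qu_family coF Q.
Proof.
elim=> {Q} [Q [G G5 iG]|Q Q' _ [G FG iG] _ [H FH iH]|Q n n0 _ [G FG iG]|Q Q' iQ _ [G FG iG]].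
- by exists G => //; apply: co_base.
- have [K FK iK] := Qu_free FG FH.
  by exists K => //; apply: qperm_iso_trans iK (qfree_iso iG iH).
- have [K [FK cK iK]] := connected_model FG.
  exists (copies K n0); first exact: co_copies.
  apply: qperm_iso_trans (Qu_copies C n0 cK) _.
  exact: qwreath_iso (qperm_iso_trans iK iG).
by exists G => //; apply: qperm_iso_trans iG iQ.
Qed.

End Jordan.

Theorem theorem5p24 (R : realType) :
  [/\ tractable R[i] (co graphs_le5),
      superrigid R[i] (co graphs_le5) &
      forall Q : qperm R[i],
        Qu_family (co graphs_le5) Q <-> Jor (Qu_family graphs_le5) Q].
Proof.
split; last 1 first.
- move=> Q; split=> [[G FG iG]|]; last exact: Qu_family_Jor.
  exact: Jor_iso iG (Jor_Qu R FG).
- split=> [G FG|G H FG FH|G FG].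
  + by split; [apply: Qu_trivial_aut | apply: aut_trivial_Qu].
  + by split; [apply: co_le5_superrigid | apply: iso_quantum_iso].
  + by split; [apply: quantum_symmetry_schmidt | apply: schmidt_quantum_symmetry].
exact: co_le5_superrigid.
Qed.
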